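(* Let $\Xi\subseteq\Pi$. The pairing $\mathbf D_{F,\Xi}^\star\times\mathbf D_{F,\Xi}^\star\to\mathbf D_{F,\Pi}^\star\simeq S$ defined by sending $(\sigma,\sigma')$ to $\mathcal A_{\Pi/\Xi}(\sigma\sigma')$ is non-degenerate, and $\{\mathcal A_\Xi(B_{I_w^{\mathrm{rev}}}(x_\Pi f_e))\}_{w\in W^\Xi}$ and $\{(X_{I_v}^\Xi)^\star\}_{v\in W^\Xi}$ are dual bases.
   Context: Setting. $R$ is a commutative ring with unit and $F\in R[[x,y]]$ is a one-dimensional commutative formal group law. $(\Lambda,\Sigma)$ is a reduced semisimple root datum: $\Lambda$ is a free abelian group of finite rank, $\Sigma\subset\Lambda$ is the finite set of roots with coroots $\alpha^\vee\in\Lambda^\vee$, and $\Sigma$ spans $\Lambda\otimes\mathbb Q$. $\Pi=\{\alpha_1,\dots,\alpha_n\}$ is a set of simple roots, $\Sigma^{\pm}$ are the positive/negative roots, $W$ is the Weyl group generated by $s_\alpha(\lambda)=\lambda-\alpha^\vee(\lambda)\alpha$, $s_i=s_{\alpha_i}$, $\ell$ is the length function, $e$ the neutral element. The formal group algebra $S=R[[\Lambda]]_F$ is the quotient of $R[[x_\lambda,\lambda\in\Lambda]]$ (completion of the polynomial ring at the augmentation ideal) by the closure of the ideal generated by $x_0$ and all $x_{\lambda+\mu}-F(x_\lambda,x_\mu)$; $W$ acts by $w(x_\lambda)=x_{w(\lambda)}$. Standing assumption: $x_\alpha$ is not a zero divisor in $S$ for all $\alpha\in\Sigma$. $Q=S[x_\alpha^{-1}\mid\alpha\in\Sigma]$.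 $Q_W$ is the free left $Q$-module with basis $(\delta_w)_{w\in W}$ and product $(q\delta_w)(q'\delta_{w'})=q\,w(q')\,\delta_{ww'}$. Put $X_i=\frac1{x_{\alpha_i}}(1-\delta_{s_i})$; for $I=(i_1,\dots,i_m)$ put $X_I=X_{i_1}\cdots X_{i_m}$, $X_\emptyset=1$, $I^{\mathrm{rev}}=(i_m,\dots,i_1)$. $\mathbf D_F\subseteq Q_W$ is the $R$-subalgebra generated by $S$ and $X_1,\dots,X_n$. $Q_W^*=\mathrm{Hom}_Q(Q_W,Q)$ has basis $(f_w)$ dual to $(\delta_w)$, and $Q_W$ acts on it by $(z\bullet f)(z')=f(z'z)$; $B_i(f)=X_i\bullet f$, $B_I=B_{i_1}\circ\cdots\circ B_{i_m}$, $B_\emptyset=\mathrm{id}$. $\mathbf D_F^\star=\mathrm{Hom}_S(\mathbf D_F,S)$ is identified with $\{f\in Q_W^*\mid f(\mathbf D_F)\subseteq S\}$; it contains $x_\Pi f_e$, where $x_\Pi=\prod_{\alpha\in\Sigma^-}x_\alpha$, and is stable under the $B_I$. For $\Xi\subseteq\Pi$: $W_\Xi$ is the subgroup generated by $s_\alpha$, $\alpha\in\Xi$; $\Sigma_\Xi^-=\{\alpha\in\Sigma^-\mid s_\alpha\in W_\Xi\}$; for $\Xi'\subseteq\Xi$, $x_{\Xi/\Xi'}=\prod_{\alpha\in\Sigma_\Xi^-\setminus\Sigma_{\Xi'}^-}x_\alpha$ (a $W_{\Xi'}$-invariant element). $W^\Xi=\{w\in W\mid\ell(ws_\alpha)>\ell(w)\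 \forall\alpha\in\Xi\}$; for each $w\in W^\Xi$ a reduced sequence $I_w$ is chosen ($w=s_{i_1}\cdots s_{i_m}$, $m=\ell(w)$). $Q_{W/W_\Xi}$ is the free $Q$-module with basis $(\delta_{\bar w})_{\bar w\in W/W_\Xi}$, $p_\Xi\colon Q_W\to Q_{W/W_\Xi}$ is the $Q$-linear map $\delta_w\mapsto\delta_{\bar w}$, $\mathbf D_{F,\Xi}=p_\Xi(\mathbf D_F)$ and $X_{I_w}^\Xi=p_\Xi(X_{I_w})$; $(X_{I_w}^\Xi)_{w\in W^\Xi}$ is an $S$-basis of $\mathbf D_{F,\Xi}$, and $((X_{I_w}^\Xi)^\star)_{w\in W^\Xi}$ is the dual $S$-basis of $\mathbf D_{F,\Xi}^\star=\mathrm{Hom}_S(\mathbf D_{F,\Xi},S)$. The dual $Q_{W/W_\Xi}^*$ has basis $(f_{\bar w})$ dual to $(\delta_{\bar w})$ and $Q$-bilinear product $f_{\bar v}f_{\bar w}=\delta_{\bar v,\bar w}f_{\bar v}$ (Kronecker symbol); $\mathbf D_{F,\Xi}^\star$ is identified with the subring $\{f\in Q_{W/W_\Xi}^*\mid f(\mathbf D_{F,\Xi})\subseteq S\}$. One has $\mathbf D_{F,\emptyset}=\mathbf D_F$ and $\mathbf D_{F,\Pi}=S\delta_{\bar e}$, so $\mathbf D_{F,\Pi}^\star\simeq S$ via $sf_{\bar e}\leftrightarrow s$. For $\Xi'\subseteq\Xi$, $\mathcal A_{\Xi/\Xi'}\colon Q_{W/W_{\Xi'}}^*\to Q_{W/W_\Xi}^*$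 is the $Q$-linear map $f_{\bar w}\mapsto\frac1{w(x_{\Xi/\Xi'})}f_{\hat w}$, where $\hat w\in W/W_\Xi$ is the class of $\bar w\in W/W_{\Xi'}$; it restricts to a map $\mathbf D_{F,\Xi'}^\star\to\mathbf D_{F,\Xi}^\star$. $\mathcal A_\Xi=\mathcal A_{\Xi/\emptyset}$. *)

(* Defs.v *)
From HB Require Import structures.
From mathcomp Require Import all_boot all_order all_algebra all_fingroup ring.
From mathcomp Require Import finmap monalg.
From mathcomp Require Import boolp.

Set Implicit Arguments.
Unset Strict Implicit.
Unset Printing Implicit Defensive.

Import GRing.Theory Num.Theory.
Local Open Scope ring_scope.
Local Open Scope quotient_scope.

(* R[[x_i, i in I]]: the completion of the polynomial ring
   {malg R[{cmonom I}]} at its augmentation ideal. An element is the family of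
   its homogeneous components, each of which is a polynomial; for infinite I
   this allows infinitely many variables overall, but finitely many in each
   degree. *)
Section Series.
Variables (I : choiceType) (R : comNzRingType).
Local Notation mpoly := {malg R[{cmonom I}]}.

Definition homogeneous (d : nat) (p : mpoly) : Prop :=
  forall m : {cmonom I}, m \in msupp p -> mdeg m = d.

Definition graded (f : nat -> mpoly) : Prop :=
  forall d, homogeneous d (f d).

Record series := Series {
  component :> nat -> mpoly;
  component_graded : `[< graded component >] }.

HB.instance Definition _ := [isSub for component].
HB.instance Definition _ := [Choice of series by <:].

Lemma seriesP (f g : series) : (forall d, f d = g d) -> f = g.
Proof. by move=> fg; apply: val_inj; apply: funext. Qed.

Lemma homog_component (f : series) d : homogeneous d (f d).
Proof. by case: f => f /= /asboolP. Qed.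

Lemma homog0 d : homogeneous d 0.
Proof. by move=> m; rewrite msupp0 in_fset0. Qed.

Lemma homogD d p q : homogeneous d p -> homogeneous d q ->
  homogeneous d (p + q).
Proof.
by move=> hp hq m /(fsubsetP (msuppD_le _ _)); rewrite in_fsetU => /orP[/hp|/hq].
Qed.

Lemma homogN d p : homogeneous d p -> homogeneous d (- p).
Proof. by move=> hp m; rewrite msuppN => /hp. Qed.

Lemma homogM d e p q : homogeneous d p -> homogeneous e q ->
  homogeneous (d + e) (p * q).
Proof.
move=> hp hq m /msuppM_le[m1 [m2 [/hp <- /hq <- ->]]].
by rewrite mdegM.
Qed.

Lemma homogZ d c p : homogeneous d p -> homogeneous d (c *: p).
Proof. by move=> hp m /(fsubsetP (msuppZ_le _ _)) /hp. Qed.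

Lemma homogU d c m : mdeg m = d -> homogeneous d << c *g m >>.
Proof.
by move=> md m' /(fsubsetP (msuppU_le)); rewrite in_fset1 => /eqP ->.
Qed.

Lemma homog_sum d (T : Type) (s : seq T) (P : pred T) (G : T -> mpoly) :
  (forall t, P t -> homogeneous d (G t)) ->
  homogeneous d (\sum_(t <- s | P t) G t).
Proof.
move=> hG; apply: (big_ind (homogeneous d)) => //; first exact: homog0.
by move=> p q; apply: homogD.
Qed.

Definition mk_series (f : nat -> mpoly) (gf : graded f) : series :=
  Series (asboolT gf).

Lemma series_opp_graded (f : series) : graded (fun d => - f d).
Proof. by move=> d; apply/homogN/homog_component. Qed.

Lemma series_add_graded (f g : series) : graded (fun d => f d + g d).
Proof. by move=> d; apply: homogD; apply: homog_component. Qed.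

Lemma series_mul_graded (f g : series) :
  graded (fun d => \sum_(i < d.+1) f i * g (d - i)%N).
Proof.
move=> d; apply: homog_sum => i _.
have {1}-> : d = (i + (d - i))%N by rewrite subnKC // -ltnS.
by apply: homogM; apply: homog_component.
Qed.

Lemma series_const_graded (c : R) :
  graded (fun d => if d == 0%N then c%:MP else 0).
Proof.
by case=> [|d] /=; [apply: homogU; rewrite mdeg1 | apply: homog0].
Qed.

Lemma series_var_graded (i : I) :
  graded (fun d => if d == 1%N then << ucm i >> else 0).
Proof.
by move=> [|[|d]] /=; try exact: homog0; apply: homogU; rewrite mdegU.
Qed.

Definition series_const c := mk_series (@series_const_graded c).
Definition series_var i := mk_series (@series_var_graded i).
Definition series_opp f := mk_series (@series_opp_graded f).
Definition series_add f g := mk_series (@series_add_graded f g).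
Definition series_mul f g := mk_series (@series_mul_graded f g).

Lemma series_addA : associative series_add.
Proof. by move=> f g h; apply: seriesP => d /=; rewrite addrA. Qed.
Lemma series_addC : commutative series_add.
Proof. by move=> f g; apply: seriesP => d /=; rewrite addrC. Qed.
Lemma series_add0 : left_id (series_const 0) series_add.
Proof.
by move=> f; apply: seriesP => d /=; case: eqP => _; rewrite ?malgC0E add0r.
Qed.
Lemma series_addN : left_inverse (series_const 0) series_opp series_add.
Proof.
by move=> f; apply: seriesP => d /=; case: eqP => _; rewrite ?malgC0E addNr.
Qed.

HB.instance Definition _ := GRing.isZmodule.Build series
  series_addA series_addC series_add0 series_addN.

Definition series_trunc (n : nat) (f : series) : {poly mpoly} :=
  \poly_(i < n) f i.

Lemma coef_series_trunc n (f : series) i :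
  (i < n)%N -> (series_trunc n f)`_i = f i.
Proof. by move=> lt_in; rewrite coef_poly lt_in. Qed.

Lemma series_mul_trunc n (f g : series) d : (d < n)%N ->
  series_mul f g d = (series_trunc n f * series_trunc n g)`_d.
Proof.
move=> lt_dn; rewrite coefM /=; apply: eq_bigr => i _.
rewrite !coef_series_trunc //; first exact: leq_ltn_trans (leq_subr _ _) lt_dn.
exact: leq_trans (ltn_ord i) lt_dn.
Qed.

Lemma series_mulC : commutative series_mul.
Proof.
by move=> f g; apply: seriesP => d; rewrite !(series_mul_trunc _ _ (ltnSn d)) mulrC.
Qed.

Lemma coefMl_eq n (p q r : {poly mpoly}) d : (d < n)%N ->
  (forall i, (i < n)%N -> p`_i = q`_i) -> (p * r)`_d = (q * r)`_d.
Proof.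
move=> lt_dn pq; rewrite !coefM; apply: eq_bigr => i _.
by rewrite pq //; apply: leq_trans (ltn_ord i) lt_dn.
Qed.

Lemma series_mulA : associative series_mul.
Proof.
move=> f g h; apply: seriesP => d.
rewrite series_mulC [RHS](series_mul_trunc _ _ (ltnSn d)).
rewrite [LHS](series_mul_trunc _ _ (ltnSn d)).
rewrite (@coefMl_eq d.+1 _ (series_trunc d.+1 g * series_trunc d.+1 h)) //.
  rewrite [RHS](@coefMl_eq d.+1 _ (series_trunc d.+1 f * series_trunc d.+1 g)) //.
    by rewrite mulrC mulrA.
  by move=> i lt_id; rewrite coef_series_trunc // (series_mul_trunc _ _ lt_id).
by move=> i lt_id; rewrite coef_series_trunc // (series_mul_trunc _ _ lt_id).
Qed.

Lemma series_mul1 : left_id (series_const 1) series_mul.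
Proof.
move=> f; apply: seriesP => d /=; rewrite big_ord_recl /= mul1r subn0.
by rewrite big1 ?addr0 // => i _; rewrite mul0r.
Qed.

Lemma series_mulDl : left_distributive series_mul series_add.
Proof.
move=> f g h; apply: seriesP => d /=; rewrite -big_split /=.
by apply: eq_bigr => i _; rewrite mulrDl.
Qed.

Lemma series_1_neq0 : series_const 1 != series_const 0.
Proof.
apply/eqP => /(congr1 (fun f : series => f 0%N)) /= /eqP.
by rewrite malgC0E oner_eq0.
Qed.

HB.instance Definition _ := GRing.Zmodule_isComNzRing.Build series
  series_mulA series_mulC series_mul1 series_mulDl series_1_neq0.

Lemma fgl_eval_graded (a : nat -> nat -> R) (f g : series) :
  graded (fun d => \sum_(i < d.+1) \sum_(j < d.+1)
                     a i j *: (f ^+ i * g ^+ j : series) d).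
Proof.
move=> d; apply: homog_sum => i _; apply: homog_sum => j _.
by apply: homogZ; apply: homog_component.
Qed.

(* The series \sum_(i, j) a_ij f^i g^j, for f and g without constant term:
   then f^i g^j has no component of degree < i + j, so the truncation of the
   sum to i, j <= d is exact in degree d. *)
Definition fgl_eval (a : nat -> nat -> R) (f g : series) : series :=
  mk_series (@fgl_eval_graded a f g).

End Series.

(* F = \sum_(i, j) fgl_coef i j x^i y^j in R[[x, y]] *)
Record formal_group_law (R : comNzRingType) := FormalGroupLaw {
  fgl_coef :> nat -> nat -> R;
  fgl_right0 : let x := @series_var 'I_3 R in
    fgl_eval fgl_coef (x (inord 0)) 0 = x (inord 0);
  fgl_comm : let x := @series_var 'I_3 R in
    fgl_eval fgl_coef (x (inord 0)) (x (inord 1)) =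
    fgl_eval fgl_coef (x (inord 1)) (x (inord 0));
  fgl_assoc : let x := @series_var 'I_3 R in
    fgl_eval fgl_coef (x (inord 0))
      (fgl_eval fgl_coef (x (inord 1)) (x (inord 2))) =
    fgl_eval fgl_coef (fgl_eval fgl_coef (x (inord 0)) (x (inord 1)))
      (x (inord 2)) }.

Lemma fgl_eval0 (I : choiceType) (R : comNzRingType) a (f g : series I R) :
  fgl_eval a f g 0%N = (a 0%N 0%N)%:MP.
Proof.
have -> : fgl_eval a f g 0%N = \sum_(i < 1) \sum_(j < 1)
                     a i j *: (f ^+ i * g ^+ j : series I R) 0%N by [].
rewrite big_ord_recl big_ord0 addr0 big_ord_recl big_ord0 addr0.
rewrite expr0 expr0 mulr1.
rewrite -mul_malgC.
exact: mulr1.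
Qed.

Lemma seriesD (I : choiceType) (R : comNzRingType) (f g : series I R) d : (f + g) d = f d + g d.
Proof. by []. Qed.
Lemma seriesM (I : choiceType) (R : comNzRingType) (f g : series I R) d :
  (f * g) d = \sum_(i < d.+1) f i * g (d - i)%N.
Proof. by []. Qed.

Lemma series_mulr_eq (I : choiceType) (R : comNzRingType) (a f g : series I R) d :
  (forall e, (e <= d)%N -> f e = g e) -> (a * f) d = (a * g) d.
Proof.
move=> fg; rewrite [LHS]seriesM [RHS]seriesM; apply: eq_bigr => i _.
by rewrite fg // leq_subr.
Qed.

Section FormalGroupAlgebra.
Variables (R : comNzRingType) (F : formal_group_law R) (L : zmodType).
Local Notation pseries := (series L R).
Local Notation X := (@series_var L R).

Inductive fga_relation : pseries -> Prop :=
| FgaZero : fga_relation (X 0)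
| FgaAdd l m : fga_relation (X (l + m) - fgl_eval F (X l) (X m)).

Definition in_fga_relations (f : pseries) : Prop :=
  exists n (c r : 'I_n -> pseries),
    (forall i, fga_relation (r i)) /\ f = \sum_i c i * r i.

(* closure for the topology defined by the order of series *)
Definition in_fga_closure (f : pseries) : Prop :=
  forall n, exists2 g, in_fga_relations g & forall d, (d < n)%N -> f d = g d.

Definition fga_ideal : pred pseries := fun f => `[< in_fga_closure f >].

Lemma fgl_coef00 : F 0%N 0%N = 0.
Proof.
have H := fgl_right0 F.
have {H} := congr1 (fun f : series 'I_3 R => f 0%N) H.
rewrite fgl_eval0 /= => /eqP.
by rewrite -malgC0E malgC_eq => /eqP.
Qed.

Lemma series_mul0 (f g : pseries) : (f * g) 0%N = f 0%N * g 0%N.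
Proof. by rewrite seriesM big_ord_recl big_ord0 addr0. Qed.

Lemma series0E d : (0 : pseries) d = 0.
Proof. rewrite /GRing.zero /series_const /=. by rewrite malgC0E if_same. Qed.

Lemma series_sum_component d (T : Type) (s : seq T) (P : pred T)
    (G : T -> pseries) :
  (\sum_(t <- s | P t) G t) d = \sum_(t <- s | P t) G t d.
Proof. by apply: (big_morph (fun f : pseries => f d)) => //; exact: series0E. Qed.

Lemma fga_relation0 (f : pseries) : fga_relation f -> f 0%N = 0.
Proof.
case=> [//|l m].
have -> : (X (l + m) - fgl_eval F (X l) (X m)) 0%N = X (l + m) 0%N - fgl_eval F (X l) (X m) 0%N by [].
by rewrite fgl_eval0 fgl_coef00 malgC0E subr0.
Qed.

Lemma fga_ideal_closed : idealr_closed fga_ideal.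
Proof.
split.
- apply/asboolP => n; exists 0 => //.
  exists 0%N, (fun=> 0), (fun=> 0); split; first by case.
  by rewrite big_ord0.
- apply/negP => /asboolP /(_ 1%N)[g [n [c [r [relr ->]]]] /(_ 0%N isT)].
  rewrite series_sum_component big1 => [|i _]; last first.
    by rewrite series_mul0 (fga_relation0 (relr i)) mulr0.
  move=> H.
  have {H} : ((1 : pseries) 0%N)@_(mone : {cmonom L}) = 0 by rewrite H mcoeff0.
  by rewrite /= mcoeffC eqxx => /eqP; rewrite oner_eq0.
- move=> a f g /asboolP If /asboolP Ig; apply/asboolP => n.
  have [f' [n1 [c1 [r1 [rel1 ->]]]] ff'] := If n.
  have [g' [n2 [c2 [r2 [rel2 ->]]]] gg'] := Ig n.
  exists (a * \sum_i c1 i * r1 i + \sum_i c2 i * r2 i); last first.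
    move=> d lt_dn; rewrite [LHS]seriesD [RHS]seriesD -(gg' d lt_dn).
    apply: (congr1 (fun p => p + g d)).
    apply: series_mulr_eq => e le_ed; apply: ff'; exact: leq_ltn_trans lt_dn.
  exists (n1 + n2)%N.
  exists (fun i => match split i with inl j => a * c1 j | inr j => c2 j end).
  exists (fun i => match split i with inl j => r1 j | inr j => r2 j end).
  split=> [i|]; first by case: split => j; [apply: rel1 | apply: rel2].
  rewrite big_split_ord /= mulr_sumr; congr (_ + _); apply: eq_bigr => i _.
    by rewrite (unsplitK (inl i)) mulrA.
  by rewrite (unsplitK (inr i)).
Qed.

HB.instance Definition _ := isIdealr.Build pseries fga_ideal fga_ideal_closed.

Definition fga_idealr : idealr pseries := Idealr.clone _ fga_ideal _.

(* the formal group algebra R[[L]]_F, with its generators x_l *)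
Definition fga := {ideal_quot fga_idealr}.
HB.instance Definition _ := GRing.ComNzRing.on fga.
Definition fga_var (l : L) : fga := \pi_fga (X l).

End FormalGroupAlgebra.

Definition free_of_finite_rank (L : zmodType) : Prop :=
  exists n (b : 'I_n -> L),
    forall l, exists! c : {ffun 'I_n -> int}, l = \sum_i b i *~ c i.

(* A reduced semisimple root datum. The dual lattice L^\vee is
   {additive L -> int}, whose elements are compared pointwise. *)
Record root_datum (L : zmodType) := RootDatum {
  roots : {fset L};
  coroot : roots -> {additive L -> int};
  lattice_free : free_of_finite_rank L;
  coroot_inj : forall a b : roots, coroot a =1 coroot b -> a = b;
  coroot_self : forall a : roots, coroot a (val a) = 2;
  root_reflection : forall a b : roots,
    val b - val a *~ coroot a (val b) \in roots;
  coroot_reflection : forall a b : roots, exists c : roots,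
    forall l, coroot c l = coroot b l - coroot b (val a) * coroot a l;
  roots_reduced : forall a : roots, val a *+ 2 \notin roots;
  roots_span : forall l : L, exists2 n : nat, (0 < n)%N &
    exists c : {ffun roots -> int}, l *+ n = \sum_a val a *~ c a }.

Definition root_type L (D : root_datum L) : finType := roots D.

Section WeylGroup.
Variables (L : zmodType) (D : root_datum L).

Definition reflection (a : root_type D) (l : L) : L := l - val a *~ coroot a l.

Definition reflections (s : seq (root_type D)) : L -> L :=
  foldr (fun a g => reflection a \o g) id s.

(* The Weyl group: the transformations of L that are products of reflections. *)
Record weyl := Weyl {
  weyl_fun :> L -> L;
  weyl_generated : exists s, weyl_fun = reflections s }.

Lemma weylP (v w : weyl) : (forall l, v l = w l) -> v = w.
Proof.
case: v w => [v hv] [w hw] /= /funext vw.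
by rewrite vw in hv *; congr Weyl; apply: Prop_irrelevance.
Qed.

Lemma reflection_additive a : zmod_morphism (reflection a).
Proof.
by move=> l m; rewrite /reflection raddfB mulrzBr opprB opprD opprK addrACA [- m + _]addrC.
Qed.

Lemma reflectionK a : involutive (reflection a).
Proof.
move=> l; rewrite /reflection raddfB /= raddfMz coroot_self.
have -> : coroot a l - 2 *~ coroot a l = - coroot a l.
  by rewrite mulrzz mulr_natl mulr2n opprD addrA subrr add0r.
by rewrite mulrNz opprK subrK.
Qed.

Lemma reflections_additive s : zmod_morphism (reflections s).
Proof.
by elim: s => [//|a s IH] l m /=; rewrite IH reflection_additive.
Qed.

Lemma reflections_cat s t : reflections (s ++ t) = reflections s \o reflections t.
Proof. by elim: s => [//|a s IH] /=; rewrite IH. Qed.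

Lemma reflectionsK s : cancel (reflections s) (reflections (rev s)).
Proof.
elim: s => [//|a s IH] l; rewrite rev_cons -cats1 reflections_cat /=.
by rewrite reflectionK IH.
Qed.

Lemma reflections_roots s (b : root_type D) : reflections s (val b) \in roots D.
Proof.
elim: s => [|a s IH] /=; first exact: valP.
exact: root_reflection a [` IH]%fset.
Qed.

Lemma weyl_additive (w : weyl) : zmod_morphism w.
Proof. by case: w => w [s /= ->]; apply: reflections_additive. Qed.

HB.instance Definition _ (w : weyl) :=
  GRing.isZmodMorphism.Build L L w (weyl_additive w).

Lemma weyl_roots (w : weyl) (b : root_type D) : w (val b) \in roots D.
Proof. by case: w => w [s /= ->]; apply: reflections_roots. Qed.

Definition weyl_root (w : weyl) (b : root_type D) : root_type D := [` weyl_roots w b]%fset.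

Lemma lattice_torsion_free n (l : L) : (0 < n)%N -> l *+ n = 0 -> l = 0.
Proof.
move=> n_gt0 ln0; have [r [b basis]] := lattice_free D.
have [c [lE _]] := basis l; have [c0 [_ c0_uniq]] := basis 0.
have c0E : c0 = [ffun=> 0].
  by apply: c0_uniq; rewrite big1 // => i _; rewrite ffunE mulr0z.
suff cn : c0 = [ffun i => c i *+ n].
  rewrite lE big1 // => i _; move: cn; rewrite c0E => /ffunP/(_ i)/eqP.
  by rewrite !ffunE eq_sym mulrn_eq0 eqn0Ngt n_gt0 => /eqP->; rewrite mulr0z.
apply: c0_uniq; rewrite -[LHS]ln0 lE -sumrMnl; apply: eq_bigr => i _.
by rewrite ffunE pmulrn -mulrzA -[in RHS]mulr_natr natz.
Qed.

Lemma weyl_faithful (v w : weyl) :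
  (forall b : root_type D, v (val b) = w (val b)) -> v = w.
Proof.
move=> vw; apply: weylP => l; have [n n_gt0 [c lE]] := roots_span D l.
apply/eqP; rewrite -subr_eq0; apply/eqP/(lattice_torsion_free n_gt0).
rewrite mulrnBl; apply/eqP; rewrite subr_eq0 -!raddfMn lE !raddf_sum; apply/eqP.
by apply: eq_bigr => b _; rewrite !raddfMz /= vw.
Qed.

Definition weyl_perm (w : weyl) : {ffun root_type D -> root_type D} :=
  [ffun b => weyl_root w b].

Definition weyl_of_perm (p : {ffun root_type D -> root_type D}) : option weyl :=
  if pselect (exists w, weyl_perm w = p) is left h then Some (projT1 (cid h))
  else None.

Lemma weyl_permK : pcancel weyl_perm weyl_of_perm.
Proof.
move=> w; rewrite /weyl_of_perm; case: pselect => [h|[]]; last by exists w.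
case: cid => v /= vw; congr Some; apply: weyl_faithful => b.
by move: vw => /ffunP/(_ b); rewrite !ffunE => /(congr1 val).
Qed.

HB.instance Definition _ := Finite.copy weyl (pcan_type weyl_permK).

Lemma weyl_mul_generated (v w : weyl) :
  exists s, (v \o w : L -> L) = reflections s.
Proof.
case: v w => [v [s /= ->]] [w [t /= ->]].
by exists (s ++ t); rewrite reflections_cat.
Qed.

Lemma weyl_inv_exists (w : weyl) : exists v : weyl, cancel w v.
Proof.
case: w => w [s /= ->].
by exists (Weyl (ex_intro _ (rev s) erefl)) => l; apply: reflectionsK.
Qed.

Definition weyl_one : weyl := Weyl (ex_intro _ [::] erefl).
Definition weyl_mul (v w : weyl) : weyl := Weyl (weyl_mul_generated v w).
Definition weyl_inv (w : weyl) : weyl := projT1 (cid (weyl_inv_exists w)).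

Lemma weyl_mulA : associative weyl_mul.
Proof. by move=> u v w; apply: weylP. Qed.
Lemma weyl_mul1 : left_id weyl_one weyl_mul.
Proof. by move=> w; apply: weylP. Qed.
Lemma weyl_mulV : left_inverse weyl_one weyl_inv weyl_mul.
Proof.
by move=> w; apply: weylP => l; rewrite /= /weyl_inv; case: cid => v /= ->.
Qed.

HB.instance Definition _ := Finite_isGroup.Build weyl
  weyl_mulA weyl_mul1 weyl_mulV.

Definition weyl_reflection (a : root_type D) : weyl :=
  Weyl (ex_intro _ [:: a] erefl).

Lemma weylM (v w : weyl) (l : L) : (v * w)%g l = v (w l).
Proof. by []. Qed.
End WeylGroup.

(* The localization A[x_t^-1 | t in T]: the pair (a, e) stands for the
   fraction a / \prod_t x_t ^ e_t. *)
Section Localization.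
Variables (A : comNzRingType) (T : finType) (x : T -> A).
Local Notation expo := {ffun T -> nat}.

Definition xpow (e : expo) : A := \prod_t x t ^+ e t.
Definition expo0 : expo := [ffun=> 0%N].
Definition expoD (e f : expo) : expo := [ffun t => (e t + f t)%N].

Lemma xpow0 : xpow expo0 = 1.
Proof. by rewrite /xpow big1 // => t _; rewrite ffunE. Qed.

Lemma xpowD e f : xpow (expoD e f) = xpow e * xpow f.
Proof. by rewrite -big_split; apply: eq_bigr => t _; rewrite ffunE exprD. Qed.

Definition frac_eq (p q : A * expo) : bool :=
  `[< exists e, xpow e * (p.1 * xpow q.2) = xpow e * (q.1 * xpow p.2) >].

Lemma frac_eq_refl : reflexive frac_eq.
Proof. by move=> p; apply/asboolP; exists expo0. Qed.

Lemma frac_eq_sym : symmetric frac_eq.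
Proof.
suff imp p q : frac_eq p q -> frac_eq q p by move=> p q; apply/idP/idP => /imp.
by move=> /asboolP[e pq]; apply/asboolP; exists e.
Qed.

Lemma frac_eq_trans : transitive frac_eq.
Proof.
move=> q p r /asboolP[e pq] /asboolP[f qr]; apply/asboolP.
exists (expoD (expoD e f) q.2); rewrite !xpowD.
transitivity (xpow f * xpow r.2 * (xpow e * (p.1 * xpow q.2))); first by ring.
rewrite pq.
transitivity (xpow e * xpow p.2 * (xpow f * (q.1 * xpow r.2))); first by ring.
by rewrite qr; ring.
Qed.

Canonical frac_equiv := EquivRel frac_eq frac_eq_refl frac_eq_sym frac_eq_trans.

Definition loc := {eq_quot frac_eq}.
HB.instance Definition _ := Choice.on loc.
HB.instance Definition _ := EqQuotient.on loc.

Definition loc_frac (a : A) (e : expo) : loc := \pi_loc (a, e).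

Lemma loc_fracP a e b f :
  (exists g, xpow g * (a * xpow f) = xpow g * (b * xpow e)) ->
  loc_frac a e = loc_frac b f.
Proof. by move=> abef; apply/eqmodP/asboolP. Qed.

Definition loc_num (p : loc) : A := (generic_quotient.repr p).1.
Definition loc_den (p : loc) : expo := (generic_quotient.repr p).2.

Lemma loc_fracE p : loc_frac (loc_num p) (loc_den p) = p.
Proof. by rewrite /loc_frac -surjective_pairing reprK. Qed.

Lemma loc_frac_repr a e : exists g,
  xpow g * (loc_num (loc_frac a e) * xpow e) =
  xpow g * (a * xpow (loc_den (loc_frac a e))).
Proof.
have /eqmodP/asboolP[g ge] := reprK (loc_frac a e).
by exists g.
Qed.

Definition loc_opp (p : loc) : loc := loc_frac (- loc_num p) (loc_den p).
Definition loc_add (p q : loc) : loc :=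
  loc_frac (loc_num p * xpow (loc_den q) + loc_num q * xpow (loc_den p))
           (expoD (loc_den p) (loc_den q)).
Definition loc_mul (p q : loc) : loc :=
  loc_frac (loc_num p * loc_num q) (expoD (loc_den p) (loc_den q)).

Lemma loc_oppE a e : loc_opp (loc_frac a e) = loc_frac (- a) e.
Proof.
have [g ge] := loc_frac_repr a e; apply: loc_fracP; exists g.
by rewrite !mulNr !mulrN ge.
Qed.

Lemma loc_addE a e b f : loc_add (loc_frac a e) (loc_frac b f) =
  loc_frac (a * xpow f + b * xpow e) (expoD e f).
Proof.
have [g ge] := loc_frac_repr a e; have [h hf] := loc_frac_repr b f.
apply: loc_fracP; exists (expoD g h); rewrite !xpowD.
set a' := loc_num _ in ge *; set e' := loc_den _ in ge *.
set b' := loc_num _ in hf *; set f' := loc_den _ in hf *.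
transitivity (xpow h * xpow f' * xpow f * (xpow g * (a' * xpow e)) +
              xpow g * xpow e' * xpow e * (xpow h * (b' * xpow f))); first by ring.
by rewrite ge hf; ring.
Qed.

Lemma loc_mulE a e b f : loc_mul (loc_frac a e) (loc_frac b f) =
  loc_frac (a * b) (expoD e f).
Proof.
have [g ge] := loc_frac_repr a e; have [h hf] := loc_frac_repr b f.
apply: loc_fracP; exists (expoD g h); rewrite !xpowD.
set a' := loc_num _ in ge *; set e' := loc_den _ in ge *.
set b' := loc_num _ in hf *; set f' := loc_den _ in hf *.
transitivity ((xpow g * (a' * xpow e)) * (xpow h * (b' * xpow f))); first by ring.
by rewrite ge hf; ring.
Qed.

Lemma loc_ind (P : loc -> Prop) : (forall a e, P (loc_frac a e)) -> forall p, P p.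
Proof. by move=> Pfrac p; rewrite -[p]loc_fracE. Qed.

Lemma loc_addA : associative loc_add.
Proof.
elim/loc_ind=> a e; elim/loc_ind=> b f; elim/loc_ind=> c g.
rewrite !loc_addE; apply: loc_fracP; exists expo0; rewrite !xpowD; ring.
Qed.

Lemma loc_addC : commutative loc_add.
Proof.
elim/loc_ind=> a e; elim/loc_ind=> b f.
rewrite !loc_addE; apply: loc_fracP; exists expo0; rewrite !xpowD; ring.
Qed.

Lemma loc_add0 : left_id (loc_frac 0 expo0) loc_add.
Proof.
elim/loc_ind=> a e.
rewrite !loc_addE; apply: loc_fracP; exists expo0; rewrite !(xpowD, xpow0); ring.
Qed.

Lemma loc_addN : left_inverse (loc_frac 0 expo0) loc_opp loc_add.
Proof.
elim/loc_ind=> a e; rewrite loc_oppE loc_addE.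
apply: loc_fracP; exists expo0; rewrite !(xpowD, xpow0); ring.
Qed.

HB.instance Definition _ := GRing.isZmodule.Build loc
  loc_addA loc_addC loc_add0 loc_addN.

Lemma loc_mulA : associative loc_mul.
Proof.
elim/loc_ind=> a e; elim/loc_ind=> b f; elim/loc_ind=> c g.
rewrite !loc_mulE; apply: loc_fracP; exists expo0; rewrite !xpowD; ring.
Qed.

Lemma loc_mulC : commutative loc_mul.
Proof.
elim/loc_ind=> a e; elim/loc_ind=> b f.
rewrite !loc_mulE; apply: loc_fracP; exists expo0; rewrite !xpowD; ring.
Qed.

Lemma loc_mul1 : left_id (loc_frac 1 expo0) loc_mul.
Proof.
elim/loc_ind=> a e.
rewrite !loc_mulE; apply: loc_fracP; exists expo0; rewrite !(xpowD, xpow0); ring.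
Qed.

Lemma loc_mulDl : left_distributive loc_mul loc_add.
Proof.
elim/loc_ind=> a e; elim/loc_ind=> b f; elim/loc_ind=> c g.
rewrite !(loc_mulE, loc_addE, loc_mulE); apply: loc_fracP; exists expo0.
rewrite !(xpowD, xpow0); ring.
Qed.

HB.instance Definition _ := GRing.Zmodule_isComPzRing.Build loc
  loc_mulA loc_mulC loc_mul1 loc_mulDl.

Definition loc_inj (a : A) : loc := loc_frac a expo0.

Lemma loc_inj_additive : zmod_morphism loc_inj.
Proof.
move=> a b.
have -> : loc_inj a - loc_inj b = loc_add (loc_inj a) (loc_opp (loc_inj b)) by [].
rewrite loc_oppE loc_addE.
apply: loc_fracP; exists expo0; rewrite !(xpowD, xpow0); ring.
Qed.

Lemma loc_inj_multiplicative : monoid_morphism loc_inj.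
Proof.
split=> // a b.
have -> : loc_inj a * loc_inj b = loc_mul (loc_inj a) (loc_inj b) by [].
rewrite loc_mulE.
apply: loc_fracP; exists expo0; rewrite !(xpowD, xpow0); ring.
Qed.

HB.instance Definition _ := GRing.isZmodMorphism.Build A loc loc_inj
  loc_inj_additive.
HB.instance Definition _ := GRing.isMonoidMorphism.Build A loc loc_inj
  loc_inj_multiplicative.

End Localization.

Section Rename.
Variables (I J : choiceType) (g : I -> J) (R : comNzRingType).

Definition rename_monom (m : {cmonom I}) : {cmonom J} :=
  \big[mmul/mone]_(i <- finsupp m) iter (m i) (mmul (ucm (g i))) mone.

Definition rename_term (m : {cmonom I}) : {malg R[{cmonom J}]} :=
  << rename_monom m >>.

Definition rename_mpoly : {malg R[{cmonom I}]} -> {malg R[{cmonom J}]} :=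
  mmap (@malgC {cmonom J} R) rename_term.

Lemma rename_monomEw (d : {fset I}) (m : {cmonom I}) j :
  (finsupp m `<=` d)%fset ->
  rename_monom m j = (\sum_(i <- d) (g i == j) * m i)%N.
Proof.
move=> md; rewrite -(big_fset_incl _ md) => [|i _]; last first.
  by move=> /fsfun_dflt ->; rewrite muln0.
rewrite /rename_monom.
rewrite (big_morph (fun m : {cmonom J} => m j) (cmM j) (cm1 j)).
apply: eq_bigr => i _; elim: (m i) => [|n IH] /=; first by rewrite cm1 muln0.
by rewrite cmM IH cmU mulnS.
Qed.

Lemma rename_monom_morph :
  mmorphism rename_term.
Proof.
rewrite /rename_term /=.
split=> [m n|] /=; last first.
  rewrite -[RHS]mpolyC1E; congr << _ >>.
  apply/eqP/cmP => j; rewrite (rename_monomEw _ (fsubset_refl _)) mdom1 cm1.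
  by rewrite big_seq_fset0.
rewrite malgM_def fgmulUU mulr1; congr << _ >>.
apply/eqP/cmP => j; rewrite cmM.
rewrite (rename_monomEw _ (fsubset_refl _)) mdomD.
rewrite (rename_monomEw _ (fsubsetUl (finsupp m) (finsupp n))).
rewrite (rename_monomEw _ (fsubsetUr (finsupp m) (finsupp n))) -big_split /=.
by apply: eq_bigr => i _; rewrite cmM mulnDr.
Qed.

HB.instance Definition _ := isMultiplicative.Build {cmonom I} {malg R[{cmonom J}]}
  rename_term rename_monom_morph.

Lemma rename_mpoly_additive : zmod_morphism rename_mpoly.
Proof. exact: mmap_is_additive. Qed.
Lemma rename_mpoly_multiplicative : monoid_morphism rename_mpoly.
Proof. by have [] := @mmap_is_multiplicative _ _ _ (@malgC {cmonom J} R) rename_term. Qed.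

Lemma rename_mpolyM p q : rename_mpoly (p * q) = rename_mpoly p * rename_mpoly q.
Proof. exact: rename_mpoly_multiplicative.2. Qed.

HB.instance Definition _ := GRing.isZmodMorphism.Build _ _ rename_mpoly
  rename_mpoly_additive.
HB.instance Definition _ := GRing.isMonoidMorphism.Build _ _ rename_mpoly
  rename_mpoly_multiplicative.

Lemma mdeg_rename_monom m : mdeg (rename_monom m) = mdeg m.
Proof.
rewrite [RHS]mdegE (big_morph (@mdeg J) (@mdegM J) (@mdeg1 J)); apply: eq_bigr => i _.
by elim: (m i) => [|n IH] /=; rewrite ?mdeg1 // mdegM IH mdegU.
Qed.

Lemma homog_rename d p : homogeneous d p -> homogeneous d (rename_mpoly p).
Proof.
move=> hp; rewrite /rename_mpoly mmapE big_seq.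
apply: homog_sum => m /hp md; rewrite mul_malgC.
by apply/homogZ/homogU; rewrite mdeg_rename_monom.
Qed.

Lemma series_rename_graded (f : series I R) :
  graded (fun d => rename_mpoly (f d)).
Proof. by move=> d; apply/homog_rename/homog_component. Qed.

Definition series_rename (f : series I R) : series J R :=
  mk_series (@series_rename_graded f).

Lemma series_rename_additive : zmod_morphism series_rename.
Proof.
move=> f h; apply: seriesP => d.
have -> : series_rename (f - h) d = rename_mpoly (f d - h d) by [].
by rewrite rmorphB.
Qed.

Lemma series_rename_multiplicative : monoid_morphism series_rename.
Proof.
split=> [|f h]; apply: seriesP => d.
  have -> : series_rename 1 d = rename_mpoly (if d == 0%N then 1%:MP else 0) by [].
  have -> : (1 : series J R) d = if d == 0%N then 1%:MP else 0 by [].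
  by case: eqP => _; rewrite ?mpolyC1E ?rmorph1 ?raddf0.
have -> : series_rename (f * h) d = rename_mpoly ((f * h) d) by [].
rewrite [in LHS]seriesM [RHS]seriesM raddf_sum; apply: eq_bigr => i _.
exact: rename_mpoly_multiplicative.2.
Qed.

HB.instance Definition _ := GRing.isZmodMorphism.Build _ _ series_rename
  series_rename_additive.
HB.instance Definition _ := GRing.isMonoidMorphism.Build _ _ series_rename
  series_rename_multiplicative.

Lemma series_rename_var i : series_rename (series_var R i) = series_var R (g i).
Proof.
apply: seriesP => d.
have -> : series_rename (series_var R i) d =
          rename_mpoly (if d == 1%N then << ucm i >> else 0) by [].
have -> : series_var R (g i) d = if d == 1%N then << ucm (g i) >> else 0 by [].
case: eqP => _; rewrite ?raddf0 // /rename_mpoly mmapU /= mpolyC1E mul1r.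
rewrite /rename_term /rename_monom mdomU big_seq_fset1 cmUU /=.
by rewrite mulm1.
Qed.

Lemma series_rename_fgl_eval a (f h : series I R) :
  series_rename (fgl_eval a f h) = fgl_eval a (series_rename f) (series_rename h).
Proof.
apply: seriesP => d.
have -> : series_rename (fgl_eval a f h) d = rename_mpoly (fgl_eval a f h d) by [].
have fglE (K : choiceType) (u v : series K R) : fgl_eval a u v d =
  \sum_(i < d.+1) \sum_(j < d.+1) (a i j)%:MP * (u ^+ i * v ^+ j : series K R) d.
  apply: eq_bigr => i _; apply: eq_bigr => j _; exact/esym/mul_malgC.
rewrite !fglE raddf_sum; apply: eq_bigr => i _.
rewrite raddf_sum; apply: eq_bigr => j _.
rewrite [LHS]rename_mpolyM -2!rmorphXn -rmorphM; congr (_ * _).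
exact: mmapC.
Qed.

End Rename.

Section FgaAction.
Variables (R : comNzRingType) (F : formal_group_law R).
Variables (L : zmodType) (D : root_datum L).
Local Notation S := (fga F L).

Definition fga_act (w : weyl D) (s : S) : S :=
  \pi_S (series_rename w (generic_quotient.repr s)).

Lemma fga_rename_ideal (w : weyl D) (f : series L R) :
  f \in @fga_ideal _ F L -> series_rename w f \in @fga_ideal _ F L.
Proof.
move=> /asboolP If; apply/asboolP => n.
have [_ [k [c [r [rel ->]]]] fE] := If n.
exists (series_rename w (\sum_i c i * r i)); last first.
  move=> d lt_dn.
  exact: (congr1 (rename_mpoly w (R := R)) (fE d lt_dn)).
exists k, (fun i => series_rename w (c i)), (fun i => series_rename w (r i)).
split=> [i|]; last by rewrite rmorph_sum; apply: eq_bigr => i _; rewrite rmorphM.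
case: (rel i) => [|l m].
  by rewrite series_rename_var raddf0; apply: FgaZero.
rewrite rmorphB /= series_rename_fgl_eval !series_rename_var raddfD.
exact: FgaAdd.
Qed.

Lemma fga_act_pi w (f : series L R) :
  fga_act w (\pi_S f) = \pi_S (series_rename w f).
Proof.
apply/eqP; rewrite /fga_act -Quotient.idealrBE -rmorphB.
by apply: fga_rename_ideal; rewrite Quotient.idealrBE reprK.
Qed.

Lemma fga_act_zmod_morphism w : zmod_morphism (fga_act w).
Proof.
move=> s t; rewrite -[s]reprK -[t]reprK -rmorphB [LHS]fga_act_pi !fga_act_pi.
by rewrite raddfB; exact: rmorphB.
Qed.

Lemma fga_act_monoid_morphism w : monoid_morphism (fga_act w).
Proof.
split=> [|s t].
  have <- : \pi_S (1 : series L R) = 1 by exact: rmorph1.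
  by rewrite fga_act_pi rmorph1.
rewrite -[s]reprK -[t]reprK -rmorphM [LHS]fga_act_pi !fga_act_pi.
by rewrite rmorphM; exact: rmorphM.
Qed.

HB.instance Definition _ w := GRing.isZmodMorphism.Build S S (fga_act w)
  (fga_act_zmod_morphism w).
HB.instance Definition _ w := GRing.isMonoidMorphism.Build S S (fga_act w)
  (fga_act_monoid_morphism w).

Lemma fga_act_var w l : fga_act w (fga_var F l) = fga_var F (w l).
Proof. by rewrite fga_act_pi series_rename_var. Qed.
End FgaAction.

Section SimpleRoots.
Variables (L : zmodType) (D : root_datum L) (Pi : {set root_type D}).

Definition nonneg_comb (l : L) : Prop :=
  exists c : root_type D -> nat, l = \sum_(a in Pi) val a *+ c a.

Definition simple_system : Prop :=
  (forall c : root_type D -> int,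
     \sum_(a in Pi) val a *~ c a = 0 -> forall a, a \in Pi -> c a = 0) /\
  (forall b : root_type D, nonneg_comb (val b) \/ nonneg_comb (- val b)).

Definition neg_roots : {set root_type D} := [set b | `[< nonneg_comb (- val b) >]].

Definition weyl_word (s : seq (root_type D)) : weyl D :=
  (\prod_(a <- s) weyl_reflection a)%g.

Definition has_word (w : weyl D) (n : nat) : bool :=
  [exists s : n.-tuple (root_type D), all (mem Pi) s && (weyl_word s == w)].

(* The default 0 is never reached when Pi is a simple system, since the simple
   reflections generate the Weyl group. *)
Definition weyl_length (w : weyl D) : nat :=
  if pselect (exists n, has_word w n) is left h then ex_minn h else 0%N.

Definition reduced_word (w : weyl D) (s : seq (root_type D)) : Prop :=
  [/\ all (mem Pi) s, weyl_word s = w & size s = weyl_length w].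

Definition parabolic (Xi : {set root_type D}) : {group weyl D} :=
  <<[set weyl_reflection a | a in Xi]>>%G.

Definition min_reps (Xi : {set root_type D}) : {set weyl D} :=
  [set w | [forall a in Xi,
              (weyl_length w < weyl_length (w * weyl_reflection a)%g)%N]].

Definition sub_neg_roots (Xi : {set root_type D}) : {set root_type D} :=
  [set a in neg_roots | weyl_reflection a \in parabolic Xi].

Definition coset_space (Xi : {set root_type D}) : finType :=
  {C : {set weyl D} | C \in lcosets (parabolic Xi) [set: weyl D]}.

Lemma coset_class_proof (Xi : {set root_type D}) (w : weyl D) :
  lcoset (parabolic Xi) w \in lcosets (parabolic Xi) [set: weyl D].
Proof. by apply: imset_f; rewrite in_setT. Qed.

Definition coset_class (Xi : {set root_type D}) (w : weyl D) : coset_space Xi :=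
  exist _ (lcoset (parabolic Xi) w) (coset_class_proof Xi w).

Definition coset_rep (Xi : {set root_type D}) (C : coset_space Xi) : weyl D :=
  fingroup.repr (val C).

End SimpleRoots.

Definition ring_inv (A : comPzRingType) (a : A) : A :=
  if pselect (exists b, a * b = 1) is left h then projT1 (cid h) else 0.

Definition nondegenerate_on (U V : zmodType) (M : U -> Prop) (pair : U -> U -> V) :
    Prop :=
  (forall f, M f -> (forall g, M g -> pair f g = 0) -> f = 0) /\
  (forall g, M g -> (forall f, M f -> pair f g = 0) -> g = 0).

Section DemazureAlgebra.
Variables (R : comNzRingType) (F : formal_group_law R).
Variables (L : zmodType) (D : root_datum L) (Pi : {set root_type D}).

Local Notation W := (weyl D).
Local Notation S := (fga F L).

Definition x_root (a : root_type D) : S := fga_var F (val a).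

Definition fga_loc : comPzRingType := loc x_root.
Local Notation Q := fga_loc.
Definition to_loc (s : S) : Q := loc_inj x_root s.

Definition loc_act (w : W) (q : Q) : Q :=
  to_loc (fga_act w (loc_num q)) *
  ring_inv (to_loc (fga_act w (xpow x_root (loc_den q)))).

Lemma ring_invP (A : comPzRingType) (a b : A) : a * b = 1 -> ring_inv a = b.
Proof.
move=> ab1; rewrite /ring_inv; case: pselect => [h|[]]; last by exists b.
case: cid => c /= ac1.
by rewrite -[c]mulr1 -ab1 mulrA [c * a]mulrC ac1 mul1r.
Qed.

Lemma loc_frac_inv (A : comNzRingType) (T : finType) (x : T -> A) e :
  loc_inj x (xpow x e) * loc_frac x 1 e = 1.
Proof.
have -> : loc_inj x (xpow x e) * loc_frac x 1 e =
  loc_mul (loc_frac x (xpow x e) (expo0 T)) (loc_frac x 1 e) by [].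
rewrite loc_mulE; apply: loc_fracP; exists (expo0 T).
by rewrite !(xpowD, xpow0); ring.
Qed.

Lemma fga_act_xpow (w : W) e : fga_act w (xpow x_root e) =
  xpow x_root [ffun a => e (weyl_root (w^-1)%g a)].
Proof.
rewrite /xpow rmorph_prod.
have rK : cancel (weyl_root w) (weyl_root (w^-1)%g).
  move=> a; apply: val_inj => /=; rewrite -weylM mulVg.
  by [].
rewrite [RHS](reindex_inj (can_inj rK)); apply: eq_bigr => a _.
by rewrite ffunE rK rmorphXn /= fga_act_var.
Qed.

Lemma loc_act_frac (w : W) s e :
  loc_act w (loc_frac x_root s e) =
  loc_frac x_root (fga_act w s) [ffun a => e (weyl_root (w^-1)%g a)].
Proof.
rewrite /loc_act fga_act_xpow (ring_invP (loc_frac_inv _ _)).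
have [g /(congr1 (fga_act w))] := loc_frac_repr x_root s e.
rewrite !rmorphM /= !fga_act_xpow => ge.
set n := fga_act w (loc_num _) in ge *.
have -> (d : {ffun root_type D -> nat}) :
    to_loc n * loc_frac x_root 1 d = loc_frac x_root n d.
  have -> : to_loc n * loc_frac x_root 1 d =
    loc_mul (loc_frac x_root n (expo0 _)) (loc_frac x_root 1 d) by [].
  rewrite loc_mulE; apply: loc_fracP; exists (expo0 _).
  by rewrite !(xpowD, xpow0); ring.
by apply: loc_fracP; eexists; exact: ge.
Qed.

(* The coordinate functions {ffun T -> Q^o} represent both the free Q-module
   with basis T and its Q-dual with the dual basis; fbasis is that basis and
   dual_eval is the evaluation of an element of the dual. *)
Definition fbasis (T : finType) (t : T) : {ffun T -> Q^o} :=
  [ffun u => (u == t)%:R].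

Definition dual_eval (T : finType) (f z : {ffun T -> Q^o}) : Q :=
  \sum_t z t * f t.

(* the product of Q_W: (q delta_v) (q' delta_w) = q v(q') delta_(v w) *)
Definition qw_mul (z z' : {ffun W -> Q^o}) : {ffun W -> Q^o} :=
  \sum_v \sum_w (z v * loc_act v (z' w) : Q) *: fbasis (v * w)%g.

Definition demazure_X (a : root_type D) : {ffun W -> Q^o} :=
  ring_inv (to_loc (x_root a)) *:
    (fbasis (1%g : W) - fbasis (weyl_reflection a)).

Definition demazure_word (s : seq (root_type D)) : {ffun W -> Q^o} :=
  foldr (fun a z => qw_mul (demazure_X a) z) (fbasis (1%g : W)) s.

(* D_F; it contains the image of R, hence is stable under R-scalars. *)
Inductive demazure_algebra : {ffun W -> Q^o} -> Prop :=
| DemazureScalar (s : S) : demazure_algebra (to_loc s *: fbasis (1%g : W))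
| DemazureX (a : root_type D) : a \in Pi -> demazure_algebra (demazure_X a)
| DemazureAdd z z' : demazure_algebra z -> demazure_algebra z' ->
    demazure_algebra (z + z')
| DemazureMul z z' : demazure_algebra z -> demazure_algebra z' ->
    demazure_algebra (qw_mul z z').

(* (z . f)(z') = f(z' z), computed on the basis *)
Definition qw_act (z f : {ffun W -> Q^o}) : {ffun W -> Q^o} :=
  [ffun w => dual_eval f (qw_mul (fbasis w) z)].

Definition demazure_B (a : root_type D) (f : {ffun W -> Q^o}) : {ffun W -> Q^o} :=
  qw_act (demazure_X a) f.

Definition demazure_B_word (s : seq (root_type D)) (f : {ffun W -> Q^o}) :
    {ffun W -> Q^o} :=
  foldr demazure_B f s.

Definition x_Pi : S := \prod_(a in neg_roots Pi) x_root a.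

Definition x_rel (Xi Xi' : {set root_type D}) : S :=
  \prod_(a in sub_neg_roots Pi Xi :\: sub_neg_roots Pi Xi') x_root a.

Definition coset_proj (Xi : {set root_type D}) (z : {ffun W -> Q^o}) :
    {ffun coset_space Xi -> Q^o} :=
  \sum_w z w *: fbasis (coset_class Xi w).

Definition demazure_module (Xi : {set root_type D})
    (y : {ffun coset_space Xi -> Q^o}) : Prop :=
  exists2 z, demazure_algebra z & y = coset_proj Xi z.

(* The dual D_(F, Xi)^* = Hom_S(D_(F, Xi), S), as the set of f in the Q-dual of
   Q_(W / W_Xi) with f(D_(F, Xi)) contained in S. *)
Definition demazure_dual (Xi : {set root_type D})
    (f : {ffun coset_space Xi -> Q^o}) : Prop :=
  forall y, demazure_module y -> exists s : S, dual_eval f y = to_loc s.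

(* the product f_v f_w = (v == w) f_v *)
Definition dual_mul (T : finType) (f g : {ffun T -> Q^o}) : {ffun T -> Q^o} :=
  [ffun t => (f t : Q) * g t].

(* A_(Xi / Xi') : f_w |-> w(x_(Xi / Xi'))^-1 f_w; since x_(Xi / Xi') is
   W_Xi'-invariant, the choice of the representative w is irrelevant. *)
Definition push (Xi Xi' : {set root_type D}) (f : {ffun coset_space Xi' -> Q^o}) :
    {ffun coset_space Xi -> Q^o} :=
  \sum_C (f C * ring_inv (loc_act (coset_rep C) (to_loc (x_rel Xi Xi'))) : Q)
           *: fbasis (coset_class Xi (coset_rep C)).

(* Q_W^* = Q_(W / W_0)^*, as W_0 is trivial *)
Definition to_coset0 (f : {ffun W -> Q^o}) :
    {ffun coset_space (set0 : {set root_type D}) -> Q^o} :=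
  [ffun C => f (coset_rep C)].

Definition push0 (Xi : {set root_type D}) (f : {ffun W -> Q^o}) :
    {ffun coset_space Xi -> Q^o} :=
  push Xi (to_coset0 f).

(* The element of D_(F, Xi)^* dual to X^Xi_(I_v) in the family
   (X^Xi_(I_w))_(w in W^Xi). *)
Definition is_dual_elt (Xi : {set root_type D}) (I : W -> seq (root_type D)) (v : W)
    (f : {ffun coset_space Xi -> Q^o}) : Prop :=
  demazure_dual f /\
  forall w, w \in min_reps Pi Xi ->
    dual_eval f (coset_proj Xi (demazure_word (I w))) = (w == v)%:R.

Definition demazure_dual_elt (Xi : {set root_type D}) (I : W -> seq (root_type D))
    (v : W) : {ffun coset_space Xi -> Q^o} :=
  if pselect (exists f, is_dual_elt I v f) is left h then projT1 (cid h)
  else 0.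

(* with values in Q_(W / W_Pi)^*; see dual_scalar for D_(F, Pi)^* ~ S *)
Definition demazure_pairing (Xi : {set root_type D})
    (f g : {ffun coset_space Xi -> Q^o}) : {ffun coset_space Pi -> Q^o} :=
  push Pi (dual_mul f g).

(* s f_e, the image of s under S ~ D_(F, Pi)^* *)
Definition dual_scalar (s : S) : {ffun coset_space Pi -> Q^o} :=
  to_loc s *: fbasis (coset_class Pi 1%g).

Definition S_basis (T : finType) (M : {ffun T -> Q^o} -> Prop)
    (I : {set W}) (b : W -> {ffun T -> Q^o}) : Prop :=
  [/\ forall w, w \in I -> M (b w),
      forall f, M f ->
        exists c : W -> S, f = \sum_(w in I) to_loc (c w) *: b w &
      forall c : W -> S, \sum_(w in I) to_loc (c w) *: b w = 0 ->
        forall w, w \in I -> c w = 0].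

End DemazureAlgebra.

(* Main.v *)
(* The elements of D_F^* are functions W -> Q, on which X_a acts by the operator
   B_a f (w) = (f w - f (w s_a)) / x_(w a). Everything follows from the fact that
   the point function x_Pi f_e has all values B_J f (e) in S. In rank two this is
   seen on explicit products of the functions w |-> x_((lam - w mu) / d). For G_2
   these only reach the multiple x_(2a) / x_a of the point function (the torsion
   index is 2), and one concludes by looking at pairs of orthogonal roots: away
   from the other four roots the point function is a product for A_1 x A_1, and
   these denominators can be eliminated one root at a time. Rank two gives the
   braid relations for the B_a modulo shorter words, hence, by Matsumoto's
   argument, every word is an S-combination of reduced words B_(I_v), and the
   point function of any parabolic subgroup is integral because B_(I_v) f (e)
   vanishes on it for v not longest. Then A_Xi preserves integrality, the family
   A_Xi (B_J x_Pi f_e) is triangular with respect to the functionals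
   f |-> B_(I_w) f (e), and duality with the latter follows from the adjointness
   A_Pi (B_a f . g) = A_Pi (f . B_a g) and the projection formula. *)

From HB Require Import structures.
Require Import Defs.
From mathcomp Require Import all_boot all_order all_algebra all_fingroup.
From mathcomp Require Import ring zify finmap monalg boolp.

Set Implicit Arguments.
Unset Strict Implicit.
Unset Printing Implicit Defensive.

Import Order.TTheory GRing.Theory Num.Theory.
Local Open Scope ring_scope.
Local Open Scope quotient_scope.

(** * Formal group algebras *)

(** Only the x_a are known to be regular in S; integers may be zero divisors. So in type G_2 the
    factor x_(2a) / x_a, which is 2 for the additive law, cannot be cancelled from its multiple of
    the point function. What can be used is that x_(2a) / x_a and x_(3a) have no common annihilator,
    the analogue of 2 and 3 being coprime. One point function is enough because B_a lowers the
    length of a support by at most one: the functions B_J (pt) are triangular, with units on the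
    diagonal, for the functionals f |-> B_(I_v) f (e). They yield a dual basis, and every linear
    functional that is integral on this basis, such as f |-> B_J f (e) or f |-> A_X f (e), is then
    an S-combination of these functionals. This mechanism serves for the braid relations, for the
    integrality of A_X and for the dual bases of the pairing. Identities at e pass to all points
    because left translations commute with the operators. *)

Section SeriesOrder.
Variables (I : choiceType) (R : comNzRingType).
Local Notation ser := (series I R).
Implicit Types f g h : ser.

Lemma ser0E d : (0 : ser) d = 0.
Proof. by rewrite /GRing.zero /series_const /= malgC0E if_same. Qed.

Lemma ser_sum d (T : Type) (s : seq T) (P : pred T) (G : T -> ser) :
  (\sum_(t <- s | P t) G t) d = \sum_(t <- s | P t) G t d.
Proof. by apply: (big_morph (fun f : ser => f d)) => //; exact: ser0E. Qed.

(* The boolean reflection keeps [done] from unfolding the definition. *)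
Definition eq_upto n f g : Prop := `[< forall d, (d < n)%N -> f d = g d >].

Lemma eq_uptoP n f g : eq_upto n f g <-> forall d, (d < n)%N -> f d = g d.
Proof. by split=> [/asboolP|fg]; last apply/asboolP. Qed.

Lemma eq_uptoE n f g d : eq_upto n f g -> (d < n)%N -> f d = g d.
Proof. by move=> /eq_uptoP fg; apply: fg. Qed.

Lemma eq_upto_refl n f : eq_upto n f f. Proof. by apply/eq_uptoP. Qed.

Lemma eq_upto_sym n f g : eq_upto n f g -> eq_upto n g f.
Proof. by move=> /eq_uptoP fg; apply/eq_uptoP => d lt; rewrite fg. Qed.

Lemma eq_upto_trans n f g h : eq_upto n f g -> eq_upto n g h -> eq_upto n f h.
Proof. by move=> /eq_uptoP fg /eq_uptoP gh; apply/eq_uptoP => d lt; rewrite fg // gh. Qed.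

Lemma eq_uptoW m n f g : (m <= n)%N -> eq_upto n f g -> eq_upto m f g.
Proof. by move=> le /eq_uptoP fg; apply/eq_uptoP => d lt; apply: fg; apply: leq_trans lt le. Qed.

Lemma eq_uptoD n f f' g g' : eq_upto n f f' -> eq_upto n g g' ->
  eq_upto n (f + g) (f' + g').
Proof. by move=> /eq_uptoP ff /eq_uptoP gg; apply/eq_uptoP => d lt; rewrite !seriesD ff // gg. Qed.

Lemma seriesN f d : (- f) d = - f d. Proof. by []. Qed.

Lemma eq_uptoN n f f' : eq_upto n f f' -> eq_upto n (- f) (- f').
Proof. by move=> /eq_uptoP ff; apply/eq_uptoP => d lt; rewrite !seriesN ff. Qed.

Lemma eq_uptoM n f f' g g' : eq_upto n f f' -> eq_upto n g g' ->
  eq_upto n (f * g) (f' * g').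
Proof.
move=> /eq_uptoP ff /eq_uptoP gg; apply/eq_uptoP => d lt; rewrite !seriesM; apply: eq_bigr => i _.
rewrite ff ?gg //; first exact: leq_ltn_trans (leq_subr _ _) lt.
by apply: leq_ltn_trans lt; rewrite -ltnS.
Qed.

Lemma eq_upto_all f g : (forall n, eq_upto n f g) -> f = g.
Proof. by move=> fg; apply: seriesP => d; apply: (eq_uptoE (fg d.+1)). Qed.

Definition ord_ge n f := eq_upto n f 0.

Lemma ord_geP n f : ord_ge n f <-> forall d, (d < n)%N -> f d = 0.
Proof.
split=> [/eq_uptoP of0 d lt|of0]; first by rewrite of0 // ser0E.
by apply/eq_uptoP=> d lt; rewrite of0 // ser0E.
Qed.

Lemma ord_geM m n f g : ord_ge m f -> ord_ge n g -> ord_ge (m + n) (f * g).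
Proof.
move=> /ord_geP f0 /ord_geP g0; apply/ord_geP => d lt.
rewrite seriesM big1 // => i _; case: (ltnP i m) => im; first by rewrite f0 // mul0r.
have le_id : (i <= d)%N by rewrite -ltnS.
suff -> : g (d - i)%N = 0 by rewrite mulr0.
apply: g0; rewrite ltn_subLR //; apply: leq_trans lt _.
by rewrite leq_add2r.
Qed.

Lemma ord_geX f i : ord_ge 1 f -> ord_ge i (f ^+ i).
Proof.
move=> f1; elim: i => [|i IH]; first by apply/ord_geP => d; rewrite ltn0.
by rewrite exprS -add1n; apply: ord_geM.
Qed.

Lemma ord_geXX f g i j : ord_ge 1 f -> ord_ge 1 g -> ord_ge (i + j) (f ^+ i * g ^+ j).
Proof. by move=> f1 g1; apply: ord_geM; apply: ord_geX. Qed.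

Lemma series_constM c f d : (series_const I c * f) d = c *: f d.
Proof.
rewrite seriesM big_ord_recl /= subn0 big1 ?addr0 ?mul_malgC // => i _.
by rewrite mul0r.
Qed.

Lemma ord_ge_var (i : I) : ord_ge 1 (series_var R i).
Proof. by apply/ord_geP; case. Qed.

End SeriesOrder.

Section FglEval.
Variables (I : choiceType) (R : comNzRingType).
Local Notation ser := (series I R).
Implicit Types (f g : ser) (a : nat -> nat -> R).

(** Beyond the truncation of the definition all terms vanish, f^i g^j having order at least i + j. A
    bound n independent of the degree lets all degrees below n be treated together. *)
Lemma fgl_eval_widen a f g d n : ord_ge 1 f -> ord_ge 1 g -> (d < n)%N ->
  fgl_eval a f g d =
  \sum_(i < n) \sum_(j < n) a i j *: (f ^+ i * g ^+ j : ser) d.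
Proof.
move=> f1 g1 lt.
pose H i j := a i j *: (f ^+ i * g ^+ j : ser) d.
have H0 i j : (d < i + j)%N -> H i j = 0.
  by move=> dij; rewrite /H (eq_uptoE (ord_geXX i j f1 g1) dij) ser0E scaler0.
have -> : fgl_eval a f g d = \sum_(i < d.+1) \sum_(j < d.+1) H i j by [].
have widen (G : nat -> {malg R[{cmonom I}]}) :
    (forall i, (d < i)%N -> G i = 0) -> \sum_(i < d.+1) G i = \sum_(i < n) G i.
  move=> G0; rewrite -!(big_mkord xpredT G) [RHS](big_cat_nat (n := d.+1)) //=.
  rewrite [X in _ = _ + X]big_nat_cond [X in _ = _ + X]big1 ?addr0 //.
  by move=> i /andP[/andP[di _] _]; apply: G0.
rewrite (widen (fun i => \sum_(j < d.+1) H i j)) => [|i di]; last first.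
  rewrite big1 // => j _; apply: H0; apply: leq_trans di _; exact: leq_addr.
apply: eq_bigr => i _; apply: (widen (H i)) => j dj.
by apply: H0; apply: leq_trans dj _; exact: leq_addl.
Qed.

Lemma fgl_eval_upto a f g n : ord_ge 1 f -> ord_ge 1 g ->
  eq_upto n (fgl_eval a f g)
    (\sum_(i < n) \sum_(j < n) series_const I (a i j) * (f ^+ i * g ^+ j)).
Proof.
move=> f1 g1; apply/eq_uptoP => d lt; rewrite (fgl_eval_widen _ f1 g1 lt) ser_sum.
apply: eq_bigr => i _; rewrite ser_sum; apply: eq_bigr => j _.
by rewrite series_constM.
Qed.

Lemma series_varM (i : I) f d :
  (series_var R i * f) d.+1 = << ucm i >> * f d.
Proof.
rewrite seriesM big_ord_recl big_ord_recl big1 /= => [|j _]; last by rewrite /= mul0r.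
by rewrite mul0r add0r addr0 subSS subn0.
Qed.

Definition monom_pow (i : I) n (m : {cmonom I}) := iter n (mmul (ucm i)) m.

Lemma series_var_mulX (i j : I) n k d :
  (series_var R i ^+ n * series_var R j ^+ k) d =
  if d == (n + k)%N then << monom_pow i n (monom_pow j k mone) >> else 0.
Proof.
have varX f m e n' : f = (fun d => if d == e then << m >> else 0) :> (nat -> _) ->
    forall d, (series_var R i ^+ n' * f) d =
    if d == (n' + e)%N then << monom_pow i n' m >> else 0.
  move=> fE; elim: n' => [|n' IH] d'; first by rewrite mul1r fE.
  rewrite exprS -mulrA; case: d' => [|d'].
    by rewrite seriesM big_ord_recl big_ord0 /= mul0r addr0.
  rewrite series_varM IH addSn eqSS; case: eqP => _; last by rewrite mulr0.
  by rewrite malgM_def fgmulUU mulr1.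
apply: varX; apply: funext; elim: k => [|k IH] d'.
  by rewrite expr0 /=; case: eqP => // _; rewrite -mpolyC1E.
rewrite exprS; case: d' => [|d'].
  by rewrite seriesM big_ord_recl big_ord0 /= mul0r addr0.
rewrite series_varM IH eqSS; case: eqP => _; last by rewrite mulr0.
by rewrite malgM_def fgmulUU mulr1.
Qed.

Lemma monom_powE (i j : I) n m : monom_pow i n m j = ((i == j) * n + m j)%N.
Proof.
elim: n => [|n IH]; first by rewrite muln0.
by rewrite /= cmM IH cmU mulnS addnA.
Qed.

End FglEval.

Section FglCoef.
Variables (R : comNzRingType) (F : formal_group_law R).
Local Notation x := (@series_var 'I_3 R).

Lemma coef_fgl_eval (a : nat -> nat -> R) (s t : 'I_3) d m :
  (fgl_eval a (x s) (x t) d)@_m = \sum_(i < d.+1) \sum_(j < d.+1)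
    a i j * ((d == i + j)%N && (monom_pow s i (monom_pow t j mone) == m))%:R.
Proof.
rewrite (fgl_eval_widen a (ord_ge_var R s) (ord_ge_var R t) (ltnSn d)).
rewrite raddf_sum; apply: eq_bigr => i _; rewrite raddf_sum; apply: eq_bigr => j _.
rewrite [LHS]mcoeffZ series_var_mulX; case: eqP => _; last by rewrite mcoeff0.
by rewrite mcoeffU1.
Qed.

Lemma coef_fgl_var (s t : 'I_3) d : s != t ->
  (fgl_eval F (x s) (x t) d)@_(monom_pow s d mone) = F d 0%N.
Proof.
move=> st; rewrite coef_fgl_eval (bigD1 (@ord_max d)) //= [X in _ + X]big1 ?addr0 => [|i id].
  rewrite (bigD1 ord0) //= [X in _ + X]big1 ?addr0 => [|j jd]; last first.
    by move: jd; rewrite -val_eqE /= -(eqn_add2l d) addn0 eq_sym => /negPf->; rewrite mulr0.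
  by rewrite addn0 !eqxx mulr1.
rewrite big1 // => j _; case: (_ =P _ :> {cmonom _}) => [|_]; last by rewrite andbF mulr0.
move=> /(congr1 (fun m : {cmonom _} => m s)).
rewrite !monom_powE cm1 eqxx !mul1n (eq_sym t) (negPf st) mul0n !addn0 => E.
by rewrite -val_eqE /= E eqxx in id.
Qed.

Lemma coef_fgl_var0 (s t : 'I_3) d : s != t ->
  (fgl_eval F (x s) (x t) d)@_(monom_pow t d mone) = F 0%N d.
Proof.
move=> st; rewrite coef_fgl_eval (bigD1 ord0) //= [X in _ + X]big1 ?addr0 => [|i id].
  rewrite (bigD1 (@ord_max d)) //= [X in _ + X]big1 ?addr0 => [|j jd]; last first.
    by move: jd; rewrite -val_eqE /= eq_sym add0n => /negPf->; rewrite mulr0.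
  by rewrite add0n !eqxx mulr1.
rewrite big1 // => j _; case: (_ =P _ :> {cmonom _}) => [|_]; last by rewrite andbF mulr0.
move=> /(congr1 (fun m : {cmonom _} => m s)).
rewrite !monom_powE cm1 eqxx mul1n (eq_sym t) (negPf st) !mul0n !addn0 => E.
by rewrite -val_eqE /= E eqxx in id.
Qed.

Lemma fgl_coefr0 d : F d 0%N = (d == 1%N)%:R.
Proof.
pose m : {cmonom 'I_3} := monom_pow (inord 0) d mone.
have /(congr1 (fun f : series 'I_3 R => (f d)@_m)) := fgl_right0 F.
have ord_0 : ord_ge 1 (0 : series 'I_3 R) by apply/ord_geP => e _; rewrite ser0E.
have -> : (fgl_eval F (x (inord 0)) 0 d)@_m =
    \sum_(i < d.+1) F i 0%N * ((x (inord 0) ^+ i : series 'I_3 R) d)@_m.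
  rewrite (fgl_eval_widen F (ord_ge_var R _) ord_0 (ltnSn d)) raddf_sum.
  apply: eq_bigr => i _; rewrite raddf_sum big_ord_recl [X in _ + X]big1 => [|j _].
    by rewrite addr0 [LHS]mcoeffZ expr0 mulr1.
  by rewrite [LHS]mcoeffZ expr0n mulr0 ser0E mcoeff0 mulr0.
have xE i : (x (inord 0) ^+ i : series 'I_3 R) d =
    if d == i then << monom_pow (inord 0) i mone >> else 0.
  have := series_var_mulX R (inord 0 : 'I_3) (inord 0) i 0 d.
  by rewrite expr0 mulr1 addn0.
have -> : (x (inord 0) d)@_m = (d == 1%N)%:R.
  have := xE 1%N; rewrite expr1 => ->; case: eqP => [dE|_]; last by rewrite mcoeff0.
  by rewrite /m dE mcoeffUU.
move=> <-; rewrite (bigD1 (@ord_max d)) //= [X in _ + X]big1 => [|i id].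
  by rewrite addr0 xE eqxx mcoeffU1 eqxx mulr1.
rewrite xE; case: eqP => dE; last by rewrite mcoeff0 mulr0.
by move: id; rewrite -val_eqE /= -dE eqxx.
Qed.

Lemma fgl_coef0r d : F 0%N d = (d == 1%N)%:R.
Proof.
have ne : (inord 0 : 'I_3) != inord 1 by rewrite -val_eqE /= !inordK.
rewrite -(coef_fgl_var0 d ne) -fgl_coefr0 fgl_comm.
by rewrite coef_fgl_var // eq_sym.
Qed.

End FglCoef.

Lemma fgl_sum_split (T : comNzRingType) (A : nat -> nat -> T) (f g : T) n :
    (forall d, A d 0%N = (d == 1%N)%:R) -> (forall d, A 0%N d = (d == 1%N)%:R) ->
  \sum_(i < n.+2) \sum_(j < n.+2) A i j * (f ^+ i * g ^+ j) =
  f + g + f * g * (\sum_(i < n.+1) \sum_(j < n.+1) A i.+1 j.+1 * (f ^+ i * g ^+ j)).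
Proof.
move=> A0 A1.
have delta (G : nat -> T) (a : nat -> T) : (forall d, a d = (d == 1%N)%:R) ->
    \sum_(i < n.+2) a i * G i = G 1%N.
  move=> aE; rewrite !big_ord_recl big1 => [|i _]; first by rewrite !aE mul0r mul1r add0r addr0.
  by rewrite aE mul0r.
rewrite big_ord_recl /= (delta (fun j => f ^+ 0 * g ^+ j)) // expr0 mul1r expr1.
under eq_bigr => i _ do rewrite big_ord_recl /= expr0 mulr1 /bump /= add1n.
rewrite big_split /=.
have -> : \sum_(i < n.+1) A i.+1 0%N * f ^+ i.+1 = f.
  have := delta (fun i => f ^+ i) _ A0; rewrite big_ord_recl A0 mul0r add0r expr1.
  by move=> {2}<-; apply: eq_bigr.
rewrite addrA [g + f]addrC; congr (_ + _).
rewrite mulr_sumr; apply: eq_bigr => i _; rewrite mulr_sumr; apply: eq_bigr => j _.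
by rewrite /bump /= add1n !exprS; ring.
Qed.

(** Besides x and y, every monomial of F is divisible by x y, since F(x, 0) = x and F(0, y) = y. All
    divisibilities between the generators x_l rest on this. *)
Lemma fgl_eval_decomp (I : choiceType) (R : comNzRingType) (F : formal_group_law R)
    (f g : series I R) : ord_ge 1 f -> ord_ge 1 g ->
  fgl_eval F f g = f + g + f * g * fgl_eval (fun i j => F i.+1 j.+1) f g.
Proof.
move=> f1 g1; apply: eq_upto_all => n.
(* Truncation at n + 2, because taking out the factor f g leaves a sum truncated at n + 1. *)
apply: eq_upto_trans (eq_uptoW (leqW (leqnSn n)) (fgl_eval_upto F _ f1 g1)) _.
apply: eq_upto_sym; apply: eq_upto_trans.
  apply: eq_uptoD; first exact: eq_upto_refl.
  apply: eq_uptoM; first exact: eq_upto_refl.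
  exact: eq_uptoW (leqnSn n) (fgl_eval_upto _ _ f1 g1).
have constE (b : bool) : series_const I (b%:R : R) = b%:R by case: b.
rewrite -(@fgl_sum_split _ (fun i j => series_const I (F i j))) => [|d|d].
- exact: eq_upto_refl.
- by rewrite fgl_coefr0 constE.
- by rewrite fgl_coef0r constE.
Qed.

(** * The generators x_l and functoriality in the lattice *)

Section FgaMap.
Variables (R : comNzRingType) (F : formal_group_law R).
Local Notation x := (fga_var F).

Lemma pi_fga0 (L : zmodType) (f : series L R) :
  (\pi_(fga F L) f == 0) = (f \in @fga_ideal _ F L).
Proof.
have -> : 0 = \pi_(fga F L) (0 : series L R) by rewrite -[LHS](rmorph0 (\pi_(fga F L))).
by rewrite -Quotient.idealrBE subr0.
Qed.

(** The ideal is closed: it suffices to approximate f in every degree by elements of the ideal,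
    which is how infinite sums are handled. *)
Lemma pi_fga_closed (L : zmodType) (f : series L R) :
  (forall n, exists2 g : series L R, \pi_(fga F L) g = 0 & eq_upto n f g) ->
  \pi_(fga F L) f = 0.
Proof.
move=> H; apply/eqP; rewrite pi_fga0; apply/asboolP => n.
have [g /eqP] := H n; rewrite pi_fga0 => /asboolP/(_ n)[h rel gh] fg.
by exists h => // d lt; rewrite (eq_uptoE fg) // gh.
Qed.

Lemma fga_var0 (L : zmodType) : x (0 : L) = 0.
Proof.
apply: pi_fga_closed => n; exists (series_var R 0); last exact: eq_upto_refl.
apply/eqP; rewrite pi_fga0; apply/asboolP => m; exists (series_var R 0) => //.
exists 1%N, (fun=> 1), (fun=> series_var R 0); split; first by move=> _; constructor.
by rewrite big_ord_recl big_ord0 mul1r addr0.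
Qed.

Lemma pi_fga_var_add (L : zmodType) (l m : L) :
  x (l + m) = \pi_(fga F L) (fgl_eval F (series_var R l) (series_var R m)).
Proof.
apply/eqP; rewrite -Quotient.idealrBE; apply/asboolP => n.
exists (series_var R (l + m) - fgl_eval F (series_var R l) (series_var R m)) => //.
exists 1%N, (fun=> 1).
exists (fun=> series_var R (l + m) - fgl_eval F (series_var R l) (series_var R m)).
split; first by move=> _; constructor.
by rewrite big_ord_recl big_ord0 mul1r addr0.
Qed.

Lemma fga_varD (L : zmodType) (l m : L) :
  exists h, x (l + m) = x l + x m + x l * x m * h.
Proof.
exists (\pi_(fga F L) (fgl_eval (fun i j => F i.+1 j.+1) (series_var R l) (series_var R m))).
rewrite pi_fga_var_add fgl_eval_decomp; try exact: ord_ge_var.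
by rewrite !rmorphD !rmorphM.
Qed.

Lemma fga_varN_dvd (L : zmodType) (l : L) : exists c, x (- l) = x l * c.
Proof.
have [h] := fga_varD l (- l); rewrite subrr fga_var0 => E.
exists (- 1 - x (- l) * h).
transitivity (x (- l) - (x l + x (- l) + x l * x (- l) * h)); first by rewrite -E subr0.
by ring.
Qed.

(** After division by x_l x_(-l) it says that 1/x_l + 1/x_(-l) lies in S; see [intQ_xi_opp]. *)
Lemma fga_varN_sum (L : zmodType) (l : L) :
  exists h, x l + x (- l) = x l * x (- l) * h.
Proof.
have [h] := fga_varD l (- l); rewrite subrr fga_var0 => E.
by exists (- h); apply/eqP; rewrite -subr_eq0 mulrN opprK -E.
Qed.

(** F(x, y) is x modulo y, so x_l does not change modulo x_a when a is added to l or subtracted from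
    it. *)
Lemma fga_varMz_cong (L : zmodType) (a l : L) (n : int) :
  exists t, x l - x (l + a *~ n) = x a * t.
Proof.
have stepD (m : L) : exists t, x m - x (m + a) = x a * t.
  have [h ->] := fga_varD m a; exists (- 1 - x m * h); ring.
have stepN (m : L) : exists t, x m - x (m - a) = x a * t.
  have [t E] := stepD (m - a); exists (- t); rewrite mulrN -E subrK; ring.
case: n => n.
  rewrite -pmulrn; elim: n => [|n [t E]]; first by exists 0; rewrite mulr0n addr0 subrr mulr0.
  have [u E'] := stepD (l + a *+ n); exists (t + u).
  by rewrite mulrDr -E -E' mulrSr addrA; ring.
rewrite NegzE mulrNz -pmulrn; elim: n.+1 => [|k [t E]].
  by exists 0; rewrite mulr0n subr0 subrr mulr0.
have [u E'] := stepN (l - a *+ k); exists (t + u).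
by rewrite mulrDr -E -E' mulrSr opprD addrA; ring.
Qed.

Variables (L M : zmodType) (phi : {additive L -> M}).

(** Besides the Weyl group, this is applied to projections of L along a root and to maps from
    [L * int] to L. *)
Definition fga_map (s : fga F L) : fga F M :=
  \pi_(fga F M) (series_rename phi (generic_quotient.repr s)).

Lemma fga_map_pi (f : series L R) :
  fga_map (\pi_(fga F L) f) = \pi_(fga F M) (series_rename phi f).
Proof.
apply/eqP; rewrite /fga_map -Quotient.idealrBE -rmorphB.
have : generic_quotient.repr (\pi_(fga F L) f) - f \in @fga_ideal _ F L.
  by rewrite Quotient.idealrBE reprK.
set g := _ - f => /asboolP If; apply/asboolP => n.
have [_ [k [c [r [rel ->]]]] fE] := If n.
exists (series_rename phi (\sum_i c i * r i)); last first.
  by move=> d lt_dn; apply: (congr1 (rename_mpoly phi (R := R)) (fE d lt_dn)).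
exists k, (fun i => series_rename phi (c i)), (fun i => series_rename phi (r i)).
split=> [i|]; last by rewrite rmorph_sum; apply: eq_bigr => i _; rewrite rmorphM.
case: (rel i) => [|l m].
  by rewrite series_rename_var raddf0; apply: FgaZero.
rewrite rmorphB /= series_rename_fgl_eval !series_rename_var raddfD.
exact: FgaAdd.
Qed.

Lemma fga_map_zmod_morphism : zmod_morphism fga_map.
Proof.
move=> s t; rewrite -[s]reprK -[t]reprK -rmorphB [LHS]fga_map_pi !fga_map_pi.
by rewrite raddfB; exact: rmorphB.
Qed.

Lemma fga_map_monoid_morphism : monoid_morphism fga_map.
Proof.
split=> [|s t].
  have <- : \pi_(fga F L) (1 : series L R) = 1 by exact: rmorph1.
  by rewrite fga_map_pi rmorph1; exact: rmorph1.
rewrite -[s]reprK -[t]reprK -rmorphM [LHS]fga_map_pi !fga_map_pi.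
by rewrite rmorphM; exact: rmorphM.
Qed.

HB.instance Definition _ := GRing.isZmodMorphism.Build _ _ fga_map
  fga_map_zmod_morphism.
HB.instance Definition _ := GRing.isMonoidMorphism.Build _ _ fga_map
  fga_map_monoid_morphism.

Lemma fga_map_var l : fga_map (x l) = x (phi l).
Proof. by rewrite [LHS]fga_map_pi series_rename_var. Qed.

End FgaMap.
 

(** * Congruences modulo x_a *)

Section Congruence.
Variables (R : comNzRingType) (F : formal_group_law R) (L : zmodType).
Variables (phi : {additive L -> L}) (a : L).
Hypothesis phi_a : forall l, exists n : int, phi l = l + a *~ n.
Local Notation x := (fga_var F).
Local Notation S := (fga F L).
Local Notation ser := (series L R).
Local Notation ren := (series_rename phi).

(** The bound on the order of q is what lets the quotients of the infinitely many homogeneous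
    components of a series be added up to a series. *)
Definition quotient_at d (f : ser) (q : ser) : Prop :=
  ord_ge d.-1 q /\ \pi_S (f - ren f - series_var R a * q) = 0.

Definition divisible_at d (f : ser) : Prop := ord_ge d f /\ exists q, quotient_at d f q.

Lemma pi_congE (f q : ser) : \pi_S (f - ren f - series_var R a * q) =
  \pi_S f - fga_map phi (\pi_S f) - x a * \pi_S q.
Proof. by rewrite fga_map_pi !rmorphB rmorphM. Qed.

Lemma ord_geD n (f g : ser) : ord_ge n f -> ord_ge n g -> ord_ge n (f + g).
Proof. by move=> f0 g0; rewrite /ord_ge -[0 : ser]addr0; apply: eq_uptoD. Qed.

Lemma ord_ge_rename n (f : ser) : ord_ge n f -> ord_ge n (ren f).
Proof.
move=> /ord_geP f0; apply/ord_geP => d lt.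
have -> : ren f d = rename_mpoly phi (f d) by [].
by rewrite f0 // raddf0.
Qed.

Lemma divisible_at0 d : divisible_at d 0.
Proof.
split; first exact: eq_upto_refl.
exists 0; split; first exact: eq_upto_refl.
by rewrite pi_congE !rmorph0 mulr0 !subrr.
Qed.

Lemma divisible_atD d f g : divisible_at d f -> divisible_at d g -> divisible_at d (f + g).
Proof.
move=> [f0 [q [q0 fq]]] [g0 [r [r0 gr]]]; split; first exact: ord_geD.
exists (q + r); split; first exact: ord_geD.
move: fq gr; rewrite !pi_congE !rmorphD /= => fq gr.
by rewrite -[RHS]addr0 -{1}fq -gr; ring.
Qed.

Lemma divisible_atM d e f g : divisible_at d f -> divisible_at e g ->
  divisible_at (d + e) (f * g).
Proof.
move=> [f0 [q [q0 fq]]] [g0 [r [r0 gr]]]; split; first exact: ord_geM.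
(* Twisted Leibniz rule: f g - f' g' = (f - f') g + f' (g - g'), where f' and g' are the images
   under [phi]. *)
exists (q * g + ren f * r); split.
  apply: ord_geD; [apply: eq_uptoW (ord_geM q0 g0) | apply: eq_uptoW (ord_geM (ord_ge_rename f0) r0)].
    by case: (d) => [|d'] /=; rewrite ?leq_pred.
  by case: (e) => [|e'] /=; rewrite ?addn0 ?leq_pred // addnS.
move: fq gr; rewrite !pi_congE => /eqP; rewrite subr_eq0 => /eqP fq.
move=> /eqP; rewrite subr_eq0 => /eqP gr.
rewrite !rmorphD !rmorphM /= mulrDr !mulrA -fq fga_map_pi -[x a * _ * _]mulrA.
rewrite [x a * (_ * _)]mulrCA -gr -!fga_map_pi; ring.
Qed.

Lemma divisible_at_var l : divisible_at 1 (series_var R l).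
Proof.
split; first exact: ord_ge_var.
have [n E] := phi_a l; have [t xt] := fga_varMz_cong F a l n.
exists (generic_quotient.repr t); split; first by apply/ord_geP => d; rewrite ltn0.
rewrite pi_congE reprK -[\pi_S (series_var R l)]/(x l) fga_map_var.
by rewrite E xt subrr.
Qed.

Lemma divisible_at_const c : divisible_at 0 (series_const L c).
Proof.
split; first by apply/ord_geP => d; rewrite ltn0.
exists 0; split; first exact: eq_upto_refl.
have -> : ren (series_const L c) = series_const L c.
  apply: seriesP => d; have -> : ren (series_const L c) d =
    rename_mpoly phi (if d == 0%N then c%:MP else 0) by [].
  by rewrite /=; case: eqP => _; rewrite ?raddf0 // /rename_mpoly mmapC.
by rewrite mulr0 !subrr rmorph0.
Qed.

Lemma mono_graded (c : R) (m : {cmonom L}) :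
  graded (fun d => if d == mdeg m then << c *g m >> else 0).
Proof. by move=> d; case: eqP => [->|_]; [apply: homogU | apply: homog0]. Qed.

Definition mono c m : ser := mk_series (@mono_graded c m).

Lemma monoE c m d : mono c m d = if d == mdeg m then << c *g m >> else 0.
Proof. by []. Qed.

Lemma divisible_at_mono c m : divisible_at (mdeg m) (mono c m).
Proof.
elim: {m}(mdeg m) {-2}m (erefl (mdeg m)) => [|n IH] m mE.
  have -> : mono c m = series_const L c.
    apply: seriesP => d; rewrite monoE mE (mdeg_eq0I mE).
    by have -> : series_const L c d = if d == 0%N then c%:MP else 0 by [].
  by rewrite mE; apply: divisible_at_const.
have [i im] : exists i, i \in finsupp m.
  case: (fset_0Vmem (finsupp m)) => [m0|[i im]]; last by exists i.
  by move: mE; rewrite mdegE m0 big_seq_fset0.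
have [m' m'E] : exists m', m = mmul (ucm i) m'.
  exists (divcm m (ucm i)); apply/eqP/cmP => j; rewrite cmM divcmE cmU.
  case: (i =P j) => [<-|_]; last by rewrite subn0.
  by rewrite /= subnKC // lt0n cmE_neq0.
have m'n : mdeg m' = n by move: mE; rewrite m'E mdegM mdegU => [[]].
have -> : mono c m = series_var R i * mono c m'.
  apply: seriesP; case=> [|d].
    by rewrite seriesM big_ord_recl big_ord0 monoE mE /= mul0r addr0.
  rewrite series_varM !monoE mE m'n eqSS; case: eqP => _; last by rewrite mulr0.
  by rewrite malgM_def fgmulUU mul1r m'E.
rewrite mE -add1n; apply: divisible_atM (divisible_at_var i) _.
by rewrite -m'n; apply: IH.
Qed.

Lemma piece_graded (f : ser) (e : nat) : graded (fun d => if d == e then f d else 0).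
Proof. by move=> d; case: eqP => _; [apply: homog_component | apply: homog0]. Qed.

Definition piece f e : ser := mk_series (@piece_graded f e).

Lemma divisible_at_piece f e : divisible_at e (piece f e).
Proof.
have -> : piece f e = \sum_(m <- msupp (f e)) mono (f e)@_m m.
  apply: seriesP => d; rewrite ser_sum /=; case: eqP => [->|de].
    rewrite {1}[f e]monalgE big_seq [RHS]big_seq; apply: eq_bigr => m mf.
    by rewrite (homog_component mf) eqxx.
  rewrite big_seq big1 // => m mf; rewrite (homog_component mf).
  by case: eqP.
rewrite big_seq; apply: (big_ind (divisible_at e)).
- exact: divisible_at0.
- exact: divisible_atD.
- by move=> m mf; rewrite -[X in divisible_at X](homog_component mf); apply: divisible_at_mono.
Qed.

(** The claim holds for variables, hence for monomials by the Leibniz rule and for homogeneous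
    components by additivity; the quotients of the components are then summed. For a reflection it
    makes (s - s_a (s)) / x_a an element of S. *)
Lemma fga_map_cong (s : S) : exists t, s - fga_map phi s = x a * t.
Proof.
rewrite -[s]reprK; move: (generic_quotient.repr s) => f.
pose q e := projT1 (cid (divisible_at_piece f e).2).
have qP e : quotient_at e (piece f e) (q e).
  exact: projT2 (cid (divisible_at_piece f e).2).
have q0 e d : (d < e.-1)%N -> q e d = 0 by move=> lt; have [/ord_geP->] := qP e.
(* Only the [q e] with e <= d + 1 reach degree d, their order being at least e - 1. *)
have g_graded : graded (fun d => \sum_(e < d.+2) q e d).
  by move=> d; apply: homog_sum => e _; apply: homog_component.
pose g := mk_series g_graded.
exists (\pi_S g); apply/eqP; rewrite -subr_eq0 -pi_congE; apply/eqP.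
apply: pi_fga_closed => n.
exists (\sum_(e < n.+1) (piece f e - ren (piece f e) - series_var R a * q e)).
  by rewrite rmorph_sum big1 // => e _; have [] := qP e.
rewrite sumrB sumrB -mulr_sumr -rmorph_sum /=.
have fE : eq_upto n f (\sum_(e < n.+1) piece f e).
  apply/eq_uptoP => d lt; rewrite ser_sum (bigD1 (Ordinal (leqW lt))) //= eqxx.
  rewrite big1 ?addr0 // => e; rewrite -val_eqE /= eq_sym => /negPf ->.
  by [].
have gE : eq_upto n g (\sum_(e < n.+1) q e).
  apply/eq_uptoP => d lt; rewrite ser_sum /=.
  rewrite -(big_mkord xpredT (fun e => q e d)) -(big_mkord xpredT (fun e => q e d)).
  rewrite [RHS](big_cat_nat (n := d.+2)) //= [X in _ = _ + X]big_nat_cond.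
  rewrite [X in _ = _ + X]big1 ?addr0 // => e /andP[/andP[de _] _].
  by apply: q0; rewrite -ltnS (ltn_predK de).
apply: eq_uptoD; last by apply: eq_uptoN; apply: eq_uptoM gE; apply: eq_upto_refl.
apply: eq_uptoD => //; apply: eq_uptoN.
apply/eq_uptoP => d lt; have ren_comp h : ren h d = rename_mpoly phi (h d) by [].
by rewrite !ren_comp (eq_uptoE fE).
Qed.

End Congruence.

(** * Root systems and Weyl groups *)

Section InvariantForm.
Variables (L : zmodType) (D : root_datum L).
Local Notation W := (weyl D).
Local Notation T := (root_type D).

Let rk := projT1 (cid (lattice_free D)).
Let basis : 'I_rk -> L := projT1 (cid (projT2 (cid (lattice_free D)))).
Let basisP : forall l, exists! c : {ffun 'I_rk -> int}, l = \sum_i basis i *~ c i :=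
  projT2 (cid (projT2 (cid (lattice_free D)))).

Definition lattice_coord (l : L) : {ffun 'I_rk -> int} :=
  projT1 (cid (basisP l)).

Lemma lattice_coordE l : l = \sum_i basis i *~ lattice_coord l i.
Proof. by rewrite /lattice_coord; case: cid => c []. Qed.

Lemma lattice_coord_uniq l (c : {ffun _ -> int}) : l = \sum_i basis i *~ c i -> lattice_coord l = c.
Proof. by rewrite /lattice_coord; case: cid => d [? u]; apply: u. Qed.

Lemma lattice_coord_additive : zmod_morphism lattice_coord.
Proof.
move=> l m; apply: lattice_coord_uniq.
rewrite {1}(lattice_coordE l) {1}(lattice_coordE m) -sumrB.
by apply: eq_bigr => i _; rewrite !ffunE mulrzBr.
Qed.

HB.instance Definition _ := GRing.isZmodMorphism.Build L {ffun 'I_rk -> int}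
  lattice_coord lattice_coord_additive.

Definition dot (l m : L) : int := \sum_i lattice_coord l i * lattice_coord m i.

(** The form [dot] depends on a basis of the lattice; the sum over W makes it invariant and keeps it
    positive definite. *)
Definition wform (l m : L) : int := \sum_(w : W) dot (w l) (w m).

Lemma dotC l m : dot l m = dot m l.
Proof. by apply: eq_bigr => i _; rewrite mulrC. Qed.

Lemma dotBr l m n : dot l (m - n) = dot l m - dot l n.
Proof. by rewrite -sumrB; apply: eq_bigr => i _; rewrite raddfB !ffunE mulrBr. Qed.

Lemma wformC l m : wform l m = wform m l.
Proof. by apply: eq_bigr => w _; rewrite dotC. Qed.

Lemma wformBr l m n : wform l (m - n) = wform l m - wform l n.
Proof. by rewrite -sumrB; apply: eq_bigr => i _; rewrite raddfB dotBr. Qed.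

Lemma wform_additive l : zmod_morphism (wform l).
Proof. by move=> m n; rewrite wformBr. Qed.

HB.instance Definition _ l := GRing.isZmodMorphism.Build L int (wform l)
  (wform_additive l).

Lemma wformW (w : W) l m : wform (w l) (w m) = wform l m.
Proof.
rewrite /wform [RHS](reindex_inj (mulIg w)); apply: eq_bigr => v _.
by rewrite !weylM.
Qed.

Lemma wform_gt0 l : l != 0 -> 0 < wform l l.
Proof.
move=> l0; rewrite /wform (bigD1 1%g) //= ltr_pwDl //; last first.
  by apply: sumr_ge0 => w _; apply: sumr_ge0 => i _; rewrite -expr2 sqr_ge0.
have dge : 0 <= dot l l by apply: sumr_ge0 => i _; rewrite -expr2 sqr_ge0.
rewrite lt_def dge andbT; apply: contra l0 => /eqP d0.
rewrite (lattice_coordE l) big1 // => i _.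
have /eqP := d0; rewrite psumr_eq0 => [|j _]; last by rewrite -expr2 sqr_ge0.
move=> /allP/(_ i (mem_index_enum i)) /=.
by rewrite -expr2 sqrf_eq0 => /eqP ->; rewrite mulr0z.
Qed.

Lemma weyl_reflectionE (a : T) l : weyl_reflection a l = l - val a *~ coroot a l.
Proof. by []. Qed.

Lemma root_neq0 (a : T) : val a != 0.
Proof.
apply/eqP => a0; have := coroot_self a; rewrite [X in coroot a X]a0 raddf0.
by [].
Qed.

Lemma weyl_reflection_self (a : T) : weyl_reflection a (val a) = - val a.
Proof.
rewrite weyl_reflectionE coroot_self.
have -> : val a *~ 2 = val a + val a by exact: mulr2n.
by rewrite opprD addrA subrr add0r.
Qed.

(** As s_a preserves the form and sends a to - a, it is the orthogonal reflection, and a^\vee is 2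
    (a, .) / (a, a). *)
Lemma coroot_wform (a : T) l :
  coroot a l * wform (val a) (val a) = 2 * wform (val a) l.
Proof.
have wformNl m n : wform (- m) n = - wform m n by rewrite wformC raddfN wformC.
have := wformW (weyl_reflection a) (val a) l.
rewrite weyl_reflection_self weyl_reflectionE wformNl raddfB /= raddfMz /=.
rewrite mulrzz; move: (wform _ _) (wform _ l) (coroot a l) => p q k E.
transitivity (- (q - p * k) + q); first by ring.
by rewrite E; ring.
Qed.

(** The invariant form expresses a coroot by its root, so W permutes the coroots as it permutes the
    roots. *)
Lemma coroot_weyl (w : W) (b c : T) l : val c = w (val b) ->
  coroot c (w l) = coroot b l.
Proof.
move=> cE; have b0 := wform_gt0 (root_neq0 b).
apply: (mulIf (lt0r_neq0 b0)); rewrite coroot_wform.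
by rewrite -(wformW w (val b) (val b)) -cE coroot_wform cE wformW.
Qed.

Lemma weyl_rootM (v w : W) b : weyl_root (v * w)%g b = weyl_root v (weyl_root w b).
Proof. exact: val_inj. Qed.

Lemma weyl_root1 b : weyl_root (1%g : W) b = b.
Proof. exact: val_inj. Qed.

Lemma weyl_rootK w : cancel (weyl_root w) (weyl_root (w^-1)%g : T -> T).
Proof. by move=> b; rewrite -weyl_rootM mulVg weyl_root1. Qed.

Lemma weyl_rootVK w : cancel (weyl_root (w^-1)%g) (weyl_root w : T -> T).
Proof. by move=> b; rewrite -weyl_rootM mulgV weyl_root1. Qed.

Lemma weyl_root_inj (w : W) : injective (weyl_root w).
Proof. exact: can_inj (weyl_rootK w). Qed.

Lemma weyl_reflection_conj (w : W) (b : T) :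
  weyl_reflection (weyl_root w b) = (w * weyl_reflection b * w^-1)%g.
Proof.
apply/(mulIg w); rewrite mulgKV; apply: weylP => l.
by rewrite !weylM !weyl_reflectionE raddfB raddfMz /= (@coroot_weyl w b).
Qed.

Lemma weyl_reflection_sqr (a : T) : (weyl_reflection a * weyl_reflection a)%g = 1%g.
Proof. by apply: weylP => l; rewrite weylM; apply: reflectionK. Qed.

Lemma weyl_reflectionV (a : T) : (weyl_reflection a)^-1%g = weyl_reflection a.
Proof. by rewrite -[LHS]mul1g -(weyl_reflection_sqr a) mulgK. Qed.

Lemma weyl_reflection_neq1 (a : T) : weyl_reflection a != 1%g.
Proof.
apply/eqP => a1; have := weyl_reflection_self a; rewrite a1 => /eqP.
rewrite -addr_eq0 => /eqP aa0; have := root_neq0 a.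
by rewrite (@lattice_torsion_free _ D 2 (val a)) ?eqxx // mulr2n.
Qed.

(** The root - b; writing it as s_b (b) supplies the proof that it is a root. *)
Definition root_opp (b : T) : T := weyl_root (weyl_reflection b) b.

Lemma root_oppE b : val (root_opp b) = - val b.
Proof. exact: weyl_reflection_self. Qed.

Lemma root_oppK : involutive root_opp.
Proof. by move=> b; apply: val_inj; rewrite !root_oppE opprK. Qed.

Lemma weyl_root_opp (w : W) b : weyl_root w (root_opp b) = root_opp (weyl_root w b).
Proof.
apply: val_inj; rewrite root_oppE -[LHS]/(w (val (root_opp b))) root_oppE.
by rewrite raddfN.
Qed.

End InvariantForm.

(** * Positive roots, inversions and parabolic subgroups *)

Section Positivity.
Variables (L : zmodType) (D : root_datum L) (Pi : {set root_type D}).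
Hypothesis hPi : simple_system Pi.
Local Notation W := (weyl D).
Local Notation T := (root_type D).
Local Notation s_ := (@weyl_reflection L D).

Implicit Types (X : {set T}) (w v u : W) (a b : T).

Definition posb (b : T) : bool := `[< nonneg_comb Pi (val b) >].

Definition int_comb (X : {set T}) (l : L) : Prop :=
  exists c : T -> int, l = \sum_(a in X) val a *~ c a.

Lemma int_combB X l m : int_comb X l -> int_comb X m -> int_comb X (l - m).
Proof.
move=> [c ->] [d ->]; exists (fun a => c a - d a).
by rewrite -sumrB; apply: eq_bigr => a _; rewrite mulrzBr.
Qed.

Lemma int_comb0 X : int_comb X 0.
Proof. by exists (fun=> 0); rewrite big1 // => a _; rewrite mulr0z. Qed.

Lemma int_combN X l : int_comb X l -> int_comb X (- l).
Proof. by move=> hl; rewrite -sub0r; apply: int_combB (int_comb0 X) hl. Qed.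

Lemma int_combD X l m : int_comb X l -> int_comb X m -> int_comb X (l + m).
Proof. by move=> hl hm; rewrite -[m]opprK; apply: int_combB hl (int_combN hm). Qed.

Lemma int_combMz (X : {set T}) a n : a \in X -> int_comb X (val a *~ n).
Proof.
move=> aX; exists (fun b => if b == a then n else 0).
rewrite (bigD1 a) //= eqxx big1 ?addr0 // => b /andP[_ /negPf->].
by rewrite mulr0z.
Qed.

Lemma nonneg_comb_int X l : nonneg_comb X l -> int_comb X l.
Proof.
by move=> [c ->]; exists (fun a => Posz (c a)); apply: eq_bigr => a _; rewrite pmulrn.
Qed.

Lemma nonneg_combD X l m : nonneg_comb X l -> nonneg_comb X m -> nonneg_comb X (l + m).
Proof.
move=> [c ->] [d ->]; exists (fun a => (c a + d a)%N).
by rewrite -big_split; apply: eq_bigr => a _; rewrite mulrnDr.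
Qed.

Lemma nonneg_comb0 X : nonneg_comb X 0.
Proof. by exists (fun=> 0%N); rewrite big1. Qed.

Lemma nonneg_combMn X l n : nonneg_comb X l -> nonneg_comb X (l *+ n).
Proof.
move=> hl; elim: n => [|n IH]; first exact: nonneg_comb0.
by rewrite mulrS; apply: nonneg_combD.
Qed.

Lemma nonneg_comb_self (X : {set T}) a : a \in X -> nonneg_comb X (val a).
Proof.
move=> aX; exists (fun b => (b == a : nat)).
rewrite (bigD1 a) //= eqxx big1 ?addr0 // => b /andP[_ /negPf->].
by rewrite mulr0n.
Qed.

Lemma nonneg_combS (X Y : {set T}) l : X \subset Y -> nonneg_comb X l -> nonneg_comb Y l.
Proof.
move=> /subsetP XY [c ->]; apply: (big_ind (nonneg_comb Y)).
- exact: nonneg_comb0.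
- exact: nonneg_combD.
- by move=> a /XY aY; apply/nonneg_combMn/nonneg_comb_self.
Qed.

Lemma int_comb_uniq (c d : T -> int) :
  \sum_(a in Pi) val a *~ c a = \sum_(a in Pi) val a *~ d a ->
  forall a, a \in Pi -> c a = d a.
Proof.
move=> /eqP; rewrite -subr_eq0 -sumrB => /eqP E a aPi; apply/eqP.
rewrite -subr_eq0; apply/eqP; apply: hPi.1 (fun a => c a - d a) _ a aPi.
by rewrite -[RHS]E; apply: eq_bigr => b _; rewrite mulrzBr.
Qed.

Lemma nonneg_combN l : nonneg_comb Pi l -> nonneg_comb Pi (- l) -> l = 0.
Proof.
move=> [c lE] [d]; rewrite lE => E.
rewrite big1 // => a aPi; suff -> : c a = 0%N by rewrite mulr0n.
have := @int_comb_uniq (fun a => - (Posz (c a))) (fun a => Posz (d a)) _ a aPi.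
have -> : \sum_(b in Pi) val b *~ - (Posz (c b)) = - \sum_(b in Pi) val b *+ c b.
  by rewrite -sumrN; apply: eq_bigr => b _; rewrite mulrNz pmulrn.
rewrite E => /(_ (eq_bigr _ (fun b _ => pmulrn _ _))).
by case: (c a) => [|n] //; case: (d a).
Qed.

Lemma posbN b : posb (root_opp b) = ~~ posb b.
Proof.
apply/idP/idP => [/asboolP|/asboolPn nb].
  rewrite root_oppE => nb; apply/negP => /asboolP /nonneg_combN /(_ nb) b0.
  by have := root_neq0 b; rewrite b0 eqxx.
by apply/asboolP; rewrite root_oppE; case: (hPi.2 b).
Qed.

Lemma posb_simple a : a \in Pi -> posb a.
Proof. by move=> aPi; apply/asboolP/nonneg_comb_self. Qed.

Lemma neg_rootsE b : (b \in neg_roots Pi) = ~~ posb b.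
Proof.
rewrite inE -posbN; apply/asboolP/asboolP; by rewrite root_oppE.
Qed.

(** From 2 = b^\vee (b) = n b^\vee (a) the multiple n divides 2, and n = 2 is excluded as the root
    system is reduced. *)
Lemma reduced_multiple (a b : T) n : val b = val a *+ n -> b = a.
Proof.
move=> E; have := coroot_self b; rewrite E raddfMn /= => E2.
have n2 : (n %| 2)%N.
  have : (2 : int) = coroot b (val a) * n%:Z by rewrite -E2 -mulr_natr natz.
  move=> /(congr1 absz); rewrite abszM => E3.
  by rewrite -[2%N]/(absz 2) E3; apply: dvdn_mull.
have : (n <= 2)%N by apply: dvdn_leq.
case: n E n2 {E2} => [|[|[|n]]] // E _ _.
- by apply: val_inj; rewrite E.
- by have := roots_reduced a; rewrite -E => /negP[]; apply: valP.
Qed.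

(** A positive root other than a has a nonzero coefficient at a second simple root, which s_a does
    not change. Since the coefficients of a root have equal signs, s_a (b) stays positive. *)
Lemma reflection_pos a b : a \in Pi -> posb b -> b != a -> posb (weyl_root (s_ a) b).
Proof.
move=> aPi /asboolP[c bE] ba.
case: (hPi.2 (weyl_root (s_ a) b)) => [|[d dE]]; first by move=> ?; apply/asboolP.
exfalso.
have [e /andP[/andP[ePi ea] ce]] : exists e, (e \in Pi) && (e != a) && (c e != 0)%N.
  apply/existsP; apply: contraNT ba; rewrite negb_exists => /forallP H.
  apply/eqP; apply: (@reduced_multiple a b (c a)).
  rewrite bE (bigD1 a) //= big1 ?addr0 // => e /andP[ePi ea].
  by have := H e; rewrite ePi ea /= negbK => /eqP ->; rewrite mulr0n.
have := @int_comb_uniq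
  (fun e => (Posz (c e)) - (if e == a then coroot a (val b) else 0))
  (fun e => - (Posz (d e))) _ e ePi.
have -> : \sum_(e in Pi) val e *~ (Posz (c e) - (if e == a then coroot a (val b) else 0)) =
    val (weyl_root (s_ a) b).
  rewrite -[RHS]/(val b - val a *~ coroot a (val b)) {2}bE.
  under eq_bigr do rewrite mulrzBr; rewrite sumrB; congr (_ - _).
  rewrite (bigD1 a) //= eqxx big1 ?addr0 // => e' /andP[_ /negPf->].
  by rewrite mulr0z.
have -> : \sum_(e in Pi) val e *~ - (Posz (d e)) = val (weyl_root (s_ a) b).
  rewrite -[RHS]opprK dE -sumrN; apply: eq_bigr => e' _.
  by rewrite mulrNz pmulrn.
move=> /(_ erefl) /eqP; rewrite (negPf ea) subr0.
by case: (c e) ce => // n _; case: (d e).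
Qed.

(* The length of w, by weyl_lengthE. *)
Definition inversions (w : W) : {set T} := [set b | posb b && ~~ posb (weyl_root w b)].
Definition ninv w := #|inversions w|.

Lemma inv_mulr w a : a \in Pi -> posb (weyl_root w a) ->
  inversions (w * s_ a)%g = a |: weyl_root (s_ a) @^-1: inversions w /\
  a \notin weyl_root (s_ a) @^-1: inversions w.
Proof.
move=> aPi wa; have na : ~~ posb (weyl_root (s_ a) a).
  by rewrite -[weyl_root _ a]/(root_opp a) posbN posb_simple.
split; last by rewrite !inE (negPf na).
apply/setP => b; rewrite !inE weyl_rootM.
have [->|ba] := eqVneq b a.
  rewrite posb_simple //= -[weyl_root (s_ a) a]/(root_opp a) weyl_root_opp.
  by rewrite posbN negbK.
rewrite /=; have [pb|nb] := boolP (posb b); first by rewrite reflection_pos.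
have [pb'|//] := boolP (posb (weyl_root (s_ a) b)).
rewrite /=; apply/esym/negbTE; rewrite negbK.
have [E|ne] := eqVneq (weyl_root (s_ a) b) a; first by rewrite E.
have := reflection_pos aPi pb' ne.
by rewrite -weyl_rootM weyl_reflection_sqr weyl_root1 (negPf nb).
Qed.

Lemma ninv_mulr w a : a \in Pi -> posb (weyl_root w a) ->
  ninv (w * s_ a)%g = (ninv w).+1.
Proof.
move=> aPi wa; have [E na] := inv_mulr aPi wa.
rewrite /ninv E cardsU1 na add1n; congr _.+1.
rewrite on_card_preimset //; apply: onW_bij.
by exists (weyl_root (s_ a)^-1%g); [exact: weyl_rootK | exact: weyl_rootVK].
Qed.

Lemma posb_mulr_simple w a : posb (weyl_root (w * s_ a)%g a) = ~~ posb (weyl_root w a).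
Proof.
by rewrite weyl_rootM -[weyl_root (s_ a) a]/(root_opp a) weyl_root_opp posbN.
Qed.

Lemma mulgKs w a : (w * s_ a * s_ a)%g = w.
Proof. by rewrite -mulgA weyl_reflection_sqr mulg1. Qed.

Lemma ninv_mulrN w a : a \in Pi -> ~~ posb (weyl_root w a) ->
  ninv w = (ninv (w * s_ a)%g).+1.
Proof.
by move=> aPi wa; rewrite -(ninv_mulr aPi) ?posb_mulr_simple // mulgKs.
Qed.

Lemma ninvV w : ninv w^-1%g = ninv w.
Proof.
have H v : (ninv v <= ninv v^-1%g)%N.
  (* The map b |-> - v (b) carries the inversions of v injectively to inversions of its inverse. *)
  pose g b := root_opp (weyl_root v b).
  have ginj : injective g by apply: inj_comp (inv_inj _) (@weyl_root_inj _ _ v); exact: root_oppK.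
  rewrite /ninv -(card_imset _ ginj); apply/subset_leq_card/subsetP => c /imsetP[b + ->].
  rewrite !inE => /andP[pb nb]; rewrite /g posbN nb /= weyl_root_opp weyl_rootK.
  by rewrite posbN negbK.
have := H w^-1%g; rewrite invgK => le1; apply/eqP.
by rewrite eqn_leq le1 H.
Qed.

Lemma ninv1 : ninv 1%g = 0%N.
Proof.
apply/eqP; rewrite cards_eq0; apply/eqP/setP => b; rewrite !inE weyl_root1.
by rewrite andbN.
Qed.

Local Notation word := (@weyl_word L D).
Implicit Types (s t : seq T).

Lemma word_cons a s : word (a :: s) = (s_ a * word s)%g.
Proof. by rewrite /weyl_word big_cons. Qed.

Lemma word_cat s t : word (s ++ t) = (word s * word t)%g.
Proof. by rewrite /weyl_word big_cat. Qed.

Lemma word_nil : word [::] = 1%g. Proof. by rewrite /weyl_word big_nil. Qed.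

Lemma word_rcons s a : word (rcons s a) = (word s * s_ a)%g.
Proof. by rewrite -cats1 word_cat word_cons word_nil mulg1. Qed.

Lemma ninv_word s : all (mem Pi) s -> (ninv (word s) <= size s)%N.
Proof.
elim/last_ind: s => [|s a IH]; first by rewrite word_nil ninv1.
rewrite all_rcons word_rcons size_rcons => /andP[aPi /IH le].
have [wa|wa] := boolP (posb (weyl_root (word s) a)); first by rewrite ninv_mulr.
by apply: leqW; apply: ltnW; rewrite -ninv_mulrN.
Qed.

(** Read from the right, the letters of s turn the positive root a into a negative one. The letter c
    at which this happens can be erased: s_c makes no other positive root negative, so the letters
    to its right conjugate s_a to s_c. *)
Lemma exchange s a : all (mem Pi) s -> a \in Pi -> ~~ posb (weyl_root (word s) a) ->
  exists s1 c s2, s = s1 ++ c :: s2 /\ (word s * s_ a)%g = word (s1 ++ s2).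
Proof.
elim: s => [|c s IH] /=; first by rewrite word_nil weyl_root1 => _ /posb_simple ->.
move=> /andP[cPi sPi] aPi; rewrite word_cons weyl_rootM => nca.
have [pa|na] := boolP (posb (weyl_root (word s) a)); last first.
  have [s1 [d [s2 [-> E]]]] := IH sPi aPi na.
  by exists (c :: s1), d, s2; rewrite -mulgA E -word_cons.
exists [::], c, s; split=> //=.
have E : weyl_root (word s) a = c by apply: contraNeq nca; apply: reflection_pos.
have := weyl_reflection_conj (word s) a; rewrite E => ->.
by rewrite mulgKV mulgKs.
Qed.

Section Parabolic.
Variable X : {set T}.
Hypothesis hX : X \subset Pi.
Local Notation WX := (parabolic X).

Lemma all_subset s : all (mem X) s -> all (mem Pi) s.
Proof. by apply: sub_all => a; apply: (subsetP hX). Qed.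

Lemma word_parabolic s : all (mem X) s -> word s \in WX.
Proof.
elim: s => [|a s IH] /=; first by rewrite word_nil group1.
case/andP=> aX /IH ws; rewrite word_cons groupM //.
by apply: mem_gen; apply: imset_f.
Qed.

Lemma parabolic_word u : u \in WX -> exists2 s, all (mem X) s & word s = u.
Proof.
move=> /gen_prodgP[n [c cX ->]].
elim: n c cX => [|n IH] c cX; first by exists [::]; rewrite ?big_ord0 ?word_nil.
have [s sX sE] := IH (fun i => c (lift ord0 i)) (fun i => cX _).
have /imsetP[a aX ca] := cX ord0.
by exists (a :: s); rewrite /= ?aX // big_ord_recl word_cons sE ca.
Qed.

Lemma pos_word1 s : all (mem X) s ->
  (forall a, a \in X -> posb (weyl_root (word s) a)) -> word s = 1%g.
Proof.
elim: {s}(size s) {-2}s (leqnn (size s)) => [|n IH] s.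
  by rewrite leqn0 => /nilP ->; rewrite word_nil.
elim/last_ind: s => [|s a _]; first by rewrite word_nil.
rewrite size_rcons ltnS all_rcons => le /andP[aX sX] ps.
have na : ~~ posb (weyl_root (word s) a).
  by have := ps a aX; rewrite word_rcons posb_mulr_simple.
have [s1 [c [s2 [sE wE]]]] := exchange (all_subset sX) (subsetP hX _ aX) na.
move: ps; rewrite word_rcons wE; apply: IH.
  by apply: leq_trans le; rewrite sE !size_cat /= leq_add2l.
by move: sX; rewrite sE !all_cat /= => /and3P[-> _ ->].
Qed.

Lemma pos_parabolic1 u : u \in WX -> (forall a, a \in X -> posb (weyl_root u a)) -> u = 1%g.
Proof. by move=> /parabolic_word[s sX <-]; apply: pos_word1. Qed.

Lemma mem_refl a : a \in X -> s_ a \in WX.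
Proof. by move=> aX; apply: mem_gen; apply: imset_f. Qed.

Lemma exists_neg u : u \in WX -> u != 1%g -> exists2 a, a \in X & ~~ posb (weyl_root u a).
Proof.
move=> uX u1; apply/exists_inP; apply: contraNT u1.
rewrite negb_exists_in => /forall_inP H; apply/eqP; apply: pos_parabolic1 => // a aX.
by have := H a aX; rewrite negbK.
Qed.

Lemma parabolic_reduced_word u : u \in WX ->
  exists2 s, all (mem X) s & word s = u /\ size s = ninv u.
Proof.
elim: {u}(ninv u) {-2}u (erefl (ninv u)) => [|n IH] u uE uX.
  have [->|u1] := eqVneq u 1%g; first by exists [::]; rewrite ?word_nil ?ninv1.
  by have [a aX na] := exists_neg uX u1; have := ninv_mulrN (subsetP hX _ aX) na; rewrite uE.
have u1 : u != 1%g by apply/eqP => u1; rewrite u1 ninv1 in uE.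
have [a aX na] := exists_neg uX u1.
have nE := ninv_mulrN (subsetP hX _ aX) na; rewrite uE in nE; case: nE => nE.
have [//||s sX [sE ss]] := IH (u * s_ a)%g; first by rewrite groupM ?mem_refl.
exists (rcons s a); first by rewrite all_rcons /= aX.
by rewrite word_rcons sE mulgKs size_rcons ss -nE.
Qed.

Lemma int_comb_act u l : u \in WX -> int_comb X (u l - l).
Proof.
move=> /parabolic_word[s sX <-]; elim: s sX => [|a s IH] /=.
  by move=> _; rewrite word_nil subrr; apply: int_comb0.
move=> /andP[aX /IH hs]; rewrite word_cons weylM weyl_reflectionE.
rewrite addrAC; apply: int_combB => //; exact: int_combMz.
Qed.

Lemma pos_int_comb b : posb b -> int_comb X (val b) -> nonneg_comb X (val b).
Proof.
move=> /asboolP[c bE] [d bE']; exists c.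
pose d' a := if a \in X then d a else 0.
have dE : \sum_(a in Pi) val a *~ Posz (c a) = \sum_(a in Pi) val a *~ d' a.
  transitivity (val b); first by rewrite bE; apply: eq_bigr => a _; rewrite pmulrn.
  rewrite bE' [RHS](big_setID X) /= (setIidPr hX) [X in _ = _ + X]big1 ?addr0 => [|a].
    by apply: eq_bigr => a aX; rewrite /d' aX.
  by rewrite inE /d' => /andP[/negPf-> _]; rewrite mulr0z.
rewrite bE (big_setID X) /= (setIidPr hX) [X in _ + X]big1 ?addr0 // => a.
rewrite inE => /andP[/negPf aX aPi]; have := int_comb_uniq dE aPi.
by rewrite /d' aX => [[->]].
Qed.

(** Longest elements and minimal representatives are described by the signs of the roots w (a), a in
    X; what this means for lengths is [ninv_longest] and [ninv_min_rep]. *)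
Definition longest w := w \in WX /\ forall a, a \in X -> ~~ posb (weyl_root w a).

Definition min_rep v := forall a, a \in X -> posb (weyl_root v a).

Lemma nonneg_comb_sum_pos (w : W) l :
  (forall a, a \in X -> posb (weyl_root w a)) -> nonneg_comb X l -> nonneg_comb Pi (w l).
Proof.
move=> pw [c ->]; rewrite raddf_sum; apply: (big_ind (nonneg_comb Pi)).
- exact: nonneg_comb0.
- exact: nonneg_combD.
- move=> a aX; rewrite raddfMn; apply: nonneg_combMn.
  by have /asboolP := pw a aX.
Qed.

Lemma min_rep_pos v b : min_rep v -> nonneg_comb X (val b) -> posb (weyl_root v b).
Proof. by move=> vX bX; apply/asboolP; apply: nonneg_comb_sum_pos. Qed.

Lemma longest_neg w b : longest w -> nonneg_comb X (val b) -> ~~ posb (weyl_root w b).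
Proof.
move=> [wX nw] [c bE]; rewrite -posbN -weyl_root_opp; apply/asboolP.
rewrite -[val _]/(w (val (root_opp b))) root_oppE bE raddfN raddf_sum -sumrN.
apply: (big_ind (nonneg_comb Pi)).
- exact: nonneg_comb0.
- exact: nonneg_combD.
- move=> a aX; rewrite raddfMn -mulNrn; apply: nonneg_combMn.
  by have := nw a aX; rewrite -posbN => /asboolP; rewrite root_oppE.
Qed.

Lemma parabolic_simple_comb u a : u \in WX -> a \in X -> posb (weyl_root u a) ->
  nonneg_comb X (val (weyl_root u a)).
Proof.
move=> uX aX pa; apply: pos_int_comb => //.
rewrite -[val _]/(u (val a)) -[u _](subrK (val a)); apply: int_combD.
  exact: int_comb_act.
exact/nonneg_comb_int/nonneg_comb_self.
Qed.

Lemma min_rep_mul_pos v u a : min_rep v -> u \in WX -> a \in X ->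
  posb (weyl_root (v * u)%g a) = posb (weyl_root u a).
Proof.
move=> vX uX aX; rewrite weyl_rootM.
have [pa|na] := boolP (posb (weyl_root u a)).
  exact/min_rep_pos/parabolic_simple_comb.
apply/negbTE; rewrite -posbN -weyl_root_opp; apply: min_rep_pos => //.
rewrite -weyl_root_opp -[root_opp a]/(weyl_root (s_ a) a) -weyl_rootM.
apply: parabolic_simple_comb => //; first by rewrite groupM ?mem_refl.
by rewrite posb_mulr_simple.
Qed.

Lemma ninv_min_rep v u : min_rep v -> u \in WX -> ninv (v * u)%g = (ninv v + ninv u)%N.
Proof.
move=> vX uX; elim: {u}(ninv u) {-2}u (erefl (ninv u)) uX => [|n IH] u uE uX.
  suff -> : u = 1%g by rewrite mulg1 ninv1 addn0.
  apply: pos_parabolic1 => // a aX; apply: contraTT isT => na.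
  by have := ninv_mulrN (subsetP hX _ aX) na; rewrite uE.
have u1 : u != 1%g by apply/eqP => u1; rewrite u1 ninv1 in uE.
have [a aX na] := exists_neg uX u1; have aPi := subsetP hX _ aX.
have nE := ninv_mulrN aPi na; rewrite uE in nE; case: nE => nE.
rewrite (@ninv_mulrN (v * u)%g a) ?min_rep_mul_pos //.
by rewrite -mulgA IH ?groupM ?mem_refl // uE -nE addnS.
Qed.

Lemma ninv_longest w u : longest w -> u \in WX -> (ninv (w * u)%g + ninv u)%N = ninv w.
Proof.
move=> lw uX; elim: {u}(ninv u) {-2}u (erefl (ninv u)) uX => [|n IH] u uE uX.
  suff -> : u = 1%g by rewrite mulg1 ninv1 addn0.
  apply: pos_parabolic1 => // a aX; apply: contraTT isT => na.
  by have := ninv_mulrN (subsetP hX _ aX) na; rewrite uE.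
have u1 : u != 1%g by apply/eqP => u1; rewrite u1 ninv1 in uE.
have [a aX na] := exists_neg uX u1; have aPi := subsetP hX _ aX.
have nE := ninv_mulrN aPi na; rewrite uE in nE; case: nE => nE.
have uaX : (u * s_ a)%g \in WX by rewrite groupM ?mem_refl.
rewrite -(IH _ (esym nE) uaX) -nE uE addnS -addSn; congr (_ + _)%N.
rewrite (@ninv_mulrN (w * (u * s_ a))%g a) //; first by rewrite mulgA mulgKs.
rewrite weyl_rootM; apply: longest_neg => //; apply: parabolic_simple_comb => //.
by rewrite posb_mulr_simple.
Qed.

Lemma longest_exists : exists w, longest w.
Proof.
have [w wX wmax] := arg_maxnP (fun w => ninv w) (group1 WX : 1%g \in WX).
exists w; split=> // a aX; apply/negP => pa.
have : (ninv (w * s_ a)%g <= ninv w)%N by apply: wmax; apply: groupM => //; apply: mem_refl.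
by rewrite ninv_mulr ?ltnn //; apply: (subsetP hX).
Qed.

Lemma ninv_le_longest w u : longest w -> u \in WX -> (ninv u <= ninv w)%N.
Proof. by move=> lw uX; rewrite -(ninv_longest lw uX) leq_addl. Qed.

Lemma longest_uniq w u : longest w -> u \in WX -> ninv u = ninv w -> u = w.
Proof.
move=> lw uX E; have := ninv_longest lw uX; rewrite E => /eqP.
rewrite -{2}[ninv w]add0n eqn_add2r => /eqP wu0.
have wX := lw.1.
have wu1 : (w * u)%g = 1%g.
  apply: pos_parabolic1 => [|a aX]; first by rewrite groupM.
  apply: contraTT isT => na.
  by have := ninv_mulrN (subsetP hX _ aX) na; rewrite wu0.
have ww1 : (w * w)%g = 1%g.
  apply: pos_parabolic1 => [|a aX]; first by rewrite groupM.
  apply: contraTT isT => na.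
  have := ninv_longest lw wX; rewrite -{2}[ninv w]add0n => /eqP.
  rewrite eqn_add2r => /eqP E'.
  by have := ninv_mulrN (subsetP hX _ aX) na; rewrite E'.
by apply: (mulgI w); rewrite wu1 ww1.
Qed.

Lemma longest_invg w : longest w -> (w^-1)%g = w.
Proof. by move=> lw; apply: (longest_uniq lw); rewrite ?groupV ?ninvV //; case: lw. Qed.

Lemma ninv_longestV w u : longest w -> u \in WX -> (ninv (u^-1 * w)%g + ninv u)%N = ninv w.
Proof.
move=> lw uX; rewrite -(ninvV (u^-1 * w)%g) invMg invgK longest_invg //.
exact: ninv_longest.
Qed.

Lemma min_rep_exists w : exists v u, [/\ min_rep v, u \in WX & w = (v * u)%g].
Proof.
have [u uX umin] := arg_minnP (fun u => ninv (w * u)%g) (group1 WX : 1%g \in WX).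
exists (w * u)%g, u^-1%g; split; rewrite ?groupV ?mulgK // => a aX.
apply: contraTT isT => na.
have : (ninv (w * u)%g <= ninv (w * (u * s_ a))%g)%N.
  by apply: umin; apply: groupM => //; apply: mem_refl.
by rewrite mulgA (ninv_mulrN (subsetP hX _ aX) na) ltnn.
Qed.

Lemma min_rep_uniq v v' u : min_rep v -> min_rep v' -> u \in WX -> v' = (v * u)%g -> u = 1%g.
Proof.
move=> mv mv' uX E; apply: pos_parabolic1 => // a aX.
by rewrite -(min_rep_mul_pos mv) // -E; apply: mv'.
Qed.

Lemma inv_parabolic w b : w \in WX -> b \in inversions w -> s_ b \in WX.
Proof.
move=> /parabolic_reduced_word[s sX [<- ss]]; elim/last_ind: s sX ss b => [|s a IH].
  by move=> _ _ b; rewrite inE word_nil weyl_root1 andbN.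
rewrite all_rcons word_rcons size_rcons => /andP[aX sX] ss b.
have aPi := subsetP hX _ aX.
have [pa|na] := boolP (posb (weyl_root (word s) a)); last first.
  have := ninv_mulrN aPi na; have := ninv_word (all_subset sX); rewrite -ss => le E.
  by move: le; rewrite E ltnNge leqnSn.
have [-> _] := inv_mulr aPi pa; rewrite !inE => /orP[/eqP->|]; first exact: mem_refl.
have ss' : size s = ninv (word s) by have := ninv_mulr aPi pa; rewrite -ss => [[]].
move=> /andP[pb nb]; have := IH sX ss' (weyl_root (s_ a) b).
rewrite inE pb nb => /(_ isT); rewrite weyl_reflection_conj.
move=> H; have aW := mem_refl aX.
by rewrite -(groupMl _ aW) -(groupMr _ (groupVr aW)).
Qed.

(** The difference s_b (b) - b = - 2 b is an integral combination of X, so the coefficients of b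
    outside X vanish. *)
Lemma reflection_int_comb b : s_ b \in WX -> int_comb X (val b).
Proof.
move=> bX; have [c cE] := int_comb_act (val b) bX.
move: cE; rewrite weyl_reflection_self => E.
have pE p : posb p -> int_comb X (- val p *+ 2) -> int_comb X (val p).
  move=> /asboolP[n nE] [d dE]; exists (fun a => Posz (n a)).
  pose d' a := if a \in X then d a else 0.
  have E2 : \sum_(a in Pi) val a *~ (- Posz (n a) * 2) = \sum_(a in Pi) val a *~ d' a.
    transitivity (- val p *+ 2).
      rewrite nE -sumrN -sumrMnl; apply: eq_bigr => a _.
      by rewrite mulrzA mulrNz pmulrn.
    rewrite dE [RHS](big_setID X) /= (setIidPr hX) [X in _ = _ + X]big1 ?addr0 => [|a].
      by apply: eq_bigr => a aX; rewrite /d' aX.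
    by rewrite inE /d' => /andP[/negPf-> _]; rewrite mulr0z.
  rewrite {1}nE (big_setID X) /= (setIidPr hX) [X in _ + X]big1 ?addr0 => [|a].
    by apply: eq_bigr => a _; rewrite pmulrn.
  rewrite inE => /andP[/negPf aX aPi]; have := int_comb_uniq E2 aPi.
  by rewrite /d' aX; case: (n a).
have b2 : int_comb X (- val b *+ 2).
  by exists c; rewrite -E mulr2n.
have [pb|nb] := boolP (posb b); first exact: pE.
rewrite -[val b]opprK -root_oppE; apply: int_combN; apply: pE.
  by rewrite posbN.
by rewrite root_oppE opprK -[val b]opprK mulNrn; apply: int_combN.
Qed.

Lemma inv_longest w : longest w -> inversions w = [set b | posb b & s_ b \in WX].
Proof.
move=> lw; apply/setP => b; rewrite [RHS]inE; apply/idP/andP => [bi|[pb bX]].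
  split; last exact: inv_parabolic lw.1 bi.
  by move: bi; rewrite inE => /andP[].
rewrite inE pb; apply: longest_neg => //; apply: pos_int_comb => //.
exact: reflection_int_comb.
Qed.

End Parabolic.

(** The inversions of the inverse of a reduced product s_1 s_2 s_3 ... are a_1, s_1 (a_2), s_1 s_2
    (a_3), ...: the roots whose x occur as denominators in an iterated operator. *)
Lemma prod_inv_word (A : comPzRingType) (g : T -> A) (c : T) s (w : W) :
  c \in Pi -> ninv (s_ c * word s)%g = (ninv (word s)).+1 ->
  \prod_(b in inversions (word (c :: s))^-1%g) g (weyl_root w b) =
  g (weyl_root w c) * \prod_(b in inversions (word s)^-1%g) g (weyl_root (w * s_ c)%g b).
Proof.
move=> cPi nE; set u := word s in nE *.
have s_V := weyl_reflectionV c.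
have pc : posb (weyl_root u^-1%g c).
  apply: contraTT isT => nc; have := ninv_mulrN cPi nc.
  have -> : (u^-1 * s_ c)%g = (s_ c * u)^-1%g by rewrite invMg s_V.
  by rewrite !ninvV nE => /eqP; rewrite ltn_eqF // leqW.
have [E nc] := inv_mulr cPi pc.
rewrite word_cons -/u invMg s_V E big_setU1 //=; congr (_ * _).
rewrite (reindex_inj (@weyl_root_inj _ _ (s_ c))); apply: eq_big => b.
  by rewrite inE -weyl_rootM weyl_reflection_sqr weyl_root1.
by rewrite -weyl_rootM.
Qed.

(** Otherwise (b, b), a nonnegative combination of the (a, b), would not be positive. *)
Lemma exists_pos_coroot X b : nonneg_comb X (val b) ->
  exists2 a, a \in X & 0 < coroot a (val b).
Proof.
move=> [c bE]; apply/exists_inP; apply: contraT; rewrite negb_exists_in => /forall_inP H.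
have := wform_gt0 D (root_neq0 b); rewrite {2}bE raddf_sum /= ltNge sumr_le0 // => a aX.
rewrite raddfMn; apply: mulrn_wle0.
have := H a aX; rewrite -leNgt => le0; rewrite /= wformC.
rewrite -(pmulr_rle0 _ (_ : 0 < 2)) // -coroot_wform.
by rewrite mulr_le0_ge0 // ltW // wform_gt0 // root_neq0.
Qed.

(** Induction on the height: a reflection s_a with a^\vee (b) > 0 lowers the coefficient of a and
    changes no other. *)
Lemma root_conj_simple X b : X \subset Pi -> nonneg_comb X (val b) ->
  exists u a, [/\ u \in parabolic X, a \in X & b = weyl_root u a].
Proof.
move=> hX [c bE].
elim: {c}(\sum_(a in X) c a)%N {-2}c (leqnn (\sum_(a in X) c a)%N) b bE => [|n IH] c le b bE.
  have := root_neq0 b; rewrite bE big1 ?eqxx // => a aX.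
  by move: le; rewrite leqn0 sum_nat_eq0 => /forall_inP/(_ a aX)/eqP ->.
have bX : nonneg_comb X (val b) by exists c.
have [a aX ca] := exists_pos_coroot bX.
have [->|ba] := eqVneq b a.
  by exists 1%g, a; rewrite group1 weyl_root1.
have aPi := subsetP hX _ aX.
have pb : posb b by apply/asboolP; apply: nonneg_combS bX.
have /(pos_int_comb hX)[|d dE] := reflection_pos aPi pb ba.
  rewrite -[val _]/(val b - val a *~ coroot a (val b)).
  by apply: int_combB; [apply: nonneg_comb_int | apply: int_combMz].
have [|u [a' [uX a'X E]]] := IH d _ (weyl_root (s_ a) b) dE.
  have E : \sum_(e in Pi) val e *~
      (if e \in X then Posz (c e) - (if e == a then coroot a (val b) else 0) else 0) =
     \sum_(e in Pi) val e *~ (if e \in X then Posz (d e) else 0).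
    have sumX (f : T -> int) : \sum_(e in Pi) val e *~ (if e \in X then f e else 0) =
        \sum_(e in X) val e *~ f e.
      rewrite (big_setID X) /= (setIidPr hX) [X in _ + X]big1 ?addr0 => [|e].
        by apply: eq_bigr => e ->.
      by rewrite inE => /andP[/negPf-> _]; rewrite mulr0z.
    rewrite !sumX; transitivity (val (weyl_root (s_ a) b)); last first.
      by rewrite dE; apply: eq_bigr => e _; rewrite pmulrn.
    rewrite -[RHS]/(val b - val a *~ coroot a (val b)) {2}bE.
    under eq_bigr do rewrite mulrzBr; rewrite sumrB; congr (_ - _).
    rewrite (bigD1 a) //= eqxx big1 ?addr0 // => e /andP[_ /negPf->].
    by rewrite mulr0z.
  have dle e : e \in X -> (d e <= c e)%N.
    move=> eX; have := int_comb_uniq E (subsetP hX _ eX); rewrite eX.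
    case: eqP => _ H; rewrite -lez_nat -H ?subr0 //.
    by rewrite gerBl ltW.
  have da : (d a < c a)%N.
    have := int_comb_uniq E aPi; rewrite aX eqxx => H.
    by rewrite -ltz_nat -H gtrBl.
  rewrite -ltnS; apply: leq_trans le.
  rewrite (bigD1 a) //= [X in (_ < X)%N](bigD1 a) //= -addSn leq_add //.
  by apply: leq_sum => e /andP[/dle].
exists (s_ a * u)%g, a'; split=> //; first by rewrite groupM ?mem_refl.
by rewrite weyl_rootM -E -weyl_rootM weyl_reflection_sqr weyl_root1.
Qed.

Lemma pos_reflection_parabolic X b : X \subset Pi -> nonneg_comb X (val b) ->
  s_ b \in parabolic X.
Proof.
move=> hX /(root_conj_simple hX)[u [a [uX aX ->]]].
by rewrite weyl_reflection_conj !groupM ?groupV // mem_refl.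
Qed.

Lemma reflection_opp b : s_ (root_opp b) = s_ b.
Proof. by rewrite weyl_reflection_conj mulgK. Qed.

(** The Weyl group is given by the reflections in all roots. Up to sign each root is conjugate to a
    simple one under products of simple reflections, so these generate. *)
Lemma parabolicT w : w \in parabolic Pi.
Proof.
have refl b : s_ b \in parabolic Pi.
  have [pb|] := boolP (posb b).
    by apply: pos_reflection_parabolic => //; apply/asboolP.
  rewrite -posbN => pb; rewrite -reflection_opp.
  by apply: pos_reflection_parabolic => //; apply/asboolP.
case: w => f [s fE].
have -> : Weyl (ex_intro _ s fE) = word s.
  apply: weylP => l /=; rewrite fE; elim: s {fE} => [|a s IH]; first by rewrite word_nil.
  by rewrite word_cons weylM -IH.
by apply: group_prod => a _; apply: refl.
Qed.

Lemma has_word_ninv w : has_word Pi w (ninv w).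
Proof.
have [s sPi [sE ss]] := parabolic_reduced_word (subxx Pi) (parabolicT w).
have st : size s == ninv w by apply/eqP.
by apply/existsP; exists (Tuple st); rewrite /= sPi sE eqxx.
Qed.

Lemma weyl_lengthE w : weyl_length Pi w = ninv w.
Proof.
rewrite /weyl_length; case: pselect => [h|[]]; last by exists (ninv w); apply: has_word_ninv.
case: ex_minnP => n /existsP[s /andP[sPi /eqP sE]] nmin.
apply/eqP; rewrite eqn_leq nmin ?has_word_ninv //=.
by rewrite -sE -{2}(size_tuple s) ninv_word.
Qed.

Lemma reduced_wordP w s : reduced_word Pi w s <->
  [/\ all (mem Pi) s, word s = w & size s = ninv w].
Proof. by rewrite /reduced_word weyl_lengthE. Qed.

Lemma min_repsP X w : X \subset Pi -> reflect (min_rep X w) (w \in min_reps Pi X).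
Proof.
move=> hX; rewrite inE; apply: (iffP forall_inP) => H a aX; have aPi := subsetP hX _ aX.
  have := H a aX; rewrite !weyl_lengthE => lt; apply: contraTT isT => na.
  by move: lt; rewrite (ninv_mulrN aPi na) ltnNge leqnSn.
by rewrite !weyl_lengthE (ninv_mulr aPi (H a aX)).
Qed.

Lemma sub_neg_rootsP X b : b \in sub_neg_roots Pi X = ~~ posb b && (s_ b \in parabolic X).
Proof. by rewrite inE neg_rootsE. Qed.

Lemma sub_neg_roots_mul X a b : X \subset Pi -> a \in X ->
  (weyl_root (s_ a) b \in sub_neg_roots Pi X :\ root_opp a) = (b \in sub_neg_roots Pi X :\ root_opp a).
Proof.
move=> hX aX; have aPi := subsetP hX _ aX; have aW := mem_refl aX.
have imp c : c \in sub_neg_roots Pi X :\ root_opp a ->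
    weyl_root (s_ a) c \in sub_neg_roots Pi X :\ root_opp a.
  rewrite !in_setD1 !sub_neg_rootsP => /andP[ca /andP[nc cX]].
  have pc : posb (weyl_root (s_ a) (root_opp c)).
    apply: reflection_pos => //; first by rewrite posbN.
    by apply: contra ca => /eqP <-; rewrite root_oppK.
  rewrite weyl_reflection_conj !groupM ?groupV // andbT.
  rewrite -posbN -weyl_root_opp pc andbT.
  apply/eqP => E; have : weyl_root (s_ a) c = weyl_root (s_ a) a by [].
  by move=> /weyl_root_inj ca'; move: nc; rewrite ca' posb_simple.
apply/idP/idP => [/imp|]; last exact: imp.
by rewrite -weyl_rootM weyl_reflection_sqr weyl_root1.
Qed.

Lemma mem_sub_neg_opp X a : X \subset Pi -> a \in X -> root_opp a \in sub_neg_roots Pi X.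
Proof.
move=> hX aX; rewrite sub_neg_rootsP posbN posb_simple ?(subsetP hX) //=.
by rewrite reflection_opp mem_refl.
Qed.

(* The quotient rule w s_a (x_X) / w (x_X) = x_{w a} / x_{- w a}. *)
Lemma prod_sub_neg_mulr (A : comPzRingType) (g : T -> A) X a w : X \subset Pi -> a \in X ->
  (\prod_(b in sub_neg_roots Pi X) g (weyl_root (w * s_ a)%g b)) * g (weyl_root w (root_opp a)) =
  (\prod_(b in sub_neg_roots Pi X) g (weyl_root w b)) * g (weyl_root w a).
Proof.
move=> hX aX; have oa := mem_sub_neg_opp hX aX.
rewrite (big_setD1 _ oa) [in RHS](big_setD1 _ oa) /=.
have -> : weyl_root (w * s_ a)%g (root_opp a) = weyl_root w a.
  by rewrite weyl_rootM weyl_root_opp root_oppK.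
rewrite (reindex_inj (@weyl_root_inj _ _ (s_ a))) /=.
under eq_bigl do rewrite sub_neg_roots_mul //.
under eq_bigr do rewrite -weyl_rootM mulgKs.
by rewrite mulrC mulrCA mulrA [RHS]mulrC mulrA.
Qed.

Lemma sub_neg_roots0 : sub_neg_roots Pi set0 = set0.
Proof.
apply/setP => b; rewrite sub_neg_rootsP in_set0; apply/negbTE; rewrite negb_and negbK.
apply/orP; right; rewrite /parabolic /= imset0 gen0 inE.
exact: weyl_reflection_neq1.
Qed.

Lemma sub_neg_rootsT : sub_neg_roots Pi Pi = neg_roots Pi.
Proof. by apply/setP => b; rewrite sub_neg_rootsP parabolicT andbT neg_rootsE. Qed.

Lemma parabolicS X (Y : {set T}) : X \subset Y -> parabolic X \subset parabolic Y.
Proof. by move=> XY; apply/genS/imsetS. Qed.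

Lemma sub_neg_rootsS X (Y : {set T}) : X \subset Y -> sub_neg_roots Pi X \subset sub_neg_roots Pi Y.
Proof.
move=> XY; apply/subsetP => b; rewrite !sub_neg_rootsP => /andP[-> bX].
exact: (subsetP (parabolicS XY)).
Qed.

End Positivity.

Lemma cmonom_ind_var (I : choiceType) (P : {cmonom I} -> Prop) :
  P mone -> (forall i m, P m -> P (mmul (ucm i) m)) -> forall m, P m.
Proof.
move=> P1 PM m; elim: {m}(mdeg m) {-2}m (erefl (mdeg m)) => [|n IH] m mE.
  by rewrite (mdeg_eq0I mE).
have [i im] : exists i, i \in finsupp m.
  case: (fset_0Vmem (finsupp m)) => [m0|[i im]]; last by exists i.
  by move: mE; rewrite mdegE m0 big_seq_fset0.
have m'E : m = mmul (ucm i) (divcm m (ucm i)).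
  apply/eqP/cmP => j; rewrite cmM divcmE cmU.
  case: (i =P j) => [<-|_]; last by rewrite subn0.
  by rewrite /= subnKC // lt0n cmE_neq0.
rewrite m'E; apply: PM; apply: IH.
by move: mE; rewrite {1}m'E mdegM mdegU => [[]].
Qed.

(** * Compatibility with composition *)

Section Functoriality.
Variables (R : comNzRingType).

Lemma rename_mpoly_ucm (I J : choiceType) (g : I -> J) i :
  rename_mpoly g (<< ucm i >> : {malg R[{cmonom I}]}) = << ucm (g i) >>.
Proof.
rewrite /rename_mpoly mmapU /= mpolyC1E mul1r.
by rewrite /rename_term /rename_monom mdomU big_seq_fset1 cmUU /= mulm1.
Qed.

Lemma rename_mpolyC (I J : choiceType) (g : I -> J) (c : R) :
  rename_mpoly g (c%:MP : {malg R[{cmonom I}]}) = c%:MP.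
Proof. exact: mmapC. Qed.

Lemma malgUM (I : choiceType) (m n : {cmonom I}) :
  << mmul m n >> = << m >> * << n >> :> {malg R[{cmonom I}]}.
Proof. by rewrite malgM_def fgmulUU mulr1. Qed.

Lemma rename_mpoly_comp (I J K : choiceType) (g : J -> K) (h : I -> J)
    (p : {malg R[{cmonom I}]}) :
  rename_mpoly g (rename_mpoly h p) = rename_mpoly (g \o h) p.
Proof.
have mE (m : {cmonom I}) : rename_mpoly g (rename_mpoly h (<< m >> : {malg R[{cmonom I}]})) =
    rename_mpoly (g \o h) << m >>.
  elim/cmonom_ind_var: m => [|i m IH]; first by rewrite !rename_mpolyC.
  rewrite malgUM.
  apply: etrans (esym (rename_mpolyM (g \o h) << ucm i >> << m >>)).
  apply: etrans (congr1 (rename_mpoly g (R := R)) (rename_mpolyM h << ucm i >> << m >>)) _.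
  apply: etrans (rename_mpolyM g _ _) _.
  congr (_ * _); last exact: IH.
  apply: etrans (congr1 (rename_mpoly g (R := R)) (rename_mpoly_ucm h i)) _.
  exact: etrans (rename_mpoly_ucm g (h i)) (esym (rename_mpoly_ucm (g \o h) i)).
have termE (I' J' : choiceType) (f : I' -> J') m :
    rename_mpoly f (<< m >> : {malg R[{cmonom I'}]}) = rename_term f R m.
  by rewrite /rename_mpoly mmapU /= mpolyC1E mul1r.
rewrite [rename_mpoly h p]mmapE [RHS]mmapE (raddf_sum (@rename_mpoly _ _ g R)).
apply: eq_bigr => m _; apply: etrans (rename_mpolyM g _ _) _.
congr (_ * _); first exact: rename_mpolyC.
by rewrite -!termE mE.
Qed.

Lemma rename_mpoly_id (I : choiceType) (p : {malg R[{cmonom I}]}) : rename_mpoly id p = p.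
Proof.
have mE (m : {cmonom I}) : rename_mpoly id (<< m >> : {malg R[{cmonom I}]}) = << m >>.
  elim/cmonom_ind_var: m => [|i m IH]; first exact: rename_mpolyC.
  rewrite malgUM; apply: etrans (rename_mpolyM id << ucm i >> << m >>) _.
  congr (_ * _); last exact: IH.
  exact: rename_mpoly_ucm.
have termE m : rename_mpoly id (<< m >> : {malg R[{cmonom I}]}) = rename_term id R m.
  by rewrite /rename_mpoly mmapU /= mpolyC1E mul1r.
rewrite [LHS]mmapE [RHS]monalgE; apply: eq_bigr => m _.
by rewrite -termE mE malgM_def fgmulUU mulr1 mul1m.
Qed.

Variable F : formal_group_law R.

Lemma fga_map_comp (L M N : zmodType) (g : {additive M -> N}) (h : {additive L -> M})
    (k : {additive L -> N}) (s : fga F L) :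
  (forall l, k l = g (h l)) -> fga_map k s = fga_map g (fga_map h s).
Proof.
move=> kE; rewrite -[s]reprK (fga_map_pi F k) (fga_map_pi F h) (fga_map_pi F g); congr (\pi_(fga F N) _).
have {}kE : (k : L -> N) = g \o h by apply: funext.
apply: seriesP => d; set t := generic_quotient.repr s.
change (rename_mpoly k (t d) = rename_mpoly g (rename_mpoly h (t d))).
by rewrite (rename_mpoly_comp g h (t d)) kE.
Qed.

Lemma fga_map_id (L : zmodType) (k : {additive L -> L}) (s : fga F L) :
  (forall l, k l = l) -> fga_map k s = s.
Proof.
move=> kE; rewrite -[s]reprK fga_map_pi; congr (\pi_(fga F L) _).
have {}kE : (k : L -> L) = id by apply: funext.
apply: seriesP => d; set t := generic_quotient.repr s.
exact: etrans (congr1 (fun f => rename_mpoly f (t d)) kE) (rename_mpoly_id (t d)).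
Qed.

Lemma fga_actE (L : zmodType) (D : root_datum L) (w : weyl D) (s : fga F L) :
  fga_act w s = fga_map w s.
Proof. by []. Qed.

End Functoriality.

(** * The localization Q *)

Section Localized.
Variables (R : comNzRingType) (F : formal_group_law R).
Variables (L : zmodType) (D : root_datum L).
Hypothesis hreg : forall a : root_type D, GRing.lreg (x_root F a).
Local Notation W := (weyl D).
Local Notation T := (root_type D).
Local Notation S := (fga F L).
Local Notation Q := (fga_loc F D).
Local Notation s_ := (@weyl_reflection L D).
Local Notation xr := (@x_root R F L D).
Local Notation toQ := (@to_loc R F L D).
Local Notation act := (@loc_act R F L D).
Implicit Types (w v u : W) (a b : T) (s t : S) (q : Q).

Lemma fga_actM v w s : fga_act (v * w)%g s = fga_act v (fga_act w s).
Proof.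
rewrite (fga_actE (v * w)%g s) (fga_actE w s) (fga_actE v).
exact: fga_map_comp.
Qed.

Lemma fga_act1 s : fga_act (1%g : W) s = s.
Proof. by rewrite fga_actE; apply: fga_map_id. Qed.

Lemma fga_act_root w a : fga_act w (xr a) = xr (weyl_root w a).
Proof. exact: fga_act_var. Qed.

Lemma fga_act_cong a s : exists t, s - fga_act (s_ a) s = xr a * t.
Proof.
rewrite fga_actE; apply: fga_map_cong => l; exists (- coroot a l).
by rewrite mulrNz; apply: weyl_reflectionE.
Qed.

Lemma x_root_opp a : exists2 c, xr (root_opp a) = xr a * c & exists d, c * d = 1.
Proof.
have dvd b : exists c, xr (root_opp b) = xr b * c.
  by have [c cE] := fga_varN_dvd F (val b); exists c; rewrite -cE /x_root root_oppE.
have [c cE] := dvd a; have [d] := dvd (root_opp a); rewrite root_oppK => dE.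
exists c => //; exists d; apply: (hreg (a := a)).
by rewrite mulrA -cE -dE mulr1.
Qed.

Lemma x_root_opp_sum a : exists h, xr a + xr (root_opp a) = xr a * xr (root_opp a) * h.
Proof.
by have [h hE] := fga_varN_sum F (val a); exists h; rewrite /x_root root_oppE.
Qed.

Lemma xpow_reg (e : {ffun T -> nat}) : GRing.lreg (xpow xr e).
Proof.
rewrite /xpow; apply: (big_ind (@GRing.lreg S)); first exact: lreg1.
  by move=> s t; apply: lregM.
by move=> a _; apply: lregX.
Qed.

Lemma toQ_inj : injective toQ.
Proof.
move=> s t /eqmodP/asboolP[e] /=; rewrite xpow0 !mulr1.
exact: xpow_reg.
Qed.

Lemma toQM s t : toQ (s * t) = toQ s * toQ t.
Proof. exact: (rmorphM (loc_inj xr)). Qed.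
Lemma toQD s t : toQ (s + t) = toQ s + toQ t.
Proof. exact: (rmorphD (loc_inj xr)). Qed.
Lemma toQB s t : toQ (s - t) = toQ s - toQ t.
Proof. exact: (rmorphB (loc_inj xr)). Qed.
Lemma toQN s : toQ (- s) = - toQ s.
Proof. exact: (rmorphN (loc_inj xr)). Qed.
Lemma toQ1 : toQ 1 = 1.
Proof. exact: (rmorph1 (loc_inj xr)). Qed.
Lemma toQ0 : toQ 0 = 0.
Proof. exact: (rmorph0 (loc_inj xr)). Qed.
Lemma toQX s n : toQ (s ^+ n) = toQ s ^+ n.
Proof. exact: (rmorphXn (loc_inj xr)). Qed.
Lemma toQ_prod (I : Type) (r : seq I) (P : pred I) (f : I -> S) :
  toQ (\prod_(i <- r | P i) f i) = \prod_(i <- r | P i) toQ (f i).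
Proof. exact: (rmorph_prod (loc_inj xr)). Qed.

Definition xq a : Q := toQ (xr a).
Definition xi a : Q := ring_inv (xq a).

Lemma toQ_xpow_inv e : exists q, toQ (xpow xr e) * q = 1.
Proof. by exists (loc_frac xr 1 e); apply: loc_frac_inv. Qed.

Lemma xqK a : xq a * xi a = 1.
Proof.
suff [q qE] : exists q, xq a * q = 1 by rewrite /xi (ring_invP qE).
have [q qE] := toQ_xpow_inv [ffun b => (b == a : nat)].
exists q; rewrite -[RHS]qE; congr (toQ _ * q).
rewrite /xpow (bigD1 a) //= ffunE eqxx expr1 big1 ?mulr1 // => b /negPf ba.
by rewrite ffunE ba expr0.
Qed.

Lemma xiK a : xi a * xq a = 1. Proof. by rewrite mulrC xqK. Qed.

Lemma mulQI (p q r : Q) (z : Q) : p * z = 1 -> p * q = p * r -> q = r.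
Proof. by move=> pz E; rewrite -[q]mul1r -pz -mulrA mulrCA E mulrCA mulrA pz mul1r. Qed.

Lemma loc_act_toQ w s : act w (toQ s) = toQ (fga_act w s).
Proof.
rewrite /to_loc /loc_inj loc_act_frac; congr loc_frac.
by apply/ffunP => a; rewrite !ffunE.
Qed.

Lemma loc_actM w : {morph act w : p q / p * q}.
Proof.
elim/loc_ind=> s e; elim/loc_ind=> t f.
have mulE s' e' t' f' : loc_frac xr s' e' * loc_frac xr t' f' =
  loc_mul (loc_frac xr s' e') (loc_frac xr t' f') by [].
rewrite mulE loc_mulE !loc_act_frac mulE loc_mulE rmorphM; congr loc_frac.
by apply/ffunP => a; rewrite !ffunE.
Qed.

Lemma loc_actD w : {morph act w : p q / p + q}.
Proof.
elim/loc_ind=> s e; elim/loc_ind=> t f.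
have addE s' e' t' f' : loc_frac xr s' e' + loc_frac xr t' f' =
  loc_add (loc_frac xr s' e') (loc_frac xr t' f') by [].
rewrite addE loc_addE !loc_act_frac addE loc_addE rmorphD !rmorphM /= !fga_act_xpow.
by congr loc_frac; apply/ffunP => a; rewrite !ffunE.
Qed.

Lemma loc_act1 w : act w 1 = 1.
Proof. by rewrite -toQ1 loc_act_toQ rmorph1. Qed.

Lemma loc_act0 w : act w 0 = 0.
Proof. by rewrite -toQ0 loc_act_toQ rmorph0. Qed.

Lemma loc_actN w q : act w (- q) = - act w q.
Proof. by apply/eqP; rewrite -addr_eq0 -loc_actD addNr loc_act0. Qed.

Lemma loc_act_comp v w q : act (v * w)%g q = act v (act w q).
Proof.
elim/loc_ind: q => s e; rewrite !loc_act_frac fga_actM; congr loc_frac.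
by apply/ffunP => a; rewrite !ffunE invMg weyl_rootM.
Qed.

Lemma loc_act_id q : act 1%g q = q.
Proof.
elim/loc_ind: q => s e; rewrite loc_act_frac fga_act1; congr loc_frac.
by apply/ffunP => a; rewrite !ffunE invg1 weyl_root1.
Qed.

Lemma loc_act_sum w (I : Type) (r : seq I) (P : pred I) (f : I -> Q) :
  act w (\sum_(i <- r | P i) f i) = \sum_(i <- r | P i) act w (f i).
Proof. exact: (big_morph (act w) (loc_actD w) (loc_act0 w)). Qed.

Lemma loc_act_prod w (I : Type) (r : seq I) (P : pred I) (f : I -> Q) :
  act w (\prod_(i <- r | P i) f i) = \prod_(i <- r | P i) act w (f i).
Proof. exact: (big_morph (act w) (loc_actM w) (loc_act1 w)). Qed.

Lemma loc_act_xq w a : act w (xq a) = xq (weyl_root w a).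
Proof. by rewrite loc_act_toQ fga_act_root. Qed.

Lemma loc_act_xi w a : act w (xi a) = xi (weyl_root w a).
Proof.
apply: (mulQI (xqK (weyl_root w a))).
by rewrite xqK -loc_act_xq -loc_actM xqK loc_act1.
Qed.

Definition intQ q : Prop := exists s, q = toQ s.

Lemma intQ_toQ s : intQ (toQ s). Proof. by exists s. Qed.
Lemma intQ_xq a : intQ (xq a). Proof. exact: intQ_toQ. Qed.
Lemma intQ0 : intQ 0. Proof. by exists 0; rewrite toQ0. Qed.
Lemma intQ1 : intQ 1. Proof. by exists 1; rewrite toQ1. Qed.
Lemma intQD p q : intQ p -> intQ q -> intQ (p + q).
Proof. by move=> [s ->] [t ->]; exists (s + t); rewrite toQD. Qed.
Lemma intQN p : intQ p -> intQ (- p).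
Proof. by move=> [s ->]; exists (- s); rewrite toQN. Qed.
Lemma intQM p q : intQ p -> intQ q -> intQ (p * q).
Proof. by move=> [s ->] [t ->]; exists (s * t); rewrite toQM. Qed.
Lemma intQX p n : intQ p -> intQ (p ^+ n).
Proof. by move=> [s ->]; exists (s ^+ n); rewrite toQX. Qed.
Lemma intQ_sum (I : Type) (r : seq I) (P : pred I) (f : I -> Q) :
  (forall i, P i -> intQ (f i)) -> intQ (\sum_(i <- r | P i) f i).
Proof. by move=> hf; apply: (big_ind intQ) => //; [exact: intQ0 | exact: intQD]. Qed.
Lemma intQ_prod (I : Type) (r : seq I) (P : pred I) (f : I -> Q) :
  (forall i, P i -> intQ (f i)) -> intQ (\prod_(i <- r | P i) f i).
Proof. by move=> hf; apply: (big_ind intQ) => //; [exact: intQ1 | exact: intQM]. Qed.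
Definition unitQ q : Prop := intQ q /\ exists2 p, intQ p & q * p = 1.

Lemma unitQM p q : unitQ p -> unitQ q -> unitQ (p * q).
Proof.
move=> [ip [p' ip' pE]] [iq [q' iq' qE]]; split; first exact: intQM.
by exists (p' * q'); [exact: intQM | rewrite mulrACA pE qE mulr1].
Qed.

Lemma unitQ1 : unitQ 1.
Proof. by split; [exact: intQ1 | exists 1; [exact: intQ1 | rewrite mulr1]]. Qed.

Lemma unitQN p : unitQ p -> unitQ (- p).
Proof.
move=> [ip [p' ip' pE]]; split; first exact: intQN.
by exists (- p'); [exact: intQN | rewrite mulrNN].
Qed.

Lemma unitQX p n : unitQ p -> unitQ (p ^+ n).
Proof.
by move=> up; elim: n => [|n IH]; [exact: unitQ1 | rewrite exprS; apply: unitQM].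
Qed.

Lemma unitQ_opp a : unitQ (xq (root_opp a) * xi a).
Proof.
have [c cE [d dE]] := x_root_opp a.
have -> : xq (root_opp a) * xi a = toQ c.
  by rewrite /xq cE toQM mulrAC xqK mul1r.
split; first exact: intQ_toQ.
by exists (toQ d); [exact: intQ_toQ | rewrite -toQM dE toQ1].
Qed.

Lemma unitQ_opp' a : unitQ (xq a * xi (root_opp a)).
Proof. by have := unitQ_opp (root_opp a); rewrite root_oppK. Qed.

Lemma intQ_xi_opp a : intQ (xi a + xi (root_opp a)).
Proof.
have [h hE] := x_root_opp_sum a; exists h.
have E : xq a + xq (root_opp a) = xq a * xq (root_opp a) * toQ h.
  by rewrite /xq -!toQD -!toQM hE.
transitivity (xi a * xi (root_opp a) * (xq a + xq (root_opp a))).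
  by rewrite mulrDr mulrAC xiK mul1r -mulrA xiK mulr1 addrC.
by rewrite E !mulrA -[xi a * _ * _]mulrAC xiK mul1r xiK mul1r.
Qed.

End Localized.

(** * Demazure operators on functions *)

Section Operators.
Variables (R : comNzRingType) (F : formal_group_law R).
Variables (L : zmodType) (D : root_datum L).
Local Notation W := (weyl D).
Local Notation T := (root_type D).
Local Notation S := (fga F L).
Local Notation Q := (fga_loc F D).
Local Notation s_ := (@weyl_reflection L D).
Local Notation toQ := (@to_loc R F L D).
Local Notation act := (@loc_act R F L D).
Local Notation xq := (@xq R F L D).
Local Notation xi := (@xi R F L D).
Implicit Types (w v u : W) (a b : T) (p q : Q) (f g h : W -> Q) (s t : seq T).
Implicit Types (X : {set T}).

(* xi b is the inverse of xq b = x_b in Q, and dmz a is the operator B_a. *)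
Definition dmz a f : W -> Q := fun w => xi (weyl_root w a) * (f w - f (w * s_ a)%g).
Definition dmzs s f : W -> Q := foldr dmz f s.

(** For X = Pi this is membership in the dual of D_F, by [demazure_dualP]. In general only the
    restriction of f to W_X matters ([dual_on_ext]), and its values at points other than 1 are
    reached through [dual_on_shift]. *)
Definition dual_on X f : Prop := forall s, all (mem X) s -> intQ (dmzs s f 1%g).

Lemma dmzs_cat s t f : dmzs (s ++ t) f = dmzs s (dmzs t f).
Proof. by rewrite /dmzs foldr_cat. Qed.

Lemma dmzs_rcons s a f : dmzs (rcons s a) f = dmzs s (dmz a f).
Proof. by rewrite -cats1 dmzs_cat. Qed.

Lemma dmz_sum (I : Type) (r : seq I) (P : pred I) (c : I -> Q) (f : I -> W -> Q) a :
  dmz a (fun w => \sum_(i <- r | P i) c i * f i w) =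
  fun w => \sum_(i <- r | P i) c i * dmz a (f i) w.
Proof.
apply: funext => w; rewrite /dmz -sumrB mulr_sumr; apply: eq_bigr => i _.
by rewrite -mulrBr mulrCA.
Qed.

Lemma dmzs_sum (I : Type) (r : seq I) (P : pred I) (c : I -> Q) (f : I -> W -> Q) s :
  dmzs s (fun w => \sum_(i <- r | P i) c i * f i w) =
  fun w => \sum_(i <- r | P i) c i * dmzs s (f i) w.
Proof. by elim: s => //= a s ->; rewrite dmz_sum. Qed.

Lemma dmzsZ c f s : dmzs s (fun w => c * f w) = fun w => c * dmzs s f w.
Proof.
have := dmzs_sum [:: tt] xpredT (fun _ => c) (fun _ => f) s.
under eq_fun do rewrite big_seq1.
by move=> ->; apply: funext => w; rewrite big_seq1.
Qed.

Lemma dmzD a f g : dmz a (fun w => f w + g w) = fun w => dmz a f w + dmz a g w.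
Proof. by apply: funext => w; rewrite /dmz -mulrDr; congr (_ * _); ring. Qed.

Lemma dmz_ext X a f g : a \in X -> {in parabolic X, f =1 g} ->
  {in parabolic X, dmz a f =1 dmz a g}.
Proof. by move=> aX fg w wX; rewrite /dmz !fg ?groupM ?mem_refl. Qed.

Lemma dmzs_ext X s f g : all (mem X) s -> {in parabolic X, f =1 g} ->
  {in parabolic X, dmzs s f =1 dmzs s g}.
Proof.
move=> sX fg; elim: s sX => [_|a s IH /andP[aX sX]]; first exact: fg.
exact: dmz_ext aX (IH sX).
Qed.

Lemma dual_on_ext X f g : {in parabolic X, f =1 g} -> dual_on X f -> dual_on X g.
Proof.
move=> fg df s sX; have [i E] := df s sX; exists i.
by rewrite -E; apply/esym/(dmzs_ext sX fg)/group1.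
Qed.

(** Coinduction: [dual_on X] is the largest class of functions that are integral at 1 and stable
    under the operators of X. *)
Lemma dual_coind X (C : (W -> Q) -> Prop) :
    (forall f, C f -> intQ (f 1%g)) ->
    (forall f a, a \in X -> C f -> C (dmz a f)) ->
  forall f, C f -> dual_on X f.
Proof.
move=> C1 CB f Cf s; elim/last_ind: s f Cf => [|s a IH] f Cf; first by move=> _; apply: C1.
by rewrite all_rcons dmzs_rcons => /andP[aX sX]; apply: IH => //; apply: CB.
Qed.

Lemma dual_on_dmz X a f : a \in X -> dual_on X f -> dual_on X (dmz a f).
Proof. by move=> aX df s sX; rewrite -dmzs_rcons; apply: df; rewrite all_rcons /= aX. Qed.

Lemma dual_on_dmzs X s f : all (mem X) s -> dual_on X f -> dual_on X (dmzs s f).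
Proof. by move=> sX df t tX; rewrite -dmzs_cat; apply: df; rewrite all_cat tX. Qed.

Lemma dual_on1 X f : dual_on X f -> intQ (f 1%g).
Proof. by move=> df; apply: (df [::]). Qed.

(** The operator B_a turns the function of s into that of t, where s - sigma_a (s) = x_(m a) t, so
    functions of this shape form a stable class. With M = L they are the functions w |-> w (s); with
    M = [L * int] they include the weight functions of rank two. *)
Lemma dual_on_points X (M : zmodType) (theta : W -> {additive M -> L})
    (sigma : T -> {additive M -> M}) (m : T -> M) (s : fga F M) :
    (forall a, a \in X -> forall l, exists n : int, sigma a l = l + m a *~ n) ->
    (forall a w, a \in X -> w \in parabolic X -> theta w (m a) = w (val a)) ->
    (forall a w l, a \in X -> w \in parabolic X ->
       theta (w * s_ a)%g l = theta w (sigma a l)) ->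
  dual_on X (fun w => toQ (fga_map (theta w) s)).
Proof.
move=> hs hm ht.
pose C f := exists r : fga F M, forall w, w \in parabolic X -> f w = toQ (fga_map (theta w) r).
apply: (@dual_coind X C) => [f [r fE]|f a aX [r fE]|]; last by exists s.
  by rewrite fE ?group1 //; apply: intQ_toQ.
have [t tE] := fga_map_cong (hs a aX) r.
exists t => w wX; rewrite /dmz !fE ?groupM ?mem_refl //.
rewrite (@fga_map_comp _ F _ _ _ (theta w) (sigma a) (theta (w * s_ a)%g)); last first.
  by move=> l; apply: ht.
rewrite -toQB -rmorphB tE rmorphM /= toQM mulrA.
have -> : fga_map (theta w) (fga_var F (m a)) = x_root F (weyl_root w a).
  by rewrite fga_map_var hm.
by rewrite xiK // mul1r.
Qed.

Lemma dual_on_char X (s : S) : dual_on X (fun w => toQ (fga_act w s)).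
Proof.
apply: (@dual_on_points X L (fun w => w) (fun a => s_ a) (fun a => val a)) => //.
by move=> a _ l; exists (- coroot a l); rewrite mulrNz; apply: weyl_reflectionE.
Qed.

Lemma dual_on_cst X q : intQ q -> dual_on X (fun=> q).
Proof.
move=> iq; apply: (@dual_coind X (fun f => f = (fun=> q) \/ f = (fun=> 0))); last by left.
- by move=> f [->|->] //; apply: intQ0.
- by move=> f a _ [->|->]; right; apply: funext => w; rewrite /dmz subrr mulr0.
Qed.

(** The Leibniz rule [dmzM] turns a product into a sum of products; the coinduction for products
    therefore runs over the whole span. *)
Inductive ring_span (C : (W -> Q) -> Prop) : (W -> Q) -> Prop :=
| RingGen f : C f -> ring_span C f
| RingAdd f g : ring_span C f -> ring_span C g -> ring_span C (fun w => f w + g w)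
| RingMul f g : ring_span C f -> ring_span C g -> ring_span C (fun w => f w * g w).

Lemma dmzM a f g w : dmz a (fun w => f w * g w) w =
  dmz a f w * g w + f w * dmz a g w + - xq (weyl_root w a) * dmz a f w * dmz a g w.
Proof.
rewrite /dmz; set x := xi _; set y := xq _; have yx : y * x = 1 by apply: xqK.
set f1 := f w; set f2 := f (w * s_ a)%g; set g1 := g w; set g2 := g (w * s_ a)%g.
transitivity (x * (f1 - f2) * g1 + f1 * (x * (g1 - g2)) +
   - (y * x) * (f1 - f2) * (x * (g1 - g2))); last by ring.
by rewrite yx; ring.
Qed.

Lemma xq_char a w : xq (weyl_root w a) = toQ (fga_act w (x_root F a)).
Proof. by rewrite fga_act_root. Qed.

Lemma dual_on_ring X f : ring_span (dual_on X) f -> dual_on X f.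
Proof.
apply: (@dual_coind X (ring_span (dual_on X))) => {f}.
  move=> f; elim=> {f} [f /dual_on1 //|f g _ ih _ jh|f g _ ih _ jh].
    exact: intQD.
  exact: intQM.
move=> f a aX; elim=> {f} [f df|f g _ ih _ jh|f g sf ih sg jh].
- by apply/RingGen/dual_on_dmz.
- by rewrite dmzD; apply: RingAdd.
have -> : dmz a (fun w => f w * g w) = fun w => (dmz a f w * g w + f w * dmz a g w) +
    (toQ (fga_act w (- x_root F a)) * dmz a f w) * dmz a g w.
  by apply: funext => w; rewrite dmzM rmorphN toQN -xq_char.
apply: RingAdd; first by apply: RingAdd; apply: RingMul.
apply: RingMul => //; apply: RingMul => //; apply/RingGen/dual_on_char.
Qed.

Lemma dual_onD X f g : dual_on X f -> dual_on X g -> dual_on X (fun w => f w + g w).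
Proof. by move=> df dg; apply: dual_on_ring; apply: RingAdd; apply: RingGen. Qed.

Lemma dual_onM X f g : dual_on X f -> dual_on X g -> dual_on X (fun w => f w * g w).
Proof. by move=> df dg; apply: dual_on_ring; apply: RingMul; apply: RingGen. Qed.

Lemma dual_onZ X q f : intQ q -> dual_on X f -> dual_on X (fun w => q * f w).
Proof. by move=> iq df; apply: dual_onM => //; apply: dual_on_cst. Qed.

Lemma dual_onB X f g : dual_on X f -> dual_on X g -> dual_on X (fun w => f w - g w).
Proof.
move=> df dg; have -> : (fun w => f w - g w) = fun w => f w + (- 1) * g w.
  by apply: funext => w; rewrite mulN1r.
by apply: dual_onD => //; apply: dual_onZ => //; apply/intQN/intQ1.
Qed.

Lemma dual_on_sum X (I : Type) (r : seq I) (P : pred I) (c : I -> Q) (f : I -> W -> Q) :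
  (forall i, P i -> intQ (c i)) -> (forall i, P i -> dual_on X (f i)) ->
  dual_on X (fun w => \sum_(i <- r | P i) c i * f i w).
Proof.
move=> ic df; elim: r => [|i r IH].
  by under eq_fun do rewrite big_nil; apply/dual_on_cst/intQ0.
have [Pi0|nPi] := boolP (P i); last first.
  by under eq_fun do rewrite big_cons (negPf nPi).
under eq_fun do rewrite big_cons Pi0.
by apply: dual_onD => //; apply: dual_onZ; [apply: ic | apply: df].
Qed.

Lemma dual_on_shift1 X a f : a \in X -> dual_on X f -> dual_on X (fun w => f (w * s_ a)%g).
Proof.
move=> aX df.
have -> : (fun w => f (w * s_ a)%g) = fun w => f w - toQ (fga_act w (x_root F a)) * dmz a f w.
  apply: funext => w; rewrite -xq_char /dmz mulrA xqK // mul1r; ring.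
by apply: dual_onB => //; apply: dual_onM; [apply: dual_on_char | apply: dual_on_dmz].
Qed.

Lemma dual_on_shift X u f : u \in parabolic X -> dual_on X f -> dual_on X (fun w => f (w * u)%g).
Proof.
move=> /parabolic_word[s sX <-]; elim/last_ind: s sX f => [|s a IH] sX f df.
  by under eq_fun do rewrite word_nil mulg1.
move: sX; rewrite all_rcons word_rcons => /andP[aX sX].
under eq_fun do rewrite mulgA.
by apply: (IH sX (fun w => f (w * s_ a)%g)); apply: dual_on_shift1.
Qed.

(* Left translations commute with the operators dmz a, which act on the right. *)
Definition ltrans v f : W -> Q := fun w => act v^-1%g (f (v * w)%g).

Lemma dmz_ltrans v a f : dmz a (ltrans v f) = ltrans v (dmz a f).
Proof.
apply: funext => w; rewrite /dmz /ltrans loc_actM loc_act_xi //.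
rewrite -weyl_rootM mulKg mulgA; congr (_ * _).
by rewrite loc_actD loc_actN.
Qed.

Lemma dmzs_ltrans v s f : dmzs s (ltrans v f) = ltrans v (dmzs s f).
Proof. by elim: s => //= a s ->; apply: dmz_ltrans. Qed.

Lemma ltrans1 v f : act v (ltrans v f 1%g) = f v.
Proof. by rewrite /ltrans mulg1 -loc_act_comp mulgV loc_act_id. Qed.

End Operators.

(** * Products over inversion sets *)

Section InversionProducts.
Variables (L : zmodType) (D : root_datum L) (Pi : {set root_type D}).
Hypothesis hPi : simple_system Pi.
Local Notation W := (weyl D).
Local Notation T := (root_type D).
Local Notation s_ := (@weyl_reflection L D).
Local Notation word := (@weyl_word L D).
Local Notation ninv := (ninv Pi).
Local Notation inversions := (inversions Pi).
Implicit Types (w v u x y : W) (a b : T) (s t : seq T) (X : {set T}).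

Lemma ninv_reduced_word x : exists2 s, all (mem Pi) s & word s = x /\ size s = ninv x.
Proof. by apply: parabolic_reduced_word; rewrite ?parabolicT. Qed.

Lemma ninvM_le x y : (ninv (x * y)%g <= ninv x + ninv y)%N.
Proof.
have [s sPi [<- <-]] := ninv_reduced_word x; have [t tPi [<- <-]] := ninv_reduced_word y.
by rewrite -word_cat -size_cat ninv_word // all_cat sPi.
Qed.

Lemma prod_inv_mul (A : comPzRingType) (g : T -> A) x y w :
  ninv (x * y)%g = (ninv x + ninv y)%N ->
  \prod_(b in inversions (x * y)^-1%g) g (weyl_root w b) =
  \prod_(b in inversions x^-1%g) g (weyl_root w b) * \prod_(b in inversions y^-1%g) g (weyl_root (w * x)%g b).
Proof.
have [s sPi [<- ss]] := ninv_reduced_word x; have [t tPi [<- tt]] := ninv_reduced_word y.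
rewrite -ss -tt -word_cat.
elim: s sPi w {x ss} => [|a s IH] /=.
  move=> _ w _; rewrite word_nil invg1 [X in _ = X * _]big_pred0 ?mul1r ?mulg1 // => b.
  by rewrite inE weyl_root1 andbN.
move=> /andP[aPi sPi] w E.
have nst : ninv (word (s ++ t)) = (size s + size t)%N.
  have stPi : all (mem Pi) (s ++ t) by rewrite all_cat sPi.
  apply/eqP; rewrite eqn_leq -size_cat ninv_word //=.
  have := ninvM_le (s_ a) (word (s ++ t)); rewrite -word_cons E addSn size_cat.
  have := ninv_word hPi (_ : all (mem Pi) [:: a]).
  rewrite /= aPi word_cons word_nil mulg1 => /(_ isT) na le.
  by rewrite -ltnS; apply: leq_trans le _; rewrite -[X in (_ <= X)%N]add1n leq_add2r.
have ns : ninv (word s) = size s.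
  apply/eqP; rewrite eqn_leq ninv_word //=.
  have := ninvM_le (word s) (word t); rewrite -word_cat nst -tt leq_add2r.
  by [].
have ncs : ninv (word (a :: s)) = (size s).+1.
  apply/eqP; rewrite eqn_leq (ninv_word hPi (s := a :: s)) /= ?aPi //.
  have := ninvM_le (word (a :: s)) (word t); rewrite -word_cat E -tt leq_add2r.
  by [].
rewrite prod_inv_word // -?word_cons ?E ?nst ?addSn // IH //.
rewrite [in RHS]prod_inv_word // -?word_cons ?ncs ?ns // mulrA; congr (_ * _).
by rewrite word_cons mulgA.
Qed.

(** The longest element of W_X exchanges the negative and the positive roots of X, and the latter
    are its inversions. This matches the denominator of A_X with that of an iterated operator. *)
Lemma prod_inv_longest (A : comPzRingType) (g : T -> A) X x w :
  X \subset Pi -> longest Pi X x ->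
  \prod_(b in sub_neg_roots Pi X) g (weyl_root (w * x)%g b) =
  \prod_(b in inversions x^-1%g) g (weyl_root w b).
Proof.
move=> hX lx; rewrite (longest_invg hPi hX lx) (inv_longest hPi hX lx).
rewrite [RHS](reindex_inj (@weyl_root_inj _ _ x)) /=.
apply: eq_big => [b|b _]; last by rewrite weyl_rootM.
rewrite sub_neg_rootsP // inE weyl_reflection_conj.
have xX : x \in parabolic X by case: lx.
rewrite groupMr ?groupV // groupMl //.
have [bX|] := boolP (s_ b \in _); last by rewrite !andbF.
rewrite !andbT; have cX := reflection_int_comb hPi hX bX.
have [pb|nb] := boolP (posb Pi b) => /=.
  exact/esym/negbTE/(longest_neg hPi lx)/(pos_int_comb hPi hX pb cX).
rewrite -[b]root_oppK weyl_root_opp posbN //; apply/esym.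
apply: (longest_neg hPi lx).
by apply: (pos_int_comb hPi hX); rewrite ?posbN // root_oppE; apply: int_combN.
Qed.

End InversionProducts.

(** * Triangularity and dual bases *)

Section DualBasis.
Variables (R : comNzRingType) (F : formal_group_law R).
Variables (L : zmodType) (D : root_datum L) (Pi : {set root_type D}).
Hypothesis hPi : simple_system Pi.
Local Notation W := (weyl D).
Local Notation T := (root_type D).
Local Notation Q := (fga_loc F D).
Local Notation s_ := (@weyl_reflection L D).
Local Notation xq := (@xq R F L D).
Local Notation xi := (@xi R F L D).
Local Notation word := (@weyl_word L D).
Local Notation ninv := (ninv Pi).
Local Notation inversions := (inversions Pi).
Implicit Types (w v u x y : W) (a b : T) (p q c : Q) (f g h : W -> Q) (s t : seq T).
Implicit Types (X : {set T}).

(* The pull-back of A_X f to W. *)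
Definition avg X f : W -> Q := fun w =>
  \sum_(u in parabolic X) f (w * u)%g * \prod_(b in sub_neg_roots Pi X) xi (weyl_root (w * u)%g b).

Lemma avg_invariant X f w u : u \in parabolic X -> avg X f (w * u)%g = avg X f w.
Proof.
move=> uX; rewrite /avg [RHS](reindex_inj (mulgI u)) /=.
apply: eq_big => [v|v _]; first by rewrite groupMl.
by rewrite !mulgA.
Qed.

Lemma avg_set0 f : avg set0 f = f.
Proof.
apply: funext => w; rewrite /avg sub_neg_roots0 // (big_pred1 1%g) => [|u].
  by rewrite mulg1 big_set0 mulr1.
by rewrite /parabolic /= imset0 gen0 inE.
Qed.

Variable Y : {set T}.
Hypothesis hY : Y \subset Pi.
Local Notation WY := (parabolic Y).

(** An operator compares f at y and at y s_a, whose lengths differ by one; hence each letter lowers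
    the bound k by at most one. *)
Lemma dmzs_supp f k s y : (forall z, z \in WY -> (ninv z < k)%N -> f z = 0) ->
  all (mem Y) s -> y \in WY -> (ninv y + size s < k)%N -> dmzs s f y = 0.
Proof.
move=> f0; elim: s y => [|a s IH] y /=; first by rewrite addn0 => _; apply: f0.
move=> /andP[aY sY] yY lt; rewrite /dmz.
have lea : (ninv (y * s_ a)%g <= (ninv y).+1)%N.
  apply: leq_trans (ninvM_le hPi _ _) _; rewrite -addn1 leq_add2l.
  have := ninv_word hPi (_ : all (mem Pi) [:: a]).
  by rewrite /= (subsetP hY) // word_cons word_nil mulg1; apply.
rewrite !IH ?subrr ?mulr0 ?groupM ?mem_refl //.
  by apply: leq_ltn_trans lt; rewrite addnS -addSn leq_add2r.
by apply: leq_ltn_trans lt; rewrite leq_add2l.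
Qed.

(** On the boundary of the range of [dmzs_supp] at most one term of the iterated operator survives,
    the one that multiplies y by all the letters. *)
Lemma dmzs_lead f k s y : (forall z, z \in WY -> (ninv z < k)%N -> f z = 0) ->
  all (mem Y) s -> y \in WY -> (ninv y + size s)%N = k ->
  dmzs s f y = (- 1) ^+ size s * f (y * word s)%g * \prod_(b in inversions (word s)^-1%g) xi (weyl_root y b).
Proof.
move=> f0; elim: s y => [|a s IH] y.
  move=> _ yY _; rewrite word_nil invg1 big_pred0 ?mulg1 ?mul1r ?mulr1 // => b.
  by rewrite inE weyl_root1 andbN.
move=> /= /andP[aY sY] yY E; rewrite /dmz (dmzs_supp f0) //; last first.
  by rewrite -E addnS.
have aPi := subsetP hY _ aY.
have yaY : (y * s_ a)%g \in WY by rewrite groupM ?mem_refl.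
(* If y (a) is negative, y s_a is shorter than y, and both sides vanish. *)
have [pa|na] := boolP (posb Pi (weyl_root y a)); last first.
  have nE := ninv_mulrN hPi aPi na.
  rewrite (dmzs_supp f0) //; last first.
    by rewrite -E nE addSn addnS ltnS leqW.
  rewrite subrr mulr0 f0 ?mulr0 ?mul0r //; first by rewrite groupM ?word_parabolic //= aY.
  rewrite word_cons mulgA; apply: leq_ltn_trans (ninvM_le hPi _ _) _.
  rewrite -E nE addSn addnS ltnS ltnW // ltnS leq_add2l.
  by apply: ninv_word => //; apply: all_subset sY.
have nE := ninv_mulr hPi aPi pa.
rewrite IH //; last by rewrite nE -E addnS.
rewrite word_cons mulgA sub0r mulrN.
have [lt|ge] := ltnP (ninv (y * s_ a * word s)%g) k.
  rewrite f0 ?mulr0 ?mul0r ?mulr0 ?oppr0 //.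
  by rewrite groupM // word_parabolic.
have sPi := all_subset hY sY.
have leS : (ninv (word s) <= size s)%N by apply: ninv_word.
(* Here y times the whole word has length at least k, the length of y plus the number of letters.
   This forces the word to be reduced, as [prod_inv_word] requires. *)
have ns : ninv (s_ a * word s)%g = (ninv (word s)).+1.
  have le1 : (k <= ninv y + ninv (s_ a * word s)%g)%N.
    by apply: leq_trans ge _; rewrite -mulgA; apply: ninvM_le.
  have le2 : (k <= ninv (y * s_ a)%g + ninv (word s))%N.
    by apply: leq_trans ge _; apply: ninvM_le.
  move: le1; rewrite -E leq_add2l => le1.
  move: le2; rewrite nE -E addSn -addnS leq_add2l ltnS => le2.
  have {le2}-> : ninv (word s) = size s by apply/eqP; rewrite eqn_leq leS.
  have le3 : (ninv (s_ a * word s)%g <= (size s).+1)%N.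
    by rewrite -word_cons; apply: (ninv_word hPi (s := a :: s)); rewrite /= aPi.
  by apply/eqP; rewrite eqn_leq le3.
rewrite -word_cons prod_inv_word // exprS; ring.
Qed.

Variable X : {set T}.
Hypothesis hXY : X \subset Y.
Let hX : X \subset Pi := subset_trans hXY hY.
Local Notation WX := (parabolic X).

Variable I : W -> seq T.
Definition min_reps_in := WY :&: min_reps Pi X.
Hypothesis hI : forall w, w \in min_reps_in ->
  [/\ all (mem Y) (I w), word (I w) = w & size (I w) = ninv w].
Local Notation V := min_reps_in.

Definition eps w f := dmzs (I w) f 1%g.

Lemma min_reps_inP v : v \in V -> v \in WY /\ min_rep Pi X v.
Proof. by rewrite inE => /andP[vY /(min_repsP hPi v hX) vX]. Qed.

Lemma min_rep_split y : y \in WY -> exists v u, [/\ v \in V, u \in WX & y = (v * u)%g].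
Proof.
move=> yY; have [v [u [mv uX yE]]] := min_rep_exists hPi hX y.
have uY : u \in WY by apply: (subsetP (parabolicS hXY)).
exists v, u; split=> //; rewrite inE; apply/andP; split; last exact/(min_repsP hPi).
by rewrite -(mulgK u v) -yE groupM ?groupV.
Qed.

Definition right_inv f := forall w u, w \in WY -> u \in WX -> f (w * u)%g = f w.

Lemma xi_prod_unit (A : {set T}) w : exists c, (\prod_(b in A) xi (weyl_root w b)) * c = 1.
Proof.
exists (\prod_(b in A) xq (weyl_root w b)); rewrite -big_split big1 //= => b _.
exact: xiK.
Qed.

(** If f vanishes on the elements shorter than v, then [eps v f] is f (v) up to an invertible
    factor, by [dmzs_lead]. Other elements reduce by invariance to their minimal representatives,
    which are not longer. *)
Lemma eps_inj_lt f k : right_inv f -> (forall w, w \in V -> (ninv w < k)%N -> eps w f = 0) ->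
  forall y, y \in WY -> (ninv y < k)%N -> f y = 0.
Proof.
move=> fi f0.
have fV n v : v \in V -> ninv v = n -> (n < k)%N -> f v = 0.
  elim/ltn_ind: n v => n IH v vV vn nk; have [vY mv] := min_reps_inP vV.
  have [IY IE Is] := hI vV.
  have below z : z \in WY -> (ninv z < n)%N -> f z = 0.
    move=> zY lt; have [v' [u [v'V uX zE]]] := min_rep_split zY.
    have [v'Y mv'] := min_reps_inP v'V.
    have lt' : (ninv v' < n)%N.
      by apply: leq_ltn_trans lt; rewrite zE (ninv_min_rep hPi hX) // leq_addr.
    by rewrite zE fi //; apply: IH (erefl _) _ => //; apply: ltn_trans lt' nk.
  have := f0 v vV; rewrite vn nk /eps (dmzs_lead below) ?group1 //; last by rewrite ninv1 Is.
  rewrite IE mul1g; have [c cE] := xi_prod_unit (inversions v^-1%g) 1%g.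
  move=> /(_ isT)/(congr1 (fun q => (- 1) ^+ size (I v) * (q * c))).
  by rewrite -!mulrA cE mulr1 mul0r mulr0 mulrA -exprD addnn -signr_odd odd_double mul1r.
move=> y yY yk; have [v [u [vV uX yE]]] := min_rep_split yY.
have [vY mv] := min_reps_inP vV.
rewrite yE fi // (fV _ v vV erefl) //.
by apply: leq_ltn_trans yk; rewrite yE (ninv_min_rep hPi hX) // leq_addr.
Qed.

Lemma eps_inj f : right_inv f -> (forall w, w \in V -> eps w f = 0) ->
  forall y, y \in WY -> f y = 0.
Proof. by move=> fi f0 y yY; apply: (eps_inj_lt fi (k := (ninv y).+1)) => // w wV _; apply: f0. Qed.

Variables (w0 : W) (p0 : Q).
Hypothesis hw0 : longest Pi Y w0.
Hypothesis hp0 : unitQ (p0 * \prod_(b in inversions w0^-1%g) xi b).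
Definition point f := forall w, w \in WY -> f w = if w == w0 then p0 else 0.
Variable pt : W -> Q.
Hypothesis hpt : point pt.

(** The class in which the dual basis is sought is a parameter: properties that hold for the
    averages of the B_s (pt) and pass to S-combinations, such as integrality of an average or of a
    trace, are inherited by the basis. *)
Variable C : (W -> Q) -> Prop.
Hypothesis C_avg : forall s, all (mem Y) s -> C (avg X (dmzs s pt)).
Hypothesis C0 : C (fun=> 0).
Hypothesis C_comb : forall f g c, intQ c -> C f -> C g -> C (fun w => f w + c * g w).
Hypothesis C_dual : forall f, C f -> dual_on Y f.

(** B_K lowers the support of the point function from w0 to the length of v w_X, where only v w_X
    itself survives; averaging over W_X carries this leading value to v. *)
Lemma schubert v : v \in V -> exists2 f, C f &
  (forall w, w \in V -> (ninv w <= ninv v)%N -> w != v -> eps w f = 0) /\ unitQ (eps v f).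
Proof.
move=> vV; have [vY mv] := min_reps_inP vV.
have [wX lX] := longest_exists hPi hX; have wXX : wX \in WX by case: lX.
have wXY : wX \in WY by apply: (subsetP (parabolicS hXY)).
have vwY : (v * wX)%g \in WY by rewrite groupM.
have w0Y : w0 \in WY by case: hw0.
(* K leads from v w_X, the longest element of the coset v W_X, to w0, and the lengths add up. *)
have [K KY [KE Ks]] : exists2 s, all (mem Y) s &
    word s = ((v * wX)^-1 * w0)%g /\ size s = ninv ((v * wX)^-1 * w0)%g.
  by apply: (parabolic_reduced_word hPi hY); rewrite groupM ?groupV.
have nvw : ninv (v * wX)%g = (ninv v + ninv wX)%N by apply: (ninv_min_rep hPi hX).
have nK : (ninv v + ninv wX + size K)%N = ninv w0.
  by rewrite Ks -nvw addnC; apply: (ninv_longestV hPi hY hw0 vwY).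
exists (avg X (dmzs K pt)); first exact: C_avg.
set g := dmzs K pt; set h := avg X g.
have pt0 z : z \in WY -> (ninv z < ninv w0)%N -> pt z = 0.
  by move=> zY lt; rewrite hpt //; case: eqP lt => // ->; rewrite ltnn.
have g0 z : z \in WY -> (ninv z < ninv v + ninv wX)%N -> g z = 0.
  by move=> zY lt; apply: (dmzs_supp pt0) => //; rewrite -nK ltn_add2r.
have g1 z : z \in WY -> ninv z = (ninv v + ninv wX)%N -> z != (v * wX)%g -> g z = 0.
  move=> zY zn zv; rewrite /g (dmzs_lead pt0) // ?zn //; rewrite hpt; last first.
    by rewrite groupM // word_parabolic.
  case: eqP => [zK|_]; last by rewrite mulr0 mul0r.
  by case/eqP: zv; apply: (mulIg (word K)); rewrite zK KE mulKVg.
have uY u : u \in WX -> u \in WY by apply: (subsetP (parabolicS hXY)).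
have le_zu z u : u \in WX -> (ninv (z * u)%g <= ninv z + ninv wX)%N.
  move=> uX; apply: leq_trans (ninvM_le hPi _ _) _; rewrite leq_add2l.
  exact: (ninv_le_longest hPi hX lX).
have h0 z : z \in WY -> (ninv z < ninv v)%N -> h z = 0.
  move=> zY lt; rewrite /h /avg big1 // => u uX.
  have zuY : (z * u)%g \in WY by apply: groupM zY (uY u uX).
  rewrite g0 ?mul0r //.
  by apply: leq_ltn_trans (le_zu _ _ uX) _; rewrite ltn_add2r.
split=> [w wV le wv|].
  have [wY mw] := min_reps_inP wV; have [IY IE Is] := hI wV.
  move: le; rewrite leq_eqVlt => /orP[/eqP E|lt]; last first.
    by apply: (dmzs_supp h0); rewrite ?group1 // ninv1 Is.
  rewrite /eps (dmzs_lead h0) ?group1 //; last by rewrite ninv1 Is.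
  rewrite IE mul1g; suff -> : h w = 0 by rewrite mulr0 mul0r.
  rewrite /h /avg big1 // => u uX; have wuY : (w * u)%g \in WY by apply: groupM wY (uY u uX).
  have := le_zu w u uX; rewrite E leq_eqVlt => /orP[/eqP E'|lt]; last by rewrite g0 ?mul0r.
  rewrite g1 ?mul0r //; apply: contra wv => /eqP wu.
  have E2 : w = (v * (wX * u^-1))%g by rewrite mulgA -wu mulgK.
  have u1 : (wX * u^-1)%g = 1%g.
    by apply: (min_rep_uniq hPi hX mv mw _ E2); rewrite groupM ?groupV.
  by rewrite E2 u1 mulg1.
have [IY IE Is] := hI vV.
rewrite /eps (dmzs_lead h0) ?group1 //; last by rewrite ninv1 Is.
rewrite IE mul1g.
(* In the average at v only u = w_X is long enough to meet the support of g. *)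
have hv : h v = g (v * wX)%g * \prod_(b in inversions wX^-1%g) xi (weyl_root v b).
  rewrite /h /avg (bigD1 wX) //= [X in _ + X]big1 ?addr0 => [|u /andP[uX uw]].
    by congr (_ * _); apply: prod_inv_longest.
  have vuY : (v * u)%g \in WY by apply: groupM vY (uY u uX).
  rewrite g0 ?mul0r // (ninv_min_rep hPi hX) // ltn_add2l.
  rewrite ltn_neqAle (ninv_le_longest hPi hX) // andbT.
  by apply: contra uw => /eqP E; apply/eqP; apply: (longest_uniq hPi hX).
have gv : g (v * wX)%g = (- 1) ^+ size K * p0 *
    \prod_(b in inversions (word K)^-1%g) xi (weyl_root (v * wX)%g b).
  rewrite /g (dmzs_lead pt0) // ?nvw //; congr (_ * _ * _); rewrite KE mulKVg hpt //.
  by rewrite eqxx.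
(* The lengths add up along w0 = v w_X (word K), so the three denominators multiply to the product
   that p0 cancels up to a unit. *)
have prodE : \prod_(b in inversions w0^-1%g) xi b =
    \prod_(b in inversions v^-1%g) xi (weyl_root 1%g b) *
    \prod_(b in inversions wX^-1%g) xi (weyl_root v b) *
    \prod_(b in inversions (word K)^-1%g) xi (weyl_root (v * wX)%g b).
  have w0E : w0 = (v * wX * word K)%g by rewrite KE mulKVg.
  have nE : ninv (v * wX * word K)%g = (ninv (v * wX)%g + ninv (word K))%N.
    by rewrite -w0E -nK nvw Ks -KE.
  have := prod_inv_mul hPi xi 1%g nE; rewrite -w0E mul1g.
  rewrite (prod_inv_mul hPi xi 1%g nvw) mul1g => <-.
  by apply: eq_bigr => b _; rewrite weyl_root1.
rewrite hv gv.
set A1 := \prod_(b in inversions (word K)^-1%g) _ in prodE *.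
set A2 := \prod_(b in inversions wX^-1%g) _ in prodE *.
set A3 := \prod_(b in inversions v^-1%g) _ in prodE *.
have -> : (-1) ^+ size (I v) * ((-1) ^+ size K * p0 * A1 * A2) * A3 =
  (-1) ^+ (size (I v) + size K) * (p0 * (A3 * A2 * A1)) :> Q by rewrite exprD; ring.
rewrite -prodE; apply: unitQM => //; apply: unitQX; apply/unitQN/unitQ1.
Qed.

Lemma eps_comb w f g c : eps w (fun w => f w + c * g w) = eps w f + c * eps w g.
Proof.
rewrite /eps; have := dmzs_sum [:: (1, f); (c, g)] xpredT fst snd (I w).
under eq_fun do rewrite !big_cons big_nil /= mul1r addr0.
by move=> ->; rewrite !big_cons big_nil /= mul1r addr0.
Qed.

Lemma eps_sum w f (r : seq W) (P : pred W) (c : W -> Q) (b : W -> W -> Q) :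
  eps w (fun x => f x + \sum_(u <- r | P u) c u * b u x) =
  eps w f + \sum_(u <- r | P u) c u * eps w (b u).
Proof.
have := eps_comb w f (fun x => \sum_(u <- r | P u) c u * b u x) 1.
by under eq_fun do rewrite mul1r; move=> ->; rewrite mul1r {2}/eps dmzs_sum.
Qed.

Lemma C_sum f (r : seq W) (P : pred W) (c : W -> Q) (b : W -> W -> Q) :
  C f -> (forall u, P u -> intQ (c u) /\ C (b u)) ->
  C (fun x => f x + \sum_(u <- r | P u) c u * b u x).
Proof.
move=> Cf Cb; elim: r => [|u r IH]; first by under eq_fun do rewrite big_nil addr0.
have [Pu|nPu] := boolP (P u); last by under eq_fun do rewrite big_cons (negPf nPu).
under eq_fun do rewrite big_cons Pu addrCA addrC.
by have [ic Cbu] := Cb u Pu; apply: C_comb.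
Qed.

Lemma eps0 w : eps w (fun=> 0) = 0.
Proof.
have := eps_comb w (fun=> 0) (fun=> 0) (-1).
by under eq_fun do rewrite mulr0 addr0; rewrite mulN1r subrr.
Qed.

(** Descending induction on the length: the function of [schubert] for v is corrected by the dual
    functions already found for longer elements and then divided by the unit [eps v f]. *)
Lemma dual_basis : exists b : W -> W -> Q, forall v, v \in V ->
  C (b v) /\ forall w, w \in V -> eps w (b v) = (w == v)%:R.
Proof.
suff H v : exists f, v \in V -> C f /\ forall w, w \in V -> eps w f = (w == v)%:R.
  by exists (fun v => projT1 (cid (H v))) => v vV; apply: (projT2 (cid (H v))).
elim/ltn_ind: {v}(ninv w0 - ninv v)%N {-2}v (erefl (ninv w0 - ninv v)%N) => n IH v vn.
have [vV|nV] := boolP (v \in V); last by exists (fun=> 0).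
pose P u := (u \in V) && (ninv v < ninv u)%N.
have Hu u : exists f, P u -> C f /\ forall w, w \in V -> eps w f = (w == u)%:R.
  have [/andP[uV lt]|nP] := boolP (P u); last by exists (fun=> 0).
  have [|f fP] := IH (ninv w0 - ninv u)%N _ u erefl; last by exists f => _; apply: fP.
  have [uY _] := min_reps_inP uV; have le := ninv_le_longest hPi hY hw0 uY.
  by rewrite -vn ltn_sub2l // (leq_trans lt).
pose b u := projT1 (cid (Hu u)).
have bP u : P u -> C (b u) /\ forall w, w \in V -> eps w (b u) = (w == u)%:R.
  exact: (projT2 (cid (Hu u))).
have [f Cf [f0 [_ [c ic cE]]]] := schubert vV.
pose g x := f x + \sum_(u | P u) (- eps u f) * b u x.
have Cg : C g.
  apply: C_sum => // u Pu; have [Cb _] := bP u Pu; split=> //; apply: intQN.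
  have /andP[uV _] := Pu; have [uY _] := min_reps_inP uV.
  by have [IY _ _] := hI uV; apply: (C_dual Cf).
have gE w : w \in V -> eps w g = if w == v then eps v f else 0.
  move=> wV; rewrite /g eps_sum.
  have -> : \sum_(u | P u) (- eps u f) * eps w (b u) = if P w then - eps w f else 0.
    have sE u : P u -> (- eps u f) * eps w (b u) = if u == w then - eps w f else 0.
      move=> Pu; have [_ ->] := bP u Pu => //; rewrite eq_sym.
      by case: eqP => [->|_]; rewrite ?mulr1 ?mulr0.
    rewrite (eq_bigr _ sE) -big_mkcondr /=; case: ifP => Pw.
      rewrite (big_pred1 w) // => u; rewrite /= andbC; case: eqP => // ->; exact: Pw.
    rewrite big_pred0 // => u; case: eqP => [->|_]; rewrite ?andbF //.
    by rewrite Pw.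
  have [->|wv] := eqVneq w v; first by rewrite /P ltnn andbF addr0.
  rewrite /P wV /=; case: ltnP => lt; first by rewrite subrr.
  by rewrite addr0 f0.
exists (fun w => 0 + c * g w) => _; split; first exact: C_comb.
move=> w wV; rewrite (eps_comb w (fun=> 0) g c) eps0 add0r gE //.
by case: eqP => _; rewrite ?mulr0 // mulrC cE.
Qed.

Lemma dual_expansion (b : W -> W -> Q) f : (forall v, v \in V ->
    right_inv (b v) /\ forall w, w \in V -> eps w (b v) = (w == v)%:R) ->
  right_inv f -> forall y, y \in WY -> f y = \sum_(v in V) eps v f * b v y.
Proof.
move=> bP fi y yY; apply/eqP; rewrite -subr_eq0; apply/eqP.
have -> : f y - \sum_(v in V) eps v f * b v y = f y + \sum_(v in V) (- eps v f) * b v y.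
  by rewrite -sumrN; congr (_ + _); apply: eq_bigr => v _; rewrite mulNr.
apply: (@eps_inj (fun y => f y + \sum_(v in V) (- eps v f) * b v y)) => // [w u wY uX|w wV].
  rewrite fi //; congr (_ + _); apply: eq_bigr => v vV.
  by have [-> ] := bP v vV.
rewrite eps_sum (bigD1 w) //= big1 => [|v /andP[vV vw]].
  by have [_ ->] := bP w wV; rewrite // eqxx mulr1 addr0 subrr.
by have [_ ->] := bP v vV; rewrite // eq_sym (negPf vw) mulr0.
Qed.

End DualBasis.

(** * Point functions in rank two *)

Section Squares.
Variables (A0 : comPzRingType) (P : A0 -> Prop) (G H : A0).
Hypotheses (PD : forall x y, P x -> P y -> P (x + y)).
Hypotheses (PM : forall x y, P x -> P y -> P (x * y)).
Hypotheses (PN : forall x, P x -> P (- x)) (PG : P G) (PH : P H).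

Lemma PB x y : P x -> P y -> P (x - y).
Proof. by move=> px py; apply: PD => //; apply: PN. Qed.

Local Ltac in_P := repeat (first [assumption | apply: PB | apply: PN | apply: PD | apply: PM]).

(* The GKM conditions on the four fixed points of a product of two projective
   lines with weights G and H. *)
Definition square (y1 y2 y3 y4 : A0) : Prop := exists A B C, [/\ P y1, P A, P B, P C &
  [/\ y2 = y1 - G * A, y3 = y1 - H * B & y4 = y1 - G * A - H * B + G * H * C]].

Lemma squareB y1 y2 y3 y4 z1 z2 z3 z4 : square y1 y2 y3 y4 -> square z1 z2 z3 z4 ->
  square (y1 - z1) (y2 - z2) (y3 - z3) (y4 - z4).
Proof.
move=> [A [B [C [ly lA lB lC [-> -> ->]]]]] [A' [B' [C' [lz lA' lB' lC' [-> -> ->]]]]].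
exists (A - A'), (B - B'), (C - C'); split; in_P.
by split; ring.
Qed.

Lemma squareM y1 y2 y3 y4 z1 z2 z3 z4 : square y1 y2 y3 y4 -> square z1 z2 z3 z4 ->
  square (y1 * z1) (y2 * z2) (y3 * z3) (y4 * z4).
Proof.
move=> [A [B [C [ly lA lB lC [-> -> ->]]]]] [A' [B' [C' [lz lA' lB' lC' [-> -> ->]]]]].
exists (A * z1 + y1 * A' - G * (A * A')), (B * z1 + y1 * B' - H * (B * B')),
  (y1 * C' + z1 * C + A * B' + A' * B - G * (A * C' + A' * C) - H * (B * C' + B' * C)
   + G * H * (C * C')); split; in_P.
by split; ring.
Qed.

Lemma square_inv x1 x2 x3 x4 y1 y2 y3 y4 : square x1 x2 x3 x4 ->
  P y1 -> P y2 -> P y3 -> P y4 ->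
  x1 * y1 = 1 -> x2 * y2 = 1 -> x3 * y3 = 1 -> x4 * y4 = 1 -> square y1 y2 y3 y4.
Proof.
move=> [A [B [C [lx lA lB lC [x2E x3E x4E]]]]] l1 l2 l3 l4 e1 e2 e3 e4.
have dinv (x y z t : A0) : x * y = 1 -> z * t = 1 -> y - t = (z - x) * (y * t).
  move=> xy zt; transitivity (y * (z * t) - t * (x * y)); last by ring.
  by rewrite xy zt !mulr1.
have d12 : y1 - y2 = - (G * A) * (y1 * y2) by rewrite (dinv _ _ _ _ e1 e2) x2E; ring.
have d13 : y1 - y3 = - (H * B) * (y1 * y3) by rewrite (dinv _ _ _ _ e1 e3) x3E; ring.
have d34 : y3 - y4 = - (G * (A - H * C)) * (y3 * y4).
  by rewrite (dinv _ _ _ _ e3 e4) x4E x3E; ring.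
have lx2 : P x2 by rewrite x2E; in_P.
(* This is (x3 x4 - x1 x2) / H, computed from x3 = x1 - H B and x4 = x2 - H (B - G C). *)
pose E := - (B * x2) - (B - G * C) * x1 + H * (B * (B - G * C)).
have lE : P E.
  by rewrite /E; in_P.
have d1234 : y1 * y2 - y3 * y4 = H * E * (y1 * y2 * (y3 * y4)).
  transitivity ((x3 * x4 - x1 * x2) * (y1 * y2 * (y3 * y4))).
    transitivity (x3 * y3 * (x4 * y4) * (y1 * y2) - x1 * y1 * (x2 * y2) * (y3 * y4)); last by ring.
    by rewrite e1 e2 e3 e4; ring.
  by congr (_ * _); rewrite /E x3E x4E x2E; ring.
exists (- A * (y1 * y2)), (- B * (y1 * y3)), (- (A * E * (y1 * y2 * (y3 * y4)) + C * (y3 * y4))).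
split; in_P.
split.
- by transitivity (y1 - (y1 - y2)); [ring | rewrite d12; ring].
- by transitivity (y1 - (y1 - y3)); [ring | rewrite d13; ring].
transitivity (y1 - (y1 - y3) - (y3 - y4)); first by ring.
rewrite d13 d34.
transitivity (y1 + H * B * (y1 * y3) + G * A * (y1 * y2) - G * A * (y1 * y2 - y3 * y4)
   - G * H * C * (y3 * y4)); first by ring.
by rewrite d1234; ring.
Qed.

(** No congruence between the z is asked for: a function supported at one corner satisfies the
    conditions as soon as its value there is divisible by G H. *)
Lemma square_div z1 z2 z3 z4 : P z1 -> P z2 -> P z3 -> P z4 ->
  square (G * H * z1) (G * H * z2) (G * H * z3) (G * H * z4).
Proof.
move=> l1 l2 l3 l4; exists (H * (z1 - z2)), (G * (z1 - z3)), (z1 - z2 - z3 + z4); split; in_P.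
by split; ring.
Qed.

(** Effect of an operator along the side G: v and v' stand for G / x_c and G / x_(-c), where c is
    the root of that side up to sign, and their sum is divisible by G. *)
Lemma square_side1 v v' h A C : P v -> P h -> P A -> P C -> v + v' = G * h ->
  square (v * A) (- v' * A) (v * (A - H * C)) (- v' * (A - H * C)).
Proof.
move=> iv ih lA lC vE; have -> : v' = G * h - v by rewrite -vE; ring.
exists (h * A), (v * C), (h * C); split; in_P.
by split; ring.
Qed.

Lemma square_side2 v v' h B C : P v -> P h -> P B -> P C -> v + v' = H * h ->
  square (v * B) (v * (B - G * C)) (- v' * B) (- v' * (B - G * C)).
Proof.
move=> iv ih lB lC vE; have -> : v' = H * h - v by rewrite -vE; ring.
exists (v * C), (h * B), (h * C); split; in_P.
by split; ring.
Qed.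

End Squares.

Section Retraction.
Variables (L : zmodType) (D : root_datum L) (a b : root_type D).

(** The projection of L along g when u a^\vee (g) + v b^\vee (g) = 1. *)
Definition retraction (g : L) (u v : int) (l : L) : L :=
  l - g *~ (u * coroot a l + v * coroot b l).

Lemma retraction_additive g u v : zmod_morphism (retraction g u v).
Proof.
move=> l m; rewrite /retraction !raddfB /=.
have -> : u * (coroot a l - coroot a m) + v * (coroot b l - coroot b m) =
  (u * coroot a l + v * coroot b l) - (u * coroot a m + v * coroot b m) by ring.
rewrite mulrzBr; move: (g *~ _) (g *~ _) => x y.
by rewrite !opprD !opprK addrACA.
Qed.
HB.instance Definition _ g u v := GRing.isZmodMorphism.Build L L
  (retraction g u v) (retraction_additive g u v).
End Retraction.

(* Pairs of integers are coordinates with respect to two simple roots a and b, and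
   p, q are the Cartan integers of (a^\vee, b) and (b^\vee, a). *)
Section RankTwoTables.
Variables p q : int.
Implicit Types r : int * int.

Definition refl1 r : int * int := (- r.1 - p * r.2, r.2).
Definition refl2 r : int * int := (r.1, - r.2 - q * r.1).

Definition id_mat : (int * int) * (int * int) := ((1, 0), (0, 1)).
Definition mat_step1 (M : (int * int) * (int * int)) := (- M.1, M.2 - M.1 *~ p).
Definition mat_step2 (M : (int * int) * (int * int)) := (M.1 - M.2 *~ q, - M.2).
Definition mat_app (M : (int * int) * (int * int)) r := M.1 *~ r.1 + M.2 *~ r.2.

(** Each round multiplies by a simple reflection on the right, so the elements of length at most n
    are reached. In each type below n is the length of the longest element. *)
Definition mats n := iter n
  (fun s => undup (s ++ [seq mat_step1 M | M <- s] ++ [seq mat_step2 M | M <- s])) [:: id_mat].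

Definition mats_closed Ms :=
  (id_mat \in Ms) && all (fun M => (mat_step1 M \in Ms) && (mat_step2 M \in Ms)) Ms.

(** A triple (l, m, e) stands for the function w |-> x_((l - w m) / d), with value x_e at 1; the
    divisibilities say that the two simple coroots take integral values on m / d. Such a factor
    vanishes at w when l = w m. *)
Definition factor_ok (d : nat) (Fa : (int * int) * (int * int) * (int * int)) :=
  let: (l, m, e) := Fa in
  [&& l - m == e *+ d, (d%:Z %| 2 * m.1 + p * m.2)%Z & (d%:Z %| q * m.1 + 2 * m.2)%Z].

Definition factors_vanish (Fs : seq ((int * int) * (int * int) * (int * int)))
    (Ms : seq ((int * int) * (int * int))) :=
  all (fun M => (M == id_mat) || has (fun Fa => Fa.1.1 == mat_app M Fa.1.2) Fs) Ms.

(** By the fourth condition the list contains all positive roots of the plane, by the fifth each of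
    its members is one; both follow by induction on the height. *)
Definition pos_roots_ok (Rs : seq (int * int)) :=
  [&& uniq Rs, ((1, 0) \in Rs), ((0, 1) \in Rs),
   all (fun r => [&& 0 <= r.1, 0 <= r.2, (r == (1, 0)) || (refl1 r \in Rs) &
                    (r == (0, 1)) || (refl2 r \in Rs)]) Rs &
   all (fun r => [|| r == (1, 0), r == (0, 1),
         (refl1 r \in Rs) && (`|(refl1 r).1| + `|(refl1 r).2| < `|r.1| + `|r.2|)%N |
         (refl2 r \in Rs) && (`|(refl2 r).1| + `|(refl2 r).2| < `|r.1| + `|r.2|)%N]) Rs].

End RankTwoTables.

Lemma mulrz_Mn (V : zmodType) (x : V) (k : int) d : x *~ (k *+ d) = x *~ k *+ d.
Proof. by rewrite -mulr_natr natz mulrzA -pmulrn. Qed.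

Lemma pair_mulrz (U V : zmodType) (x : U) (y : V) n : (x, y) *~ n = (x *~ n, y *~ n).
Proof.
have pairMn k : (x, y) *+ k = (x *+ k, y *+ k).
  by elim: k => [//|k IH]; rewrite !mulrS IH.
by case: n => n; rewrite ?NegzE ?mulrNz -!pmulrn pairMn.
Qed.

Section WeightMap.
Variables (L : zmodType) (D : root_datum L).
Local Notation T := (root_type D).

(** The second coordinate is a formal point whose image n = nu (w) depends on w. The rule nu (w s_a)
    = nu (w) + k w (a) is encoded in [weight_refl], so that w |-> x_(nu w) becomes an instance of
    [dual_on_points]. *)
Definition weight_map (w : weyl D) (n : L) (x : L * int) : L := w x.1 + n *~ x.2.

Lemma weight_map_additive w n : zmod_morphism (weight_map w n).
Proof.
move=> x y; rewrite /weight_map /= raddfB mulrzBr opprD !addrA; congr (_ + _).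
by rewrite addrAC.
Qed.
HB.instance Definition _ w n := GRing.isZmodMorphism.Build (L * int)%type L
  (weight_map w n) (weight_map_additive w n).

Definition weight_refl (a : T) (k : int) (x : L * int) : L * int :=
  (weyl_reflection a x.1 + val a *~ (k * x.2), x.2).

Lemma weight_refl_additive a k : zmod_morphism (weight_refl a k).
Proof.
move=> x y; have E : weyl_reflection a (x.1 - y.1) + val a *~ (k * (x.2 - y.2)) =
    (weyl_reflection a x.1 + val a *~ (k * x.2)) - (weyl_reflection a y.1 + val a *~ (k * y.2)).
  have -> : weyl_reflection a (x.1 - y.1) = weyl_reflection a x.1 - weyl_reflection a y.1.
    exact: raddfB.
  rewrite mulrBr mulrzBr; move: (weyl_reflection a x.1) (weyl_reflection a y.1) => A B.
  by rewrite opprD addrACA.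
exact: (congr2 pair E erefl).
Qed.
HB.instance Definition _ a k := GRing.isZmodMorphism.Build (L * int)%type (L * int)%type
  (weight_refl a k) (weight_refl_additive a k).
End WeightMap.

(** * Rank two: point functions as products of weight functions *)

Section RankTwo.
Variables (R : comNzRingType) (F : formal_group_law R).
Variables (L : zmodType) (D : root_datum L) (Pi : {set root_type D}).
Hypothesis hPi : simple_system Pi.
Hypothesis hreg : forall a : root_type D, GRing.lreg (x_root F a).
Local Notation W := (weyl D).
Local Notation T := (root_type D).
Local Notation Q := (fga_loc F D).
Local Notation s_ := (@weyl_reflection L D).
Local Notation toQ := (@to_loc R F L D).
Local Notation xq := (@xq R F L D).
Local Notation xi := (@xi R F L D).
Local Notation word := (@weyl_word L D).
Local Notation xv := (fun l : L => toQ (fga_var F l)).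
Implicit Types (w v u : W) (f g : W -> Q) (X : {set T}).

(* The functions w |-> x_((lam - w mu) / d), for mu / d an integral weight. *)
Lemma dual_on_weight X (lam mu e : L) (d : nat) : (0 < d)%N -> lam - mu = e *+ d ->
    (forall a, a \in X -> exists n : int, coroot a mu = n *+ d) ->
  exists nu : W -> L, (forall w, w \in parabolic X -> nu w *+ d = lam - w mu) /\
    dual_on X (fun w => xv (nu w)).
Proof.
move=> d0 lmE hmu.
have nuP w : exists n : L, w \in parabolic X -> n *+ d = lam - w mu.
  have [wX|_] := boolP (w \in parabolic X); last by exists 0.
  suff [n nE] : exists n : L, n *+ d = lam - w mu by exists n.
  have [s sX <-] := parabolic_word wX; elim/last_ind: s sX => [|s a IH].
    by move=> _; exists e; rewrite word_nil lmE.
  rewrite all_rcons word_rcons => /andP[aX /IH[n nE]].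
  have [k kE] := hmu a aX; exists (n + word s (val a) *~ k).
  rewrite mulrnDl nE weylM weyl_reflectionE raddfB /= raddfMz /= kE.
  by rewrite opprB addrA addrAC mulrz_Mn addrC addrA [_ *+ _ + _]addrC.
pose nu w := projT1 (cid (nuP w)); exists nu.
have nuE w : w \in parabolic X -> nu w *+ d = lam - w mu by apply: (projT2 (cid (nuP w))).
split=> //.
have kP a : exists k : int, a \in X -> coroot a mu = k *+ d.
  have [aX|_] := boolP (a \in X); last by exists 0.
  by have [k kE] := hmu a aX; exists k.
pose k a := projT1 (cid (kP a)).
have kE a : a \in X -> coroot a mu = k a *+ d by apply: (projT2 (cid (kP a))).
have nu_step a w : a \in X -> w \in parabolic X -> nu (w * s_ a)%g = nu w + w (val a) *~ k a.
  move=> aX wX; apply/eqP; rewrite -subr_eq0; apply/eqP/(lattice_torsion_free D d0).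
  rewrite mulrnBl mulrnDl !nuE ?groupM ?mem_refl //.
  rewrite weylM weyl_reflectionE raddfB /= raddfMz /= kE //.
  rewrite mulrz_Mn opprB; set x := _ *+ d; set y := w mu.
  by rewrite addrA addrAC subrr.
have := @dual_on_points R F L D X (L * int)%type (fun w => weight_map w (nu w))
  (fun a => weight_refl a (k a)) (fun a => (val a, 0)) (fga_var F ((0, 1) : L * int)).
have -> : (fun w => toQ (fga_map (weight_map w (nu w)) (fga_var F (0, 1)))) = fun w => xv (nu w).
  by apply: funext => w; rewrite fga_map_var /= /weight_map /= raddf0 add0r.
apply.
- move=> a aX [l m]; exists (- coroot a l + k a * m).
  rewrite pair_mulrz mul0rz /weight_refl.
  apply: (congr2 pair); last by rewrite /= addr0.
  by rewrite -[(l, m).1]/l -[(l, m).2]/m weyl_reflectionE mulrzDr mulrNz addrA.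
- by move=> a w aX wX; rewrite /= /weight_map /= mulr0z addr0.
- move=> a w [l m] aX wX.
  transitivity (w (s_ a l) + (nu w + w (val a) *~ k a) *~ m); first by rewrite -nu_step.
  transitivity (w (s_ a l + val a *~ (k a * m)) + nu w *~ m); last by [].
  have -> : w (s_ a l + val a *~ (k a * m)) = w (s_ a l) + w (val a) *~ (k a * m).
    by rewrite raddfD raddfMz.
  by rewrite mulrzDl mulrzA addrA addrAC.
Qed.

Variables a b : T.
Hypotheses (aPi : a \in Pi) (bPi : b \in Pi) (ab : a != b).
Local Notation Y := [set a; b].
Local Notation p := (coroot a (val b)).
Local Notation q := (coroot b (val a)).

Lemma Y_sub : Y \subset Pi.
Proof. by apply/subsetP => c; rewrite !inE => /orP[] /eqP ->. Qed.

Definition lin (r : int * int) : L := val a *~ r.1 + val b *~ r.2.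

Lemma lin_additive : zmod_morphism lin.
Proof. by move=> r s; rewrite /lin /= !mulrzBr opprD addrACA. Qed.
HB.instance Definition _ := GRing.isZmodMorphism.Build (int * int)%type L lin lin_additive.

Lemma sumY (c : T -> L) : \sum_(x in Y) c x = c a + c b.
Proof.
rewrite (bigD1 a) ?inE ?eqxx //= (big_pred1 b) // => x; rewrite !inE.
by have [->|] := eqVneq x a; rewrite ?(negPf ab) //= andbT.
Qed.

Lemma lin_inj : injective lin.
Proof.
suff H r : lin r = 0 -> r = 0.
  by move=> r s E; apply/eqP; rewrite -subr_eq0; apply/eqP/H; rewrite raddfB /= E subrr.
move=> r0; pose c (x : T) : int := if x == a then r.1 else if x == b then r.2 else 0.
have c0 : \sum_(x in Pi) val x *~ c x = 0.
  rewrite (big_setID Y) /= (setIidPr Y_sub) [X in _ + X]big1 ?addr0 => [|x].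
    by rewrite sumY /c eqxx eq_sym (negPf ab) eqxx.
  by rewrite !inE negb_or /c => /andP[/andP[/negPf-> /negPf->] _]; rewrite mulr0z.
have ca := hPi.1 c c0 a aPi; have cb := hPi.1 c c0 b bPi.
move: ca cb; rewrite /c eqxx [b == a]eq_sym (negPf ab) eqxx.
by case: r {r0 c c0} => r1 r2 /= -> ->.
Qed.

Lemma coroot_a_lin r : coroot a (lin r) = 2 * r.1 + p * r.2.
Proof. by rewrite raddfD /= !raddfMz /= coroot_self !mulrzz. Qed.

Lemma coroot_b_lin r : coroot b (lin r) = q * r.1 + 2 * r.2.
Proof. by rewrite raddfD /= !raddfMz /= coroot_self !mulrzz. Qed.

Lemma s_a_lin r : s_ a (lin r) = lin (refl1 p r).
Proof.
rewrite weyl_reflectionE coroot_a_lin {1}/lin addrAC -mulrzBr /lin.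
by congr (_ *~ _ + _); rewrite /refl1 /=; ring.
Qed.

Lemma s_b_lin r : s_ b (lin r) = lin (refl2 q r).
Proof.
rewrite weyl_reflectionE coroot_b_lin {1}/lin -addrA -mulrzBr /lin.
by congr (_ + _ *~ _); rewrite /refl2 /=; ring.
Qed.

Lemma lin10 : lin (1, 0) = val a. Proof. by rewrite /lin /= mulr0z addr0. Qed.
Lemma lin01 : lin (0, 1) = val b. Proof. by rewrite /lin /= mulr0z add0r. Qed.

Definition has_mat w (M : (int * int) * (int * int)) : Prop :=
  w (val a) = lin M.1 /\ w (val b) = lin M.2.

Lemma has_mat_app w M r : has_mat w M -> w (lin r) = lin (mat_app M r).
Proof.
move=> [wa wb]; have -> : w (lin r) = w (val a) *~ r.1 + w (val b) *~ r.2.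
  by rewrite /lin raddfD !raddfMz.
by rewrite wa wb /mat_app raddfD !raddfMz.
Qed.

Lemma weylBMz w l m n : w (l - m *~ n) = w l - w m *~ n.
Proof. by rewrite raddfB raddfMz. Qed.

Lemma linBMz r r' n : lin (r - r' *~ n) = lin r - lin r' *~ n.
Proof. by rewrite raddfB raddfMz. Qed.

Lemma subMz2 (l : L) : l - l *~ 2 = - l.
Proof. by rewrite -{1}[l]mulr1z -mulrzBr (_ : 1 - 2 = - 1 :> int) // mulrNz mulr1z. Qed.

Lemma mats_complete Ms w : mats_closed p q Ms -> w \in parabolic Y ->
  exists2 M, M \in Ms & has_mat w M.
Proof.
move=> /andP[id_in /allP cl] /parabolic_word[s sY <-].
elim/last_ind: s sY => [|s c IH].
  move=> _; exists id_mat => //; rewrite word_nil; split; first by rewrite lin10.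
  by rewrite lin01.
rewrite all_rcons word_rcons => /andP[cY /IH[M MMs [Ma Mb]]].
have /andP[M1 M2] := cl M MMs.
move: cY; rewrite /= !inE => /orP[] /eqP ->.
  exists (mat_step1 p M) => //; split; rewrite weylM weyl_reflectionE weylBMz.
    by rewrite Ma coroot_self subMz2 raddfN.
  by rewrite Ma Mb linBMz.
exists (mat_step2 q M) => //; split; rewrite weylM weyl_reflectionE weylBMz.
  by rewrite Ma Mb linBMz.
by rewrite Mb coroot_self subMz2 raddfN.
Qed.

Lemma mat_id_eq1 w : w \in parabolic Y -> has_mat w id_mat -> w = 1%g.
Proof.
move=> wY [wa wb]; apply: (pos_parabolic1 hPi Y_sub wY) => c; rewrite !inE.
have e c' : w (val c') = val c' -> weyl_root w c' = c' by move=> E; apply: val_inj.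
by case/orP=> /eqP ->; rewrite e ?posb_simple // ?wa ?wb ?lin10 ?lin01.
Qed.

(** The product of the weight functions does it: each w != 1 makes one factor equal to x_0 = 0. *)
Lemma dual_on_factors Ms d Fs : (0 < d)%N -> mats_closed p q Ms ->
    all (factor_ok p q d) Fs -> factors_vanish Fs Ms ->
  dual_on Y (fun w => if w == 1%g then \prod_(Fa <- Fs) xv (lin Fa.2) else 0).
Proof.
move=> d0 cl ok /allP van.
suff [f [df f1 f0]] : exists f, [/\ dual_on Y f, f 1%g = \prod_(Fa <- Fs) xv (lin Fa.2) &
    forall w M, w \in parabolic Y -> has_mat w M ->
      has (fun Fa => Fa.1.1 == mat_app M Fa.1.2) Fs -> f w = 0].
  apply: dual_on_ext df => w wY /=; case: eqP => [->//|w1].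
  have [M MMs wM] := mats_complete cl wY; apply: (f0 w M) => //.
  have /orP[/eqP Mid|//] := van M MMs.
  by case: w1; apply: mat_id_eq1 => //; rewrite -Mid.
elim: Fs ok {van} => [|[[l m] e] Fs IH].
  move=> _; exists (fun=> 1); split=> //; first exact/dual_on_cst/intQ1.
  by rewrite big_nil.
move=> /= /andP[/and3P[/eqP lme dm1 dm2] /IH[f [df f1 f0]]].
have [||nu [nuE dnu]] := @dual_on_weight Y (lin l) (lin m) (lin e) d d0.
- by rewrite -raddfB lme raddfMn.
- move=> c; rewrite !inE => /orP[] /eqP ->; rewrite ?coroot_a_lin ?coroot_b_lin.
    by have /dvdzP[k ->] := dm1; exists k; rewrite -mulr_natr natz.
  by have /dvdzP[k ->] := dm2; exists k; rewrite -mulr_natr natz.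
exists (fun w => xv (nu w) * f w); split; first exact: dual_onM.
  rewrite f1 big_cons; congr (xv _ * _).
  apply/eqP; rewrite -subr_eq0; apply/eqP/(lattice_torsion_free D d0).
  by rewrite mulrnBl nuE ?group1 // -raddfMn -lme raddfB subrr.
move=> w M wY wM /= /orP[/eqP lE|hs]; last by rewrite (f0 w M) ?mulr0.
have -> : nu w = 0.
  by apply: (lattice_torsion_free D d0); rewrite nuE // (has_mat_app _ wM) -lE subrr.
by rewrite fga_var0 toQ0 mul0r.
Qed.

Lemma nonneg_comb_lin l : nonneg_comb Y l -> exists m n : nat, l = lin (m%:Z, n%:Z).
Proof. by move=> [c ->]; rewrite sumY; exists (c a), (c b); rewrite /lin /= !pmulrn. Qed.

Lemma refl1K : involutive (refl1 p).
Proof. by case=> r1 r2; rewrite /refl1 /=; congr (_, _); ring. Qed.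

Lemma refl2K : involutive (refl2 q).
Proof. by case=> r1 r2; rewrite /refl2 /=; congr (_, _); ring. Qed.

Definition pos_in (c : T) : bool := posb Pi c && (s_ c \in parabolic Y).

Lemma aY : a \in Y. Proof. by rewrite !inE eqxx. Qed.
Lemma bY : b \in Y. Proof. by rewrite !inE eqxx orbT. Qed.

Lemma pos_in_simple c : c \in Y -> pos_in c.
Proof. by move=> cY; rewrite /pos_in (posb_simple (subsetP Y_sub _ cY)) mem_refl. Qed.

Lemma pos_in_refl k c : k \in Y -> pos_in c -> c != k -> pos_in (weyl_root (s_ k) c).
Proof.
move=> kY /andP[pc cY] ck; rewrite /pos_in (reflection_pos hPi (subsetP Y_sub _ kY) pc ck) /=.
by have sk := mem_refl kY; rewrite weyl_reflection_conj groupMr ?groupV // groupMl.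
Qed.

Lemma pos_in_lin c : pos_in c -> exists m n : nat, val c = lin (m%:Z, n%:Z).
Proof.
move=> /andP[pc cY]; apply: nonneg_comb_lin; apply: (pos_int_comb hPi Y_sub pc).
exact: (reflection_int_comb hPi Y_sub).
Qed.

Lemma pos_roots_complete Rs c : pos_roots_ok p q Rs -> pos_in c ->
  exists2 r, r \in Rs & val c = lin r.
Proof.
move=> /and5P[_ R10 R01 /allP cl _] pc; have [m [n cE]] := pos_in_lin pc.
exists (m%:Z, n%:Z) => //.
move: {2}(m + n)%N (erefl (m + n)%N) => N.
elim/ltn_ind: N m n c cE pc => N IH m n c cE pc mn.
have cY : nonneg_comb Y (val c).
  have /andP[pc' cY] := pc; apply: (pos_int_comb hPi Y_sub pc').
  exact: (reflection_int_comb hPi Y_sub).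
have simple k r : val k = lin r -> k = c -> r = (m%:Z, n%:Z).
  by move=> kE kc; apply: lin_inj; rewrite -cE -kE kc.
have [k kY] := exists_pos_coroot cY; move: kY; rewrite !inE => /orP[] /eqP -> {k}.
  have [ca _|ca] := eqVneq c a.
    by rewrite -(simple a (1, 0)) ?lin10.
  rewrite cE coroot_a_lin /= => lt.
  have pc' := pos_in_refl aY pc ca; have [m' [n' c'E]] := pos_in_lin pc'.
  have E : (m'%:Z, n'%:Z) = refl1 p (m%:Z, n%:Z).
    by apply: lin_inj; rewrite -c'E -s_a_lin -cE.
  have E1 := congr1 fst E; have E2 := congr1 snd E; rewrite /refl1 /= in E1 E2.
  have := IH (m' + n')%N _ m' n' _ c'E pc' erefl; rewrite -mn => H.
  have lt' : (m' + n' < m + n)%N by clear - E1 E2 lt; move: (_ * n%:Z) E1 lt => pn E1 lt; lia.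
  have /cl/and4P[_ _ /orP[/eqP r1|rR] _] := H lt'; last by rewrite E refl1K in rR.
  have ca' : weyl_root (s_ a) c = a by apply: val_inj; rewrite c'E r1 lin10.
  have : posb Pi c by case/andP: pc.
  rewrite -[c](weyl_rootK (s_ a)) ca'.
  by rewrite weyl_reflectionV -[weyl_root _ a]/(root_opp a) posbN // posb_simple.
have [cb _|cb] := eqVneq c b.
  by rewrite -(simple b (0, 1)) ?lin01.
rewrite cE coroot_b_lin /= => lt.
have pc' := pos_in_refl bY pc cb; have [m' [n' c'E]] := pos_in_lin pc'.
have E : (m'%:Z, n'%:Z) = refl2 q (m%:Z, n%:Z).
  by apply: lin_inj; rewrite -c'E -s_b_lin -cE.
have E1 := congr1 fst E; have E2 := congr1 snd E; rewrite /refl2 /= in E1 E2.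
have := IH (m' + n')%N _ m' n' _ c'E pc' erefl; rewrite -mn => H.
have lt' : (m' + n' < m + n)%N by clear - E1 E2 lt; move: (_ * m%:Z) E2 lt => pn E2 lt; lia.
have /cl/and4P[_ _ _ /orP[/eqP r1|rR]] := H lt'; last by rewrite E refl2K in rR.
have cb' : weyl_root (s_ b) c = b by apply: val_inj; rewrite c'E r1 lin01.
have : posb Pi c by case/andP: pc.
rewrite -[c](weyl_rootK (s_ b)) cb'.
by rewrite weyl_reflectionV -[weyl_root _ b]/(root_opp b) posbN // posb_simple.
Qed.

Lemma lin_pos c (r : int * int) : val c = lin r -> 0 <= r.1 -> 0 <= r.2 -> posb Pi c.
Proof.
case: r => [[m|m] [n|n]] // cE _ _; apply/asboolP; rewrite cE /lin /= -!pmulrn.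
by apply: nonneg_combD; apply: nonneg_combMn; apply: nonneg_comb_self.
Qed.

Lemma pos_roots_sound Rs r : pos_roots_ok p q Rs -> r \in Rs ->
  exists2 c, pos_in c & val c = lin r.
Proof.
move=> /and5P[_ R10 R01 /allP cl /allP dec].
move: {2}(`|r.1| + `|r.2|)%N (erefl (`|r.1| + `|r.2|)%N) => N.
elim/ltn_ind: N r => N IH r rN rR.
have /and4P[r1 r2 _ _] := cl r rR.
have up k r' c : k \in Y -> val (weyl_root (s_ k) c) = lin r -> pos_in c -> r' = r ->
    exists2 c, pos_in c & val c = lin r.
  move=> kY E /andP[_ cY] _; exists (weyl_root (s_ k) c) => //.
  rewrite /pos_in (lin_pos E) //=.
  by have sk := mem_refl kY; rewrite weyl_reflection_conj groupMr ?groupV // groupMl.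
have /or4P[/eqP ->|/eqP ->|/andP[rR' lt]|/andP[rR' lt]] := dec r rR.
- by exists a; rewrite ?lin10 // pos_in_simple // aY.
- by exists b; rewrite ?lin01 // pos_in_simple // bY.
- have [|c pc cE] := IH _ _ (refl1 p r) erefl rR'; first by rewrite -rN.
  apply: (up a r c aY _ pc erefl).
  by rewrite -[LHS]/(s_ a (val c)) cE s_a_lin refl1K.
have [|c pc cE] := IH _ _ (refl2 q r) erefl rR'; first by rewrite -rN.
apply: (up b r c bY _ pc erefl).
by rewrite -[LHS]/(s_ b (val c)) cE s_b_lin refl2K.
Qed.

Lemma pos_roots_prod Rs w0 : pos_roots_ok p q Rs -> longest Pi Y w0 ->
  \prod_(c in inversions Pi w0) xq c = \prod_(r <- Rs) xv (lin r).
Proof.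
move=> ok lw0; rewrite (inv_longest hPi Y_sub lw0).
transitivity (\prod_(l <- [seq val c | c <- enum [set c | pos_in c]]) xv l).
  by rewrite big_map big_enum; apply: eq_bigl => c; rewrite !inE.
rewrite -(big_map lin xpredT xv); apply: perm_big; apply: uniq_perm.
- by rewrite map_inj_uniq ?enum_uniq //; apply: val_inj.
- by rewrite map_inj_uniq; [case/and5P: ok | apply: lin_inj].
move=> l; apply/mapP/mapP => [[c]|[r rR ->]].
  rewrite mem_enum inE => pc ->; have [r rR cE] := pos_roots_complete ok pc.
  by exists r.
have [c pc cE] := pos_roots_sound ok rR.
by exists c; rewrite ?mem_enum ?inE.
Qed.

Lemma dual_on_point_factors d Fs n w0 : (0 < d)%N -> mats_closed p q (mats p q n) ->
    all (factor_ok p q d) Fs -> factors_vanish Fs (mats p q n) ->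
    pos_roots_ok p q [seq Fa.2 | Fa <- Fs] -> longest Pi Y w0 ->
  dual_on Y (fun w => if w == 1%g then \prod_(c in inversions Pi w0) xq c else 0).
Proof.
move=> d0 cl ok van rok lw0; have := dual_on_factors d0 cl ok van.
by rewrite (pos_roots_prod rok lw0) big_map.
Qed.

Definition point_on_Y w0 :=
  dual_on Y (fun w => if w == 1%g then \prod_(c in inversions Pi w0) xq c else 0).

(** The weights of the vector representations of two copies of SL_2, times 2. *)
Lemma rank2_A1A1 w0 : p = 0 -> q = 0 -> longest Pi Y w0 -> point_on_Y w0.
Proof.
move=> pE qE; apply: (@dual_on_point_factors 2
  [:: ((1, 0), (-1, 0), (1, 0)); ((0, 1), (0, -1), (0, 1))] 2);
  by rewrite ?pE ?qE //; vm_compute.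
Qed.

(* The weights of the vector representation of SL_3, times 3. *)
Lemma rank2_A2 w0 : p = -1 -> q = -1 -> longest Pi Y w0 -> point_on_Y w0.
Proof.
move=> pE qE; apply: (@dual_on_point_factors 3
  [:: ((2, 1), (-1, 1), (1, 0)); ((2, 1), (-1, -2), (1, 1)); ((-1, 1), (-1, -2), (0, 1))] 3);
  by rewrite ?pE ?qE //; vm_compute.
Qed.

(* The weights of the vector representation of Sp_4, times 2. *)
Lemma rank2_B2 w0 : p = -2 -> q = -1 -> longest Pi Y w0 -> point_on_Y w0.
Proof.
move=> pE qE; apply: (@dual_on_point_factors 2
  [:: ((2, 1), (0, 1), (1, 0)); ((2, 1), (0, -1), (1, 1));
      ((2, 1), (-2, -1), (2, 1)); ((0, 1), (0, -1), (0, 1))] 4);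
  by rewrite ?pE ?qE //; vm_compute.
Qed.

(* The torsion index of G_2 is 2: the points of the seven-dimensional
   representation only give the multiple x_2a / x_a of the point function. *)
Definition G2_factors : seq ((int * int) * (int * int) * (int * int)) :=
  [:: ((1, 0), (-1, 0), (2, 0)); ((1, 1), (-1, 0), (2, 1)); ((2, 1), (1, 0), (1, 1));
      ((-1, 0), (-1, -1), (0, 1)); ((1, 0), (-2, -1), (3, 1)); ((1, 1), (-2, -1), (3, 2))].
Definition G2_roots : seq (int * int) := [:: (1, 0); (2, 1); (1, 1); (0, 1); (3, 1); (3, 2)].

Lemma G2_checks : [/\ mats_closed (-3) (-1) (mats (-3) (-1) 6),
  all (factor_ok (-3) (-1) 1) G2_factors, factors_vanish G2_factors (mats (-3) (-1) 6) &
  pos_roots_ok (-3) (-1) G2_roots].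
Proof. by split; vm_compute. Qed.

(** * Localization at a pair of orthogonal roots *)

Section LocalPair.
Variables (g1 g2 : T) (kappa : Q).
Hypotheses (kint : intQ kappa) (g12 : coroot g1 (val g2) = 0) (g21 : coroot g2 (val g1) = 0).
Hypotheses (g1Y : s_ g1 \in parabolic Y) (g2Y : s_ g2 \in parabolic Y).

(** The subring S[1/kappa] of Q; in the application kappa is the product of the x of the four
    positive roots other than g1 and g2. *)
Definition locQ (x : Q) : Prop := exists N, intQ (kappa ^+ N * x).

Lemma locQ_int x : intQ x -> locQ x.
Proof. by move=> ix; exists 0%N; rewrite mul1r. Qed.

Lemma locQD x y : locQ x -> locQ y -> locQ (x + y).
Proof.
move=> [m im] [n jn]; exists (m + n)%N; rewrite mulrDr exprD.
by apply: intQD; [rewrite mulrAC mulrC | rewrite -mulrA]; apply: intQM => //; apply: intQX.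
Qed.

Lemma locQM x y : locQ x -> locQ y -> locQ (x * y).
Proof. by move=> [m im] [n jn]; exists (m + n)%N; rewrite exprD mulrACA; apply: intQM. Qed.

Lemma locQN x : locQ x -> locQ (- x).
Proof. by move=> [m im]; exists m; rewrite mulrN; apply: intQN. Qed.

Local Notation G := (xq g1).
Local Notation H := (xq g2).

Lemma locG : locQ G. Proof. exact/locQ_int/intQ_xq. Qed.
Lemma locH : locQ H. Proof. exact/locQ_int/intQ_xq. Qed.

Local Notation squareQ := (square locQ G H).

Lemma square_char (s : fga F L) :
  squareQ (toQ s) (toQ (fga_act (s_ g1) s)) (toQ (fga_act (s_ g2) s))
    (toQ (fga_act (s_ g1 * s_ g2)%g s)).
Proof.
have [A AE] := fga_act_cong g1 s; have [B BE] := fga_act_cong g2 s.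
have [C CE] := fga_act_cong g1 B.
have g1g2 : weyl_root (s_ g1) g2 = g2.
  by apply: val_inj; rewrite -[LHS]/(s_ g1 (val g2)) weyl_reflectionE g12 mulr0z subr0.
have E : fga_act (s_ g1) s - fga_act (s_ g1 * s_ g2)%g s = x_root F g2 * (B - x_root F g1 * C).
  rewrite fga_actM -rmorphB BE rmorphM /= fga_act_root g1g2 -CE; congr (_ * _).
  by rewrite opprB addrC subrK.
exists (toQ A), (toQ B), (toQ C); split; try exact/locQ_int/intQ_toQ.
rewrite -!toQM -!toQB -toQD; split; congr toQ.
- by rewrite -AE opprB addrC subrK.
- by rewrite -BE opprB addrC subrK.
transitivity (s - (s - fga_act (s_ g1) s) - (fga_act (s_ g1) s - fga_act (s_ g1 * s_ g2)%g s)).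
  by ring.
by rewrite E AE; ring.
Qed.

(** The squares are orbits under left translation by s_g1 and s_g2, because f (w s_k) = f (s_c w)
    for c = w (k): the operator B_k divides by x_c a difference along the reflection in c itself. *)
Definition square_fun f : Prop := forall w, w \in parabolic Y ->
  squareQ (f w) (f (s_ g1 * w)%g) (f (s_ g2 * w)%g) (f (s_ g1 * s_ g2 * w)%g).

Hypothesis hloc : forall c, s_ c \in parabolic Y -> c \notin [:: g1; root_opp g1; g2; root_opp g2] ->
  locQ (xi c).

Lemma g1g2_root : weyl_root (s_ g1) g2 = g2.
Proof. by apply: val_inj; rewrite -[LHS]/(s_ g1 (val g2)) weyl_reflectionE g12 mulr0z subr0. Qed.
Lemma g2g1_root : weyl_root (s_ g2) g1 = g1.
Proof. by apply: val_inj; rewrite -[LHS]/(s_ g2 (val g1)) weyl_reflectionE g21 mulr0z subr0. Qed.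

Lemma g12_comm : (s_ g1 * s_ g2 = s_ g2 * s_ g1)%g.
Proof.
have := weyl_reflection_conj (s_ g1) g2; rewrite g1g2_root weyl_reflectionV => E.
by rewrite {2}E mulgKs.
Qed.

Lemma refl_left w c : (w * s_ c)%g = (s_ (weyl_root w c) * w)%g.
Proof. by rewrite weyl_reflection_conj mulgKV. Qed.

Lemma corner_roots_stable d c : d \in [:: g1; g2] ->
  (weyl_root (s_ d) c \in [:: g1; root_opp g1; g2; root_opp g2]) =
  (c \in [:: g1; root_opp g1; g2; root_opp g2]).
Proof.
move=> dg; have self (u : T) : weyl_root (s_ u) u = root_opp u by [].
have imp e : e \in [:: g1; root_opp g1; g2; root_opp g2] ->
    weyl_root (s_ d) e \in [:: g1; root_opp g1; g2; root_opp g2].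
  move: dg; rewrite !inE => /orP[] /eqP -> /or4P[] /eqP ->;
    rewrite ?weyl_root_opp ?self ?g1g2_root ?g2g1_root ?root_oppK eqxx ?orbT //.
apply/idP/idP => [/imp|]; last exact: imp.
by rewrite -weyl_rootM weyl_reflection_sqr weyl_root1.
Qed.

(** Let c = w (k). Either x_c is invertible in S[1/kappa], and 1/x_c satisfies the congruences along
    with x_c; or c is g1 or g2 up to sign, and B_k takes differences along a side of the square. *)
Lemma square_fun_dmz k f : k \in Y -> square_fun f -> square_fun (dmz k f).
Proof.
move=> kY sf w wY; set c := weyl_root w k.
have kc v : weyl_root v c = weyl_root (v * w)%g k by rewrite weyl_rootM.
have refl_in v : v \in parabolic Y -> s_ (weyl_root v k) \in parabolic Y.
  by move=> vY; rewrite weyl_reflection_conj groupMr ?groupV // groupMl ?mem_refl.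
have wk : (w * s_ k)%g = (s_ c * w)%g by rewrite refl_left.
have side_unit (u d : T) : d \in [:: u; root_opp u] ->
    intQ (xq u * xi d) /\ exists2 h, intQ h & xq u * xi d + xq u * xi (root_opp d) = xq u * h.
  move=> dE; split; last first.
    by exists (xi d + xi (root_opp d)); [exact: intQ_xi_opp | rewrite mulrDr].
  move: dE; rewrite !inE => /orP[] /eqP ->; first by rewrite xqK; apply: intQ1.
  by have [] := unitQ_opp' hreg u.
have g1w : (s_ g1 * w)%g \in parabolic Y by rewrite groupM.
have g2w : (s_ g2 * w)%g \in parabolic Y by rewrite groupM.
have g12w : (s_ g1 * s_ g2 * w)%g \in parabolic Y by rewrite !groupM.
have [lD [lM [lN [lG lH]]]] := (locQD, (locQM, (locQN, (locG, locH)))).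
have [cin|cnot] := boolP (c \in [:: g1; root_opp g1; g2; root_opp g2]); last first.
  have sh : squareQ (f w - f (w * s_ k)%g) (f (s_ g1 * w)%g - f (s_ g1 * w * s_ k)%g)
      (f (s_ g2 * w)%g - f (s_ g2 * w * s_ k)%g)
      (f (s_ g1 * s_ g2 * w)%g - f (s_ g1 * s_ g2 * w * s_ k)%g).
    apply: squareB => //; first exact: sf.
    by have := sf (w * s_ k)%g; rewrite !mulgA; apply; rewrite groupM ?mem_refl.
  apply: squareM sh => //.
  have lxi v : v \in parabolic Y ->
      weyl_root v k \notin [:: g1; root_opp g1; g2; root_opp g2] -> locQ (xi (weyl_root v k)).
    by move=> vY; apply: hloc; apply: refl_in.
  have := square_char (x_root F c); rewrite !fga_act_root !kc => sx.
  have st1 v : (weyl_root (s_ g1 * v)%g k \in [:: g1; root_opp g1; g2; root_opp g2]) =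
      (weyl_root v k \in [:: g1; root_opp g1; g2; root_opp g2]).
    by rewrite weyl_rootM corner_roots_stable ?inE ?eqxx.
  have st2 v : (weyl_root (s_ g2 * v)%g k \in [:: g1; root_opp g1; g2; root_opp g2]) =
      (weyl_root v k \in [:: g1; root_opp g1; g2; root_opp g2]).
    by rewrite weyl_rootM corner_roots_stable ?inE ?eqxx ?orbT.
  apply: (square_inv _ _ _ _ _ sx) => //; try exact: xqK.
  - exact: lxi.
  - by apply: lxi => //; rewrite st1.
  - by apply: lxi => //; rewrite st2.
  - by apply: lxi => //; rewrite -mulgA st1 st2.
have [A [B [C [lf lA lB lC [f2E f3E f4E]]]]] := sf w wY.
have reflk v : (v * s_ k)%g = (s_ (weyl_root v k) * v)%g by rewrite refl_left.
have dmzE v d : weyl_root v k = d -> dmz k f v = xi d * (f v - f (s_ d * v)%g).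
  by move=> dE; rewrite /dmz dE reflk dE.
have pair_case (d u : T) : d \in [:: u; root_opp u] -> s_ d = s_ u /\ weyl_root (s_ u) d = root_opp d.
  rewrite !inE => /orP[] /eqP ->; split=> //; first exact: reflection_opp.
  by rewrite weyl_root_opp.
move: cin; rewrite -[[:: g1; _; _; _]]/([:: g1; root_opp g1] ++ [:: g2; root_opp g2]) mem_cat.
case/orP=> cin; have [sc oc] := pair_case _ _ cin; have [iv [h ih vE]] := side_unit _ _ cin.
  have g2c : weyl_root (s_ g2) c = c.
    by move: cin; rewrite !inE => /orP[] /eqP ->; rewrite ?weyl_root_opp g2g1_root.
  rewrite (dmzE w c) // (dmzE (s_ g1 * w)%g (root_opp c)) -?kc // (dmzE (s_ g2 * w)%g c) -?kc //.
  rewrite (dmzE (s_ g1 * s_ g2 * w)%g (root_opp c)) -?kc ?weyl_rootM ?g2c //.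
  rewrite reflection_opp sc !mulgA weyl_reflection_sqr !mul1g f2E f3E f4E.
  have [liv lih] := (locQ_int iv, locQ_int ih).
  have : squareQ (G * xi c * A) (- (G * xi (root_opp c)) * A) (G * xi c * (A - H * C))
    (- (G * xi (root_opp c)) * (A - H * C)) by apply: square_side1 vE.
  congr (square _ _ _ _ _ _ _); ring.
have g1c : weyl_root (s_ g1) c = c.
  by move: cin; rewrite !inE => /orP[] /eqP ->; rewrite ?weyl_root_opp g1g2_root.
rewrite (dmzE w c) // (dmzE (s_ g1 * w)%g c) -?kc // (dmzE (s_ g2 * w)%g (root_opp c)) -?kc //.
rewrite (dmzE (s_ g1 * s_ g2 * w)%g (root_opp c)) -?kc ?weyl_rootM ?oc ?weyl_root_opp ?g1c //.
have g2sqr : (s_ g2 * s_ g1 * s_ g2)%g = s_ g1 by rewrite -g12_comm mulgKs.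
rewrite reflection_opp sc !mulgA weyl_reflection_sqr !mul1g g2sqr -g12_comm.
have [liv lih] := (locQ_int iv, locQ_int ih); rewrite f2E f3E f4E.
have : squareQ (H * xi c * B) (H * xi c * (B - G * C)) (- (H * xi (root_opp c)) * B)
  (- (H * xi (root_opp c)) * (B - G * C)) by apply: square_side2 vE.
congr (square _ _ _ _ _ _ _); ring.
Qed.

End LocalPair.

(** * Type G_2: elimination of denominators *)

Section G2.
Hypotheses (pE : p = -3) (qE : q = -1).
Local Notation xs r := (fga_var F (lin r)).
Local Notation retr r u v := (@retraction L D a b (lin r) u v).

Definition retraction_mat (g : int * int) (u v : int) (r : int * int) : int * int :=
  r - g *~ (u * (2 * r.1 - 3 * r.2) + v * (- r.1 + 2 * r.2)).

Lemma retraction_lin (g : int * int) (u v : int) (r : int * int) :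
  retr g u v (lin r) = lin (retraction_mat g u v r).
Proof.
rewrite /retraction coroot_a_lin coroot_b_lin pE qE linBMz; congr (_ - _ *~ _).
by ring.
Qed.

(** For t = 0 this says that s is regular; a second element t makes up for an s that need not be,
    such as x_(3a). *)
Definition jointly_regular (t s : fga F L) := forall z, t * z = 0 -> s * z = 0 -> z = 0.

(* The retraction kills g and is the identity modulo g, so its kernel in S is x_g S:
   x_g cancels from the denominator of e as soon as s and t, which also clear
   the denominator, have no common annihilator modulo x_g. *)
Lemma eliminate1 (g : int * int) (u v : int) (c : T) e (s t : fga F L) :
    val c = lin g -> retraction_mat g u v g = 0 ->
    intQ (toQ (xs g) * e) -> intQ (toQ s * e) -> intQ (toQ t * e) ->
    jointly_regular (fga_map (retr g u v) t) (fga_map (retr g u v) s) ->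
  intQ e.
Proof.
move=> cE g0 [s0 s0E] [s1 s1E] [t1 t1E] reg; set pi := fga_map (retr g u v) in reg.
have xg : x_root F c = xs g by rewrite /x_root cE.
have pi_g : pi (xs g) = 0.
  by rewrite /pi fga_map_var /= retraction_lin g0 raddf0 fga_var0.
have step r r' : toQ r * e = toQ r' -> pi r * pi s0 = 0.
  move=> rE; have : r * s0 = xs g * r'.
    by apply: (toQ_inj hreg); rewrite !toQM -s0E -rE mulrCA.
  by move/(congr1 pi); rewrite /pi !rmorphM [X in _ = X * _ -> _]pi_g mul0r.
have s00 : pi s0 = 0 by apply: reg; apply: step; [exact: t1E | exact: s1E].
have [|z zE] := @fga_map_cong _ F _ (retr g u v) (lin g) _ s0.
  by move=> l; eexists; rewrite /= /retraction -mulrNz.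
move: zE; rewrite -/pi s00 subr0 => zE; exists z.
have xi_c : xi c * toQ (xs g) = 1 by rewrite -xg xiK.
by rewrite -[e]mul1r -xi_c -mulrA s0E zE toQM mulrA xi_c mul1r.
Qed.

Lemma eliminate (g : int * int) (u v : int) (c : T) e (s t : fga F L) N :
    val c = lin g -> retraction_mat g u v g = 0 ->
    intQ (toQ (xs g) ^+ N * e) -> intQ (toQ s * e) -> intQ (toQ t * e) ->
    jointly_regular (fga_map (retr g u v) t) (fga_map (retr g u v) s) ->
  intQ e.
Proof.
move=> cE g0 + se te reg; elim: N => [|N IH]; first by rewrite mul1r.
rewrite exprS -mulrA => ge; apply: IH; apply: (eliminate1 cE g0 ge) reg.
  by rewrite mulrCA; apply: intQM => //; apply/intQX/intQ_toQ.
by rewrite mulrCA; apply: intQM => //; apply/intQX/intQ_toQ.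
Qed.

Lemma jointly_regularM (t s s' : fga F L) : jointly_regular t s -> jointly_regular t s' ->
  jointly_regular t (s * s').
Proof.
move=> rs rs' z tz; rewrite -mulrA => sz; apply: rs' => //; apply: rs => //.
by rewrite mulrCA tz mulr0.
Qed.

Lemma jointly_regularX (t s : fga F L) n : jointly_regular t s -> jointly_regular t (s ^+ n).
Proof.
move=> rs; elim: n => [|n IH]; first by move=> z _; rewrite mul1r.
by rewrite exprS; apply: jointly_regularM.
Qed.

Lemma jointly_regular_root (t : fga F L) (r : int * int) (c : T) : val c = lin r -> jointly_regular t (xs r).
Proof.
move=> cE z _ xz; apply: (hreg (a := c)).
by rewrite mulr0 /x_root cE.
Qed.

Lemma jointly_regularN (t : fga F L) (r : int * int) :
  jointly_regular t (xs r) -> jointly_regular t (xs (- r)).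
Proof.
move=> reg z tz nz; apply: reg => //; have [d dE] := fga_varN_dvd F (lin (- r)).
by rewrite -[r]opprK raddfN /= dE mulrAC nz mul0r.
Qed.

(** Chosen so that 1 - t is the quotient x_(2a) / x_a, which is 2 for the additive law. *)
Definition G2_t : fga F L := projT1 (cid (fga_varMz_cong F (lin (1, 0)) (lin (1, 0)) 1)).

Lemma lin_double (r : int * int) : lin r + lin r = lin (r + r).
Proof. by rewrite raddfD. Qed.

Lemma G2_tE : xs (2, 0) = xs (1, 0) * (1 - G2_t).
Proof.
rewrite /G2_t; case: cid => t /= tE; rewrite mulrBr mulr1 -tE.
rewrite -[_ *~ 1]/(lin (1, 0)) lin_double.
by rewrite opprB addrC subrK.
Qed.

(** By the formal group law x_(3a) is x_a modulo x_(2a) / x_a, and x_a is regular; for the additive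
    law this is the coprimality of 2 and 3. *)
Lemma jointly_regular_triple : jointly_regular (1 - G2_t) (xs (3, 0)).
Proof.
have [h hE] := fga_varD F (lin (2, 0)) (lin (1, 0)).
move: hE; rewrite -raddfD -[(2, 0) + (1, 0)]/((3, 0) : int * int) G2_tE => hE z tz xz.
apply: (hreg (a := a)); rewrite mulr0 /x_root -lin10 -[RHS]xz hE.
set t := 1 - G2_t in tz *.
transitivity (xs (1, 0) * z + xs (1, 0) * (t * z) * (1 + xs (1, 0) * h)); last by ring.
by rewrite tz; ring.
Qed.

Lemma G2_t_fixed (g : int * int) (u v : int) : retraction_mat g u v (1, 0) = (1, 0) ->
  fga_map (retr g u v) (1 - G2_t) = 1 - G2_t.
Proof.
move=> gE; apply: (hreg (a := a)); rewrite /x_root -lin10.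
have x1 : fga_map (retr g u v) (xs (1, 0)) = xs (1, 0).
  by rewrite fga_map_var /= retraction_lin gE.
rewrite -{1}x1 -rmorphM -G2_tE -[LHS]/(fga_map (retr g u v) (xs (2, 0))) fga_map_var.
have e1 : retr g u v (lin (1, 0)) = lin (1, 0) by rewrite retraction_lin gE.
congr (fga_var F _); rewrite -[(2, 0)]/((1, 0) + (1, 0) : int * int) -lin_double.
exact: (etrans (raddfD (retr g u v) _ _) (congr2 +%R e1 e1)).
Qed.

Variable w0 : W.
Hypothesis lw0 : longest Pi Y w0.
Let f w : Q := if w == 1%g then \prod_(c in inversions Pi w0) xq c else 0.
Local Notation xl r := (toQ (xs r)).

Lemma G2_ok : [/\ mats_closed p q (mats p q 6), all (factor_ok p q 1) G2_factors,
  factors_vanish G2_factors (mats p q 6) & pos_roots_ok p q G2_roots].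
Proof. by rewrite pE qE; apply: G2_checks. Qed.

Lemma f1E : f 1%g = \prod_(r <- G2_roots) xl r.
Proof. by rewrite /f eqxx; have [_ _ _ ok] := G2_ok; rewrite (pos_roots_prod ok lw0). Qed.

Lemma G2_double_point : dual_on Y (fun w => toQ (1 - G2_t) * f w).
Proof.
have [cl ok van rok] := G2_ok.
apply: dual_on_ext (dual_on_factors (isT : (0 < 1)%N) cl ok van) => w _.
have [->|w1] := eqVneq w 1%g; last by rewrite /f (negPf w1) mulr0.
rewrite f1E /G2_factors /G2_roots !big_cons !big_nil -[(_, _, (2, 0)).2]/((2, 0) : int * int).
by rewrite [X in X * _]/= G2_tE toQM /=; ring.
Qed.

(** The hypothesis on r and s is orthogonality for the invariant form scaled to (a, a) = 2, (a, b) =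
    - 3, (b, b) = 6. *)
Lemma G2_orthogonal (r s : int * int) (c d : T) : val c = lin r -> val d = lin s ->
    2 * r.1 * s.1 - 3 * (r.1 * s.2 + r.2 * s.1) + 6 * r.2 * s.2 = 0 ->
  coroot c (val d) = 0.
Proof.
move=> cE dE E; have c0 := wform_gt0 D (root_neq0 c).
suff B0 : wform D (val c) (val d) = 0.
  by apply: (mulIf (lt0r_neq0 c0)); rewrite coroot_wform B0 mulr0 mul0r.
have wformDl l m n : wform D (l + m) n = wform D l n + wform D m n.
  by rewrite wformC raddfD /= !(wformC _ n).
have wformMl l m (n : int) : wform D (l *~ n) m = wform D l m * n.
  by rewrite wformC raddfMz /= mulrzz wformC.
have wformMr l m (n : int) : wform D l (m *~ n) = wform D l m * n by rewrite raddfMz /= mulrzz.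
have := coroot_wform a (val b); have := coroot_wform b (val a).
rewrite pE qE [wform D (val b) (val a)]wformC => E1 E2.
rewrite cE dE /lin wformDl !raddfD /= !wformMl !wformMr [wform D (val b) (val a)]wformC.
move: E1 E2; move: (wform D (val b) (val b)) (wform D (val a) (val b)) => x y.
move: (wform D (val a) (val a)) => z E1 E2.
have -> : x = - 2 * y by lia.
suff : 2 * (z * r.1 * s.1 + y * r.1 * s.2 + (y * r.2 * s.1 + - 2 * y * r.2 * s.2)) = 0 by lia.
have : z * (2 * r.1 * s.1 - 3 * (r.1 * s.2 + r.2 * s.1) + 6 * r.2 * s.2) = 0 by rewrite E mulr0.
have [k [-> ->]] : exists k, z = 2 * k /\ y = - 3 * k by exists (y + 2 * z); lia.
move=> <-; ring.
Qed.

Lemma G2_pair_local (r1 r2 : int * int) others s : perm_eq [:: r1, r2 & others] G2_roots ->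
    2 * r1.1 * r2.1 - 3 * (r1.1 * r2.2 + r1.2 * r2.1) + 6 * r1.2 * r2.2 = 0 ->
    all (mem Y) s ->
  exists N, intQ ((\prod_(r <- others) xl r) ^+ N * dmzs s f 1%g).
Proof.
move=> pe orth sY; have [_ _ _ ok] := G2_ok.
have [|g1 /andP[_ g1Y] g1E] := pos_roots_sound ok (r := r1).
  by rewrite -(perm_mem pe) inE eqxx.
have [|g2 /andP[_ g2Y] g2E] := pos_roots_sound ok (r := r2).
  by rewrite -(perm_mem pe) !inE eqxx orbT.
have g12 := G2_orthogonal g1E g2E orth.
have g21 : coroot g2 (val g1) = 0.
  by apply: (G2_orthogonal g2E g1E); rewrite -[RHS]orth; ring.
set kappa := \prod_(r <- others) _.
have kint : intQ kappa by rewrite /kappa; apply: intQ_prod => r _; apply: intQ_toQ.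
have locr r c : r \in others -> val c = lin r -> locQ kappa (xi c).
  move=> ro cE; exists 1%N; rewrite expr1 /kappa (perm_big _ (perm_to_rem ro)) big_cons.
  have -> : xl r = xq c by rewrite /xq /x_root cE.
  by rewrite mulrAC xqK mul1r; apply: intQ_prod => t _; apply: intQ_toQ.
have inR (r : int * int) : (r \in G2_roots) = [|| r == r1, r == r2 | r \in others].
  by rewrite -(perm_mem pe) !inE.
have hpos c : pos_in c -> c \notin [:: g1; root_opp g1; g2; root_opp g2] -> locQ kappa (xi c).
  move=> cp; rewrite !inE !negb_or => /and4P[c1 _ c2 _].
  have [r rR cE] := pos_roots_complete ok cp; apply: (locr r) => //.
  move: rR; rewrite inR => /or3P[/eqP rE|/eqP rE|//].
    by case/eqP: c1; apply: val_inj; rewrite cE rE g1E.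
  by case/eqP: c2; apply: val_inj; rewrite cE rE g2E.
have hloc c : s_ c \in parabolic Y -> c \notin [:: g1; root_opp g1; g2; root_opp g2] ->
    locQ kappa (xi c).
  move=> cY cn; have [pc|nc] := boolP (posb Pi c); first by apply: hpos; rewrite // /pos_in pc.
  have -> : xi c = xi (root_opp c) * (xq (root_opp c) * xi c) by rewrite mulrA xiK mul1r.
  apply: locQM => //; last first.
    have [iu _] := unitQ_opp' hreg (root_opp c); rewrite root_oppK in iu.
    exact: locQ_int.
  apply: hpos; first by rewrite /pos_in (posbN hPi) nc reflection_opp.
  apply: contra cn; rewrite !inE !(can2_eq (@root_oppK _ D) (@root_oppK _ D)) !root_oppK.
  by case/or4P=> ->; rewrite ?orbT.
(* The point function is x_g1 x_g2 times a function supported at 1 with value kappa, so [square_div]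
   applies. *)
have init : square_fun g1 g2 kappa f.
  pose z w : Q := if w == 1%g then kappa else 0.
  have fz w : f w = xq g1 * xq g2 * z w.
    rewrite /z; case: eqP => [->|/eqP w1]; last by rewrite /f (negPf w1) mulr0.
    rewrite f1E -(perm_big _ pe) !big_cons /= -/kappa mulrA.
    by rewrite /xq /x_root g1E g2E.
  have lz w : locQ kappa (z w) by apply: locQ_int; rewrite /z; case: eqP => // _; apply: intQ0.
  move=> w _; rewrite !fz; apply: square_div => //;
    by [apply: locQD|apply: locQM|apply: locQN|apply: locG|apply: locH].
have : square_fun g1 g2 kappa (dmzs s f).
  elim: s sY => [//|k s IH] /= /andP[kY /IH]; exact: square_fun_dmz.
by case/(_ 1%g (group1 _)) => A [B [C [l1 _ _ _ _]]].
Qed.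

Definition G2_image (r : int * int) : bool := (r \in G2_roots) || (- r \in G2_roots).

Lemma jointly_regular_image (t : fga F L) r : G2_image r -> jointly_regular t (xs r).
Proof.
have [_ _ _ ok] := G2_ok; case/orP=> /(pos_roots_sound ok)[c _ cE].
  exact: jointly_regular_root cE.
by rewrite -[r]opprK; apply: jointly_regularN; apply: jointly_regular_root cE.
Qed.

Lemma G2_elim (t : fga F L) e (g : int * int) (u v : int) others M N :
    g \in G2_roots -> retraction_mat g u v g = 0 ->
    intQ (xl g ^+ N * e) -> intQ ((\prod_(r <- others) xl r) ^+ M * e) -> intQ (toQ t * e) ->
    (forall r, r \in others ->
       jointly_regular (fga_map (retr g u v) t) (xs (retraction_mat g u v r))) ->
  intQ e.
Proof.
move=> gR g0 ge oe te reg; have [_ _ _ ok] := G2_ok.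
have [c _ cE] := pos_roots_sound ok gR.
apply: (eliminate (s := (\prod_(r <- others) xs r) ^+ M) cE g0 ge _ te).
  by rewrite toQX toQ_prod.
rewrite rmorphXn rmorph_prod; apply: jointly_regularX.
elim: others reg {oe} => [|r others IH] reg; first by move=> z _; rewrite big_nil mul1r.
rewrite big_cons; apply: jointly_regularM; last by apply: IH => s so; apply: reg; rewrite inE so orbT.
rewrite -[X in jointly_regular _ X]/(fga_map _ (xs r)) fga_map_var.
rewrite -[X in fga_var F X]/(retr g u v (lin r)) retraction_lin.
by apply: reg; rewrite inE eqxx.
Qed.

Lemma rank2_G2 : point_on_Y w0.
Proof.
move=> s sY; set e := dmzs s _ _.
have te : intQ (toQ (1 - G2_t) * e) by have := G2_double_point sY; rewrite dmzsZ.
(* The three orthogonal pairs of positive roots, each made of a short and a long one; the list holds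
   the four roots that remain in the denominator. *)
have [M1 q1] := @G2_pair_local (1, 0) (3, 2) [:: (1, 1); (2, 1); (0, 1); (3, 1)] s isT erefl sY.
have [M2 q2] := @G2_pair_local (1, 1) (3, 1) [:: (1, 0); (3, 2); (2, 1); (0, 1)] s isT erefl sY.
have [M3 q3] := @G2_pair_local (2, 1) (0, 1) [:: (1, 0); (3, 2); (1, 1); (3, 1)] s isT erefl sY.
rewrite -/e in q1 q2 q3.
have intQ_insert x y z : intQ x -> intQ (y * z) -> intQ (y * (x * z)).
  by move=> ix iy; rewrite mulrCA; apply: intQM.
have ix r N : intQ (xl r ^+ N) by apply/intQX/intQ_toQ.
have t0 y : intQ (toQ 0 * y) by rewrite toQ0 mul0r; apply: intQ0.
have reg0 (t : fga F L) (g : int * int) (u v : int) (others : seq (int * int)) :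
    all (fun r => G2_image (retraction_mat g u v r)) others ->
    forall r, r \in others -> jointly_regular t (xs (retraction_mat g u v r)).
  by move=> /allP img r /img; apply: jointly_regular_image.
have regt (g : int * int) (u v : int) (others : seq (int * int)) : retraction_mat g u v (1, 0) = (1, 0) ->
    all (fun r => let r' := retraction_mat g u v r in
      [|| G2_image r', r' == (3, 0) | r' == (-3, 0)]) others ->
    forall r, r \in others ->
    jointly_regular (fga_map (retr g u v) (1 - G2_t)) (xs (retraction_mat g u v r)).
  move=> gE /allP img r /img; rewrite G2_t_fixed //; case/or3P=> [im|/eqP ->|/eqP ->].
  - exact: jointly_regular_image.
  - exact: jointly_regular_triple.
  exact: (jointly_regularN jointly_regular_triple).
(* By [q1] the denominator of e involves (1, 1), (2, 1), (0, 1) and (3, 1). They are removed in this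
   order, short roots first; e1 and e2 are e multiplied by the powers still to be removed. *)
set e1 := xl (0, 1) ^+ M1 * (xl (3, 1) ^+ M1 * e).
set e2 := xl (3, 1) ^+ M1 * e.
have me1 y : intQ (y * e) -> intQ (y * e1) by move=> iy; do 2![apply: (intQ_insert); first exact: ix].
have me2 y : intQ (y * e) -> intQ (y * e2) by move=> iy; apply: (intQ_insert); first exact: ix.
(* The form u a^\vee + v b^\vee is the first coordinate for (u, v) = (2, 3) and the second one for
   (1, 2), so g is killed. For the short roots g = (1, 1) and (2, 1) the four roots in the other
   denominator are mapped to roots, and t = 0 will do. *)
have i0 : intQ (xl (2, 1) ^+ M1 * e1).
  apply: (@G2_elim 0 _ (1, 1) 2 3 [:: (1, 0); (3, 2); (2, 1); (0, 1)] M2 M1 isT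
    erefl _ _ (t0 _) (reg0 _ (1, 1) 2 3 _ _)) => //.
    by move: q1; rewrite !big_cons big_nil mulr1 !exprMn -!mulrA.
  by rewrite mulrCA; apply: intQM => //; apply: me1.
have i1 : intQ e1.
  apply: (@G2_elim 0 _ (2, 1) 1 2 [:: (1, 0); (3, 2); (1, 1); (3, 1)] M3 M1 isT
    erefl i0 _ (t0 _) (reg0 _ (2, 1) 1 2 _ _)) => //.
  exact: me1.
(* Along the long roots (0, 1) and (3, 1) the other long roots are mapped to 3 a or - 3 a, where
   x_(3a) may be a zero divisor; here the multiple of the point function by 1 - t comes in. *)
have i2 : intQ e2.
  apply: (@G2_elim _ _ (0, 1) 1 2 [:: (1, 0); (3, 2); (1, 1); (3, 1)] M3 M1 isT
    erefl i1 _ _ (regt (0, 1) 1 2 _ _ _)) => //; exact: me2.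
exact: (@G2_elim _ _ (3, 1) 1 2 [:: (1, 0); (3, 2); (2, 1); (0, 1)] M2 M1 isT
    erefl i2 q2 te (regt (3, 1) 1 2 _ _ _)).
Qed.

End G2.
End RankTwo.

(** * Cartan integers of two simple roots *)

Section RankTwoPoint.
Variables (R : comNzRingType) (F : formal_group_law R).
Variables (L : zmodType) (D : root_datum L) (Pi : {set root_type D}).
Hypotheses (hPi : simple_system Pi) (hreg : forall a : root_type D, GRing.lreg (x_root F a)).
Local Notation T := (root_type D).
Local Notation W := (weyl D).
Local Notation Q := (fga_loc F D).
Local Notation s_ := (@weyl_reflection L D).
Local Notation xq := (xq F).
Local Notation xi := (xi F).
Implicit Types (a b c k : T) (u v w : W) (f g : W -> Q).

(** The root s_a (b) = b - a^\vee (b) a is positive, so its coefficient at a is not negative. *)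
Lemma coroot_simple_le0 a b : a \in Pi -> b \in Pi -> a != b -> coroot a (val b) <= 0.
Proof.
move=> aPi bPi ab; have pb := pos_in_simple aPi bPi (bY a b).
have ba : b != a by rewrite eq_sym.
have [m [n E]] := pos_in_lin hPi aPi bPi ab (pos_in_refl hPi aPi bPi (aY a b) pb ba).
have : lin a b (- coroot a (val b), 1) = lin a b (m%:Z, n%:Z).
  by rewrite -E -[RHS]/(s_ a (val b)) weyl_reflectionE /lin mulrNz mulr1z addrC.
by move/(lin_inj hPi aPi bPi ab)/(congr1 fst) => /=; lia.
Qed.

Lemma cartan_pairs a b : a \in Pi -> b \in Pi -> a != b ->
  let p := coroot a (val b) in let q := coroot b (val a) in
  [\/ p = 0 /\ q = 0, p = -1 /\ q = -1, p = -2 /\ q = -1 \/ p = -1 /\ q = -2 |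
      p = -3 /\ q = -1 \/ p = -1 /\ q = -3].
Proof.
move=> aPi bPi ab p q.
have p0 : p <= 0 by apply: coroot_simple_le0.
have q0 : q <= 0 by apply: coroot_simple_le0 => //; rewrite eq_sym.
have := coroot_wform a (val b); have := coroot_wform b (val a); rewrite -/p -/q.
rewrite [wform D (val b) (val a)]wformC.
have a0 := wform_gt0 D (root_neq0 a); have b0 := wform_gt0 D (root_neq0 b).
have wformBl l m n : wform D (l - m) n = wform D l n - wform D m n.
  by rewrite wformC raddfB /= !(wformC _ n).
have wformMl l m (n : int) : wform D (l *~ n) m = wform D l m * n.
  by rewrite wformC raddfMz /= mulrzz wformC.
have wformMr l m (n : int) : wform D l (m *~ n) = wform D l m * n.
  by rewrite raddfMz /= mulrzz.
(* This is (b, b) times the component of a orthogonal to b; its positive norm is the strict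
   Cauchy-Schwarz inequality, which gives p q < 4. *)
pose l := val a *~ wform D (val b) (val b) - val b *~ wform D (val a) (val b).
have l0 : l != 0.
  have -> : l = lin a b (wform D (val b) (val b), - wform D (val a) (val b)).
    by rewrite /lin /= mulrNz.
  rewrite -(raddf0 (lin a b)) (inj_eq (lin_inj hPi aPi bPi ab)).
  by apply/eqP => /(congr1 fst) /= E; rewrite E ltxx in b0.
have := wform_gt0 D l0; rewrite /l wformBl !raddfB /= !wformMl !wformMr.
rewrite [wform D (val b) (val a)]wformC.
move: a0 b0; move: (wform D (val a) (val a)) (wform D (val b) (val b)) (wform D (val a) (val b)).
move: p q p0 q0 => p q p0 q0 x z y x0 z0 H E1 E2.
have xz0 : 0 < x * z by apply: mulr_gt0.
have yy : y * y < x * z.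
  rewrite -subr_gt0 -(pmulr_rgt0 _ z0); apply: etrans H; congr (0 < _); ring.
have pq : p * q < 4.
  rewrite -(ltr_pM2r xz0); have -> : p * q * (x * z) = (p * x) * (q * z) by ring.
  by rewrite E1 E2; lia.
have [pz|pn] := eqVneq p 0.
  apply: Or41; split=> //; apply: (mulIf (lt0r_neq0 z0)).
  by rewrite E1 mul0r -E2 pz mul0r.
have [qz|qn] := eqVneq q 0.
  apply: Or41; split=> //; apply: (mulIf (lt0r_neq0 x0)).
  by rewrite E2 mul0r -E1 qz mul0r.
have p1 : p <= -1 by lia.
have q1 : q <= -1 by lia.
have p3 : -3 <= p by nia.
have q3 : -3 <= q by nia.
have : (p = -1 \/ p = -2 \/ p = -3) /\ (q = -1 \/ q = -2 \/ q = -3) by split; lia.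
case=> [[pE|[pE|pE]] [qE|[qE|qE]]]; rewrite pE qE in pq *; try by [].
- exact: Or42.
- by apply: Or43; right.
- by apply: Or44; right.
- by apply: Or43; left.
by apply: Or44; left.
Qed.

Lemma rank2_point a b w0 : a \in Pi -> b \in Pi -> a != b -> longest Pi [set a; b] w0 ->
  point_on_Y F Pi a b w0.
Proof.
move=> aPi bPi ab lw0; have ba : b != a by rewrite eq_sym.
have lw0' : longest Pi [set b; a] w0 by rewrite setUC.
have swap : point_on_Y F Pi b a w0 -> point_on_Y F Pi a b w0 by rewrite /point_on_Y setUC.
case: (cartan_pairs aPi bPi ab) => [[pE qE]|[pE qE]|[] [pE qE]|[] [pE qE]].
- exact: rank2_A1A1.
- exact: rank2_A2.
- exact: rank2_B2.
- by apply: swap; apply: rank2_B2.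
- exact: rank2_G2.
by apply: swap; apply: rank2_G2.
Qed.

End RankTwoPoint.

(** * Braid relations and normal forms *)

Section Expansion.
Variables (R : comNzRingType) (F : formal_group_law R).
Variables (L : zmodType) (D : root_datum L) (Pi : {set root_type D}).
Hypotheses (hPi : simple_system Pi) (hreg : forall a : root_type D, GRing.lreg (x_root F a)).
Local Notation T := (root_type D).
Local Notation W := (weyl D).
Local Notation S := (fga F L).
Local Notation Q := (fga_loc F D).
Local Notation toQ := (@to_loc R F L D).
Local Notation xq := (xq F).
Local Notation xi := (xi F).
Local Notation word := (@weyl_word L D).
Local Notation ninv := (ninv Pi).
Local Notation inversions := (inversions Pi).
Implicit Types (a b c k : T) (u v w y : W) (f g : W -> Q) (J K U : seq T) (X Y : {set T}).

Definition reduced_words (Y : {set T}) (I : W -> seq T) : Prop :=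
  forall w, w \in parabolic Y -> [/\ all (mem Y) (I w), word (I w) = w & size (I w) = ninv w].

Lemma reduced_words_exist Y : Y \subset Pi -> exists I, reduced_words Y I.
Proof.
move=> hY; have H w : exists s, w \in parabolic Y ->
    [/\ all (mem Y) s, word s = w & size s = ninv w].
  have [wY|_] := boolP (w \in parabolic Y); last by exists [::].
  by have [s sY [sw ss]] := parabolic_reduced_word hPi hY wY; exists s.
by exists (fun w => projT1 (cid (H w))) => w; apply: (projT2 (cid (H w))).
Qed.

Lemma min_reps_in0 Y : min_reps_in Pi Y set0 = parabolic Y.
Proof.
apply/setP => w; rewrite inE; case: (w \in parabolic Y) => //=.
by apply/(min_repsP hPi); [apply: sub0set | move=> a; rewrite inE].
Qed.

Lemma dmzs_at J f w : dmzs J f w = loc_act w (dmzs J (ltrans w f) 1%g).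
Proof. by rewrite dmzs_ltrans ltrans1. Qed.

Variable Y : {set T}.
Hypothesis hY : Y \subset Pi.
Variable I : W -> seq T.
Hypothesis hI : reduced_words Y I.
Variables (w0 : W) (p0 : Q) (pt : W -> Q).
Hypotheses (hw0 : longest Pi Y w0) (hpt : point Y w0 p0 pt) (dpt : dual_on Y pt).
Hypothesis hp0 : unitQ (p0 * \prod_(b in inversions w0^-1%g) xi b).

(** With a dual basis b_v the coefficient of B_(I_v) is B_J b_v (1): integral because b_v is dual,
    zero for v longer than J by its support, and given by a leading term for v as long as J. Left
    translation carries the expansion from 1 to w. *)
Lemma word_expansion J : all (mem Y) J -> exists t : W -> S, [/\
    forall f w, dmzs J f w = \sum_(v in parabolic Y) toQ (fga_act w (t v)) * dmzs (I v) f w,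
    forall v, v \in parabolic Y -> (size J < ninv v)%N -> t v = 0 &
    ninv (word J) = size J ->
      forall v, v \in parabolic Y -> ninv v = size J -> t v = (v == word J)%:R].
Proof.
move=> JY; have hI' w : w \in min_reps_in Pi Y set0 ->
    [/\ all (mem Y) (I w), word (I w) = w & size (I w) = ninv w].
  by rewrite min_reps_in0; apply: hI.
have [||||b] := @dual_basis R F L D Pi hPi Y hY set0 (sub0set _) I hI' w0 p0 hw0 hp0 pt hpt (dual_on Y).
- by move=> s sY; rewrite avg_set0 //; apply: dual_on_dmzs.
- exact/dual_on_cst/intQ0.
- by move=> f g c ic df dg; apply: dual_onD => //; apply: dual_onZ.
- by [].
rewrite min_reps_in0 => bP.
have inv0 f : right_inv Y set0 f.
  move=> w u _; rewrite /parabolic /= imset0 gen0 inE => /eqP ->; by rewrite mulg1.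
have b0 v z : v \in parabolic Y -> z \in parabolic Y -> (ninv z < ninv v)%N -> b v z = 0.
  move=> vY zY lt; have [_ be] := bP v vY.
  apply: (eps_inj_lt hPi hY (sub0set _) hI' (inv0 (b v)) _ zY lt) => w.
  rewrite min_reps_in0 => wY ltw; rewrite be //.
  by case: eqP ltw => // ->; rewrite ltnn.
have tP v : exists s : S, v \in parabolic Y -> dmzs J (b v) 1%g = toQ s.
  have [vY|_] := boolP (v \in parabolic Y); last by exists 0.
  by have [dbv _] := bP v vY; have [s sE] := dbv J JY; exists s.
pose t v := projT1 (cid (tP v)).
have tE v : v \in parabolic Y -> dmzs J (b v) 1%g = toQ (t v) by apply: (projT2 (cid (tP v))).
have expand f : dmzs J f 1%g = \sum_(v in parabolic Y) toQ (t v) * dmzs (I v) f 1%g.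
  have fE : {in parabolic Y, f =1 fun y => \sum_(v in parabolic Y) dmzs (I v) f 1%g * b v y}.
    move=> y yY; have := dual_expansion hPi hY (sub0set _) hI' _ (inv0 f) yY (b := b).
    rewrite min_reps_in0; apply => v vY; split; first exact: inv0.
    by have [_ be] := bP v vY; move=> w wY; apply: be.
  rewrite (dmzs_ext JY fE) ?group1 // dmzs_sum.
  by apply: eq_bigr => v vY; rewrite tE // mulrC.
exists t; split.
- move=> f w; rewrite dmzs_at expand loc_act_sum; apply: eq_bigr => v vY.
  by rewrite loc_actM loc_act_toQ -dmzs_at.
- move=> v vY lt; apply: (toQ_inj hreg); rewrite -tE // toQ0.
  by apply: (dmzs_supp hPi hY (k := ninv v)) => // [z|]; [apply: b0 | rewrite ninv1].
move=> Jr v vY vJ; apply: (toQ_inj hreg); rewrite -tE //.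
have wJ : word J \in parabolic Y by apply: word_parabolic.
have [IY IE Is] := hI wJ.
(* The leading term depends on K only through its length and [word K], so J may be replaced by the
   chosen reduced word of the same element. *)
have lead K : all (mem Y) K -> size K = size J -> dmzs K (b v) 1%g =
    (- 1) ^+ size K * b v (1 * word K)%g * \prod_(c in inversions (word K)^-1%g) xi (weyl_root 1%g c).
  move=> KY Ks; apply: (dmzs_lead hPi hY (k := ninv v)) => //; first by move=> z; apply: b0.
  by rewrite ninv1 Ks.
rewrite lead // -{1}IE; rewrite -Jr -Is in lead *.
have := lead (I (word J)) IY erefl; rewrite IE => <-.
have [_ be] := bP v vY; rewrite -/(eps I (word J) (b v)) be ?min_reps_in0 //.
by rewrite eq_sym; case: eqP; rewrite ?toQ0 ?toQ1.
Qed.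

End Expansion.

(** * Matsumoto's argument modulo shorter words *)

Section Matsumoto.
Variables (R : comNzRingType) (F : formal_group_law R).
Variables (L : zmodType) (D : root_datum L) (Pi : {set root_type D}).
Hypotheses (hPi : simple_system Pi) (hreg : forall a : root_type D, GRing.lreg (x_root F a)).
Local Notation T := (root_type D).
Local Notation W := (weyl D).
Local Notation S := (fga F L).
Local Notation Q := (fga_loc F D).
Local Notation s_ := (@weyl_reflection L D).
Local Notation toQ := (@to_loc R F L D).
Local Notation xq := (xq F).
Local Notation xi := (xi F).
Local Notation word := (@weyl_word L D).
Local Notation ninv := (ninv Pi).
Local Notation inversions := (inversions Pi).
Local Notation char s w := (toQ (fga_act w s)).
Implicit Types (a b c k : T) (u v w y : W) (f g : W -> Q) (U V K : seq T) (s : S).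
Implicit Types (P : (W -> Q) -> W -> Q).

Variable X : {set T}.
Hypothesis hX : X \subset Pi.

(* S acts on functions by multiplication with w |-> w(s). *)
Inductive lower n : ((W -> Q) -> W -> Q) -> Prop :=
| LowerWord U : all (mem X) U -> (size U < n)%N -> lower n (dmzs U)
| LowerZero : lower n (fun _ _ => 0)
| LowerAdd P P' : lower n P -> lower n P' -> lower n (fun f w => P f w + P' f w)
| LowerScale s P : lower n P -> lower n (fun f w => char s w * P f w).

Lemma lower_sub n P P' : lower n P -> lower n P' -> lower n (fun f w => P f w - P' f w).
Proof.
move=> lP lP'; have -> : (fun f w => P f w - P' f w) = fun f w => P f w + char (- 1) w * P' f w.
  by apply/funext => f; apply/funext => w; rewrite rmorphN rmorph1 toQN toQ1 mulN1r.
by apply: LowerAdd => //; apply: LowerScale.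
Qed.

Lemma lower_sum n (r : seq W) (B : pred W) (t : W -> S) (G : W -> (W -> Q) -> W -> Q) :
  (forall v, B v -> lower n (fun f w => char (t v) w * G v f w)) ->
  lower n (fun f w => \sum_(v <- r | B v) char (t v) w * G v f w).
Proof.
move=> lG; elim: r => [|v r IH].
  by under eq_fun do [under eq_fun do rewrite big_nil]; apply: LowerZero.
have [Bv|nB] := boolP (B v).
  by under eq_fun do [under eq_fun do rewrite big_cons Bv]; apply: LowerAdd => //; apply: lG.
by under eq_fun do [under eq_fun do rewrite big_cons (negPf nB)].
Qed.

Lemma lower_leq m n P : (m <= n)%N -> lower m P -> lower n P.
Proof.
move=> mn; elim=> {P} [U UX lt||P P' _ lP _ lP'|s P _ lP].
- by apply: LowerWord => //; apply: leq_trans mn.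
- exact: LowerZero.
- exact: LowerAdd.
exact: LowerScale.
Qed.

Lemma dmz_char k s h w s' : s - fga_act (s_ k) s = x_root F k * s' ->
  dmz k (fun w => char s w * h w) w =
  char s' w * h w + char (fga_act (s_ k) s) w * dmz k h w.
Proof.
move=> sE; rewrite /dmz -fga_actM.
have cE : char (fga_act (s_ k) s) w = char s w - xq (weyl_root w k) * char s' w.
  by rewrite xq_char -toQM -rmorphM -sE rmorphB toQB subKr.
rewrite fga_actM cE.
transitivity (xi (weyl_root w k) * xq (weyl_root w k) * (char s' w * h w) +
  (char s w - xq (weyl_root w k) * char s' w) * (xi (weyl_root w k) * (h w - h (w * s_ k)%g)));
  last by rewrite xiK mul1r.
have xx := xiK F (weyl_root w k).
transitivity (xi (weyl_root w k) * xq (weyl_root w k) * (char s' w * h w)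
  + xi (weyl_root w k) * (char s w - xq (weyl_root w k) * char s' w) * (h w - h (w * s_ k)%g)); last by ring.
ring.
Qed.

Lemma lower_dmz k n P : k \in X -> lower n P -> lower n.+1 (fun f => dmz k (P f)).
Proof.
move=> kX; elim=> {P} [U UX lt||P P' _ lP _ lP'|s P lP0 lP].
- by apply: (@LowerWord _ (k :: U)); rewrite //= kX.
- have -> : (fun f => dmz k (fun=> 0)) = (fun (f : W -> Q) (w : W) => 0 : Q).
    by apply/funext => f; apply/funext => w; rewrite /dmz subrr mulr0.
  exact: LowerZero.
- have -> : (fun f => dmz k (fun w => P f w + P' f w)) = fun f w => dmz k (P f) w + dmz k (P' f) w.
    by apply/funext => f; rewrite dmzD.
  exact: LowerAdd.
have [s' sE] := fga_act_cong k s.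
have -> : (fun f => dmz k (fun w => char s w * P f w)) =
    fun f w => char s' w * P f w + char (fga_act (s_ k) s) w * dmz k (P f) w.
  by apply/funext => f; apply/funext => w; apply: dmz_char.
by apply: LowerAdd; apply: LowerScale => //; apply: lower_leq lP0.
Qed.

Lemma lower_dmzs U n P : all (mem X) U -> lower n P -> lower (size U + n) (fun f => dmzs U (P f)).
Proof. by move=> + lP; elim: U => //= k U IH /andP[kX /IH]; apply: lower_dmz. Qed.

Lemma lower_comp k n P : k \in X -> lower n P -> lower n.+1 (fun f => P (dmz k f)).
Proof.
move=> kX; elim=> {P} [U UX lt||P P' _ lP _ lP'|s P _ lP].
- have -> : (fun f => dmzs U (dmz k f)) = dmzs (rcons U k) by apply/funext => f; rewrite dmzs_rcons.
  by apply: LowerWord; rewrite ?all_rcons ?size_rcons //= kX.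
- exact: LowerZero.
- exact: LowerAdd.
exact: LowerScale.
Qed.

(** B_k B_k = (1/x_k + 1/x_(-k)) B_k, with a coefficient in S. *)
Lemma lower_dmz_sqr U k : all (mem X) U -> k \in X ->
  lower (size U).+2 (fun f => dmzs U (dmz k (dmz k f))).
Proof.
move=> UX kX; have [s sE] := intQ_xi_opp F k.
have -> : (fun f => dmzs U (dmz k (dmz k f))) =
    fun f => (fun f => dmzs U (fun w => char s w * f w)) (dmz k f).
  apply/funext => f; congr (dmzs U); apply/funext => w; rewrite {1}/dmz.
  rewrite -loc_act_toQ -sE loc_actD !loc_act_xi // weyl_root_opp.
  have -> : dmz k f (w * s_ k)%g = xi (root_opp (weyl_root w k)) * (f (w * s_ k)%g - f w).
    by rewrite /dmz mulgKs weyl_rootM -[weyl_root (s_ k) k]/(root_opp k) weyl_root_opp.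
  by rewrite /dmz; ring.
apply: (lower_comp kX (P := fun f => dmzs U (fun w => char s w * f w))); rewrite -addn1.
apply: (lower_dmzs (P := fun f w => char s w * f w)) => //.
by apply: LowerScale; apply: (@LowerWord _ [::]).
Qed.

Definition reduced U := ninv (word U) = size U.

Lemma reduced_rcons U k : all (mem Pi) U -> k \in Pi -> reduced (rcons U k) ->
  reduced U /\ ~~ posb Pi (weyl_root (word U * s_ k)%g k).
Proof.
rewrite /reduced word_rcons size_rcons posb_mulr_simple // negbK => UPi kPi E.
have le := ninv_word hPi UPi.
have [pk|nk] := boolP (posb Pi (weyl_root (word U) k)).
  by split=> //; move: E; rewrite ninv_mulr // => -[].
by have := ninv_mulrN hPi kPi nk; rewrite E => E'; move: le; rewrite E' ltnNge leqnSn.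
Qed.

Lemma reduced_cat U V : ninv (word U * word V)%g = (ninv (word U) + ninv (word V))%N ->
  reduced U -> reduced V -> reduced (U ++ V).
Proof. by move=> E rU rV; rewrite /reduced word_cat E rU rV size_cat. Qed.

(** Thanks to the point function of the dihedral group both words expand in the chosen reduced
    words, with the same leading term. *)
Lemma braid a b U V : a \in X -> b \in X -> a != b ->
    all (mem [set a; b]) U -> all (mem [set a; b]) V -> reduced U -> reduced V -> word U = word V ->
  lower (size U) (fun f w => dmzs U f w - dmzs V f w).
Proof.
move=> aX bX ab UY VY rU rV UV; have YX : [set a; b] \subset X.
  by apply/subsetP => c; rewrite !inE => /orP[] /eqP ->.
have hY := subset_trans YX hX; have [aPi bPi] := (subsetP hX _ aX, subsetP hX _ bX).
have [I hI] := reduced_words_exist hPi hY.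
have [w0 lw0] := longest_exists hPi hY; have w0V := longest_invg hPi hY lw0.
pose p0 := \prod_(c in inversions w0) xq c.
pose pt w : Q := if w == w0 then p0 else 0.
have w0Y : w0 \in parabolic [set a; b] by case: lw0.
have dpt : dual_on [set a; b] pt.
  (* The function of [rank2_point] is supported at 1; right translation by w0 moves it to w0. *)
  have -> : pt = fun w => if (w * w0)%g == 1%g then p0 else 0.
    by apply/funext => w; rewrite /pt -[in LHS]w0V eq_mulgV1 invgK.
  exact: (dual_on_shift w0Y (rank2_point hPi hreg aPi bPi ab lw0)).
have hp0 : unitQ (p0 * \prod_(c in inversions w0^-1%g) xi c).
  have -> : p0 * \prod_(c in inversions w0^-1%g) xi c = 1.
    by rewrite w0V -big_split big1 //= => c _; apply: xqK.
  exact: unitQ1.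
have normal Z : all (mem [set a; b]) Z -> reduced Z ->
    lower (size Z) (fun f w => dmzs Z f w - dmzs (I (word Z)) f w).
  move=> ZY rZ; have zY := word_parabolic ZY.
  have [t [tE t0 t1]] := word_expansion hPi hreg hY hI lw0 (fun w _ => erefl) dpt hp0 ZY.
  have -> : (fun f w => dmzs Z f w - dmzs (I (word Z)) f w) = fun f w =>
      \sum_(v in parabolic [set a; b] | v != word Z) char (t v) w * dmzs (I v) f w.
    apply/funext => f; apply/funext => w; rewrite tE (bigD1 (word Z)) //= t1 // eqxx.
    by rewrite rmorph1 toQ1 mul1r addrAC subrr add0r.
  apply: lower_sum => v /andP[vY vZ]; have [IY IE Is] := hI v vY.
  have zero : t v = 0 -> lower (size Z) (fun f w => char (t v) w * dmzs (I v) f w).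
    move=> ->; have -> : (fun f w => char 0 w * dmzs (I v) f w) = fun _ _ => 0.
      by apply/funext => f; apply/funext => w; rewrite rmorph0 toQ0 mul0r.
    exact: LowerZero.
  have [lt|gt|E] := ltngtP (ninv v) (size Z).
  - apply/LowerScale/LowerWord; last by rewrite Is.
    by apply: sub_all IY => c; apply: (subsetP YX).
  - exact/zero/t0.
  by apply: zero; rewrite t1 // (negPf vZ).
have sE : size U = size V by rewrite -rU -rV UV.
have := lower_sub (normal U UY rU) (_ : lower (size U) _); rewrite UV.
move=> /(_ (fun f w => dmzs V f w - dmzs (I (word V)) f w)).
have -> : (fun f w => dmzs U f w - dmzs (I (word V)) f w - (dmzs V f w - dmzs (I (word V)) f w))
   = fun f w => dmzs U f w - dmzs V f w.
  by apply/funext => f; apply/funext => w; ring.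
by apply; rewrite sE; apply: normal.
Qed.

(** If the last letters i and j differ, write the element as v u with u in the dihedral group of i
    and j; then u has reduced words ending in i and in j. With K a reduced word of v one passes from
    U to K Zi i, to K Zj j, to V: the outer steps cancel a common last letter, the middle one is
    [braid]. *)
Lemma matsumoto U V : all (mem X) U -> all (mem X) V -> reduced U -> reduced V -> word U = word V ->
  lower (size U) (fun f w => dmzs U f w - dmzs V f w).
Proof.
move: {2}(size U) (erefl (size U)) => n; elim: n U V => [|n IH] U V Un UX VX rU rV UV.
  have Vn : size V = 0%N by rewrite -rV -UV rU.
  rewrite (size0nil Un) (size0nil Vn).
  have -> : (fun f w => dmzs [::] f w - dmzs [::] f w) = fun _ _ => 0.
    by apply/funext => f; apply/funext => w; rewrite subrr.
  exact: LowerZero.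
have sPi Z : all (mem X) Z -> all (mem Pi) Z by apply: sub_all => c; apply: (subsetP hX).
have last_eq A B i : all (mem X) (rcons A i) -> all (mem X) (rcons B i) ->
    reduced (rcons A i) -> reduced (rcons B i) -> word (rcons A i) = word (rcons B i) ->
    size A = n -> lower n.+1 (fun f w => dmzs (rcons A i) f w - dmzs (rcons B i) f w).
  rewrite !all_rcons => /andP[iX AX] /andP[_ BX] rA rB AB An.
  have iPi := subsetP hX _ iX.
  have [rA' _] := reduced_rcons (sPi A AX) iPi rA.
  have [rB' _] := reduced_rcons (sPi B BX) iPi rB.
  have AB' : word A = word B by move: AB; rewrite !word_rcons => /mulIg.
  have := lower_comp iX (IH A B An AX BX rA' rB' AB'); rewrite An.
  by under eq_fun do rewrite -!dmzs_rcons.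
have trans_lower (P1 P2 P3 : (W -> Q) -> W -> Q) : lower n.+1 (fun f w => P1 f w - P2 f w) ->
    lower n.+1 (fun f w => P2 f w - P3 f w) -> lower n.+1 (fun f w => P1 f w - P3 f w).
  move=> l1 l2; have := LowerAdd l1 l2.
  have -> : (fun f w => P1 f w - P2 f w + (P2 f w - P3 f w)) = fun f w => P1 f w - P3 f w.
    by apply/funext => f; apply/funext => w; ring.
  by [].
have Vn : size V = n.+1 by rewrite -rV -UV rU.
rewrite Un; case/lastP: U Un UX rU UV => // A i; case/lastP: V Vn VX rV => // B j.
rewrite !size_rcons => -[Bn] BX rB [An] AX rA AB.
have [ij|ij] := eqVneq i j; first by rewrite -ij in BX rB AB *; apply: last_eq.
have [iX AX'] : i \in X /\ all (mem X) A by move: AX; rewrite all_rcons => /andP.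
have [jX BX'] : j \in X /\ all (mem X) B by move: BX; rewrite all_rcons => /andP.
have [iPi jPi] := (subsetP hX _ iX, subsetP hX _ jX).
have [_ ni] := reduced_rcons (sPi A AX') iPi rA; have [_ nj] := reduced_rcons (sPi B BX') jPi rB.
move: ni nj; rewrite -!word_rcons -AB => ni nj.
have YX : [set i; j] \subset X by apply/subsetP => c; rewrite !inE => /orP[] /eqP ->.
have hY := subset_trans YX hX.
have [v [u [mv uY wE]]] := min_rep_exists hPi hY (word (rcons A i)).
have uX := subsetP (parabolicS YX) u uY.
have vX : v \in parabolic X.
  by rewrite -(mulgK u v) -wE groupM ?groupV //; apply: word_parabolic.
have [K KX [KE Ks]] := parabolic_reduced_word hPi hX vX.
have nw : ninv (v * u)%g = (ninv v + ninv u)%N by apply: (ninv_min_rep hPi hY).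
have word_ending k : k \in [set i; j] -> ~~ posb Pi (weyl_root (v * u)%g k) ->
    exists Z, [/\ all (mem [set i; j]) (rcons Z k), word (rcons Z k) = u & reduced (rcons Z k)].
  move=> kY; rewrite (min_rep_mul_pos hPi hY mv uY kY) => nk.
  have [|Z ZY [ZE Zs]] := parabolic_reduced_word hPi hY (u := (u * s_ k)%g).
    by rewrite groupM ?mem_refl.
  have wZ : word (rcons Z k) = u by rewrite word_rcons ZE mulgKs.
  exists Z; split=> //; first by rewrite all_rcons /= kY.
  by rewrite /reduced wZ size_rcons Zs; apply: ninv_mulrN => //; apply: (subsetP hY).
rewrite wE in ni nj.
have [Zi [ZiY ZiE rZi]] := word_ending i (set21 i j) ni.
have [Zj [ZjY ZjE rZj]] := word_ending j (set22 i j) nj.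
have sX Z : all (mem [set i; j]) Z -> all (mem X) Z by apply: sub_all => c; apply: (subsetP YX).
have rK : reduced K by rewrite /reduced KE Ks.
have nE : (size K + ninv u)%N = n.+1 by rewrite Ks -nw -wE rA size_rcons An.
have sizeZ k Z : word (rcons Z k) = u -> reduced (rcons Z k) -> size (K ++ Z) = n.
  by move=> ZE; rewrite /reduced ZE size_rcons size_cat => rZ; apply: succn_inj; rewrite -addnS -rZ.
have KZ k Z : all (mem [set i; j]) (rcons Z k) -> word (rcons Z k) = u -> reduced (rcons Z k) ->
    [/\ all (mem X) (rcons (K ++ Z) k), reduced (rcons (K ++ Z) k) & word (rcons (K ++ Z) k) = (v * u)%g].
  move=> ZY ZE rZ; rewrite -!cats1 -catA cats1; split; first by rewrite all_cat KX sX.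
    by apply: reduced_cat => //; rewrite KE ZE.
  by rewrite word_cat KE ZE.
have [KiX rKi KiE] := KZ i Zi ZiY ZiE rZi; have [KjX rKj KjE] := KZ j Zj ZjY ZjE rZj.
apply: (trans_lower _ (dmzs (rcons (K ++ Zi) i))).
  by apply: last_eq => //; rewrite KiE.
apply: (trans_lower _ (dmzs (rcons (K ++ Zj) j))); last first.
  by apply: last_eq => //; rewrite ?KjE -?AB //; apply: (sizeZ j).
have := lower_dmzs KX (braid iX jX ij ZiY ZjY rZi rZj (etrans ZiE (esym ZjE))).
rewrite -rZi ZiE nE.
have -> : (fun f => dmzs K (fun w => dmzs (rcons Zi i) f w - dmzs (rcons Zj j) f w)) =
   fun f w => dmzs (rcons (K ++ Zi) i) f w - dmzs (rcons (K ++ Zj) j) f w.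
  apply/funext => f; rewrite -!cats1 -!catA !cats1 !dmzs_cat.
  have -> : (fun w => dmzs (rcons Zi i) f w - dmzs (rcons Zj j) f w) =
     fun w => \sum_(c <- [:: (1, dmzs (rcons Zi i) f); (- 1, dmzs (rcons Zj j) f)]) c.1 * c.2 w.
    by apply/funext => w; rewrite !big_cons big_nil /= mul1r mulN1r addr0.
  by rewrite dmzs_sum; apply/funext => w; rewrite !big_cons big_nil /= mul1r mulN1r addr0.
by [].
Qed.

(** Take the first letter k after which the word is no longer reduced. Modulo shorter words the
    reduced word before it can be replaced by one ending in k, and then B_k B_k becomes shorter. *)
Lemma nonreduced U : all (mem X) U -> ~ reduced U -> lower (size U) (dmzs U).
Proof.
have sPi Z : all (mem X) Z -> all (mem Pi) Z by apply: sub_all => c; apply: (subsetP hX).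
elim/last_ind: U => [_|V k IH]; first by case; rewrite /reduced word_nil ninv1.
rewrite all_rcons size_rcons => /andP[kX VX] nr; have kPi := subsetP hX _ kX.
have -> : dmzs (rcons V k) = fun f => dmzs V (dmz k f) by apply/funext => f; rewrite dmzs_rcons.
have [rV|rV] := pselect (reduced V); last by apply: lower_comp (IH VX rV).
have [pk|nk] := boolP (posb Pi (weyl_root (word V) k)).
  by case: nr; rewrite /reduced word_rcons size_rcons ninv_mulr // rV.
have vkX : (word V * s_ k)%g \in parabolic X by rewrite groupM ?mem_refl ?word_parabolic.
have [K KX [KE Ks]] := parabolic_reduced_word hPi hX vkX.
have nV := ninv_mulrN hPi kPi nk; rewrite -Ks in nV.
have wK : word (rcons K k) = word V by rewrite word_rcons KE mulgKs.
have rK : reduced (rcons K k) by rewrite /reduced wK nV size_rcons.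
have KX' : all (mem X) (rcons K k) by rewrite all_rcons KX andbT.
have := LowerAdd (lower_comp kX (matsumoto VX KX' rV rK (esym wK))) (_ : lower _ _).
move=> /(_ (fun f => dmzs K (dmz k (dmz k f)))).
have -> : (fun f w => dmzs V (dmz k f) w - dmzs (rcons K k) (dmz k f) w + dmzs K (dmz k (dmz k f)) w)
   = fun f => dmzs V (dmz k f).
  by apply/funext => f; apply/funext => w; rewrite dmzs_rcons subrK.
by apply; rewrite -rV nV; apply: lower_dmz_sqr.
Qed.

Variable I : W -> seq T.
Hypothesis hI : reduced_words Pi X I.

Definition normal P := exists t : W -> S, forall f w,
  P f w = \sum_(v in parabolic X) char (t v) w * dmzs (I v) f w.

Lemma normal_lower n P : (forall U, all (mem X) U -> (size U < n)%N -> normal (dmzs U)) ->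
  lower n P -> normal P.
Proof.
move=> nw; elim=> {P} [U UX lt||P P' _ [t tE] _ [t' tE']|s P _ [t tE]]; first exact: nw.
- exists (fun=> 0) => f w; rewrite big1 // => v _; by rewrite rmorph0 toQ0 mul0r.
- exists (fun v => t v + t' v) => f w; rewrite tE tE' -big_split /=.
  by apply: eq_bigr => v _; rewrite rmorphD toQD mulrDl.
exists (fun v => s * t v) => f w; rewrite tE mulr_sumr.
by apply: eq_bigr => v _; rewrite rmorphM toQM mulrA.
Qed.

Lemma word_normal U : all (mem X) U -> normal (dmzs U).
Proof.
move: {2}(size U) (erefl (size U)) => n; elim/ltn_ind: n U => n IH U Un UX.
have below P : lower n P -> normal P.
  by apply: normal_lower => V VX lt; apply: IH lt V erefl VX.
have [rU|rU] := pselect (reduced U); last by apply: below; rewrite -Un; apply: nonreduced.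
have wX := word_parabolic UX; have [IX IE Is] := hI wX.
have rI : reduced (I (word U)) by rewrite /reduced IE Is.
have [t tE] : normal (fun f w => dmzs U f w - dmzs (I (word U)) f w).
  by apply: below; rewrite -Un; apply: matsumoto.
exists (fun v => t v + (v == word U)%:R) => f w.
transitivity ((dmzs U f w - dmzs (I (word U)) f w) + dmzs (I (word U)) f w); first by rewrite subrK.
rewrite tE [in RHS](eq_bigr (fun v => char (t v) w * dmzs (I v) f w +
  (if v == word U then dmzs (I v) f w else 0))) => [|v _]; last first.
  by rewrite rmorphD toQD mulrDl; congr (_ + _); case: eqP;
    rewrite ?rmorph1 ?rmorph0 ?toQ1 ?toQ0 ?mul1r ?mul0r.
rewrite big_split /=; congr (_ + _); rewrite -big_mkcondr (big_pred1 (word U)) // => v /=.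
by rewrite andbC; case: eqP => // ->.
Qed.

End Matsumoto.

(** * Push-forwards *)

Section Averages.
Variables (R : comNzRingType) (F : formal_group_law R).
Variables (L : zmodType) (D : root_datum L) (Pi : {set root_type D}).
Hypotheses (hPi : simple_system Pi) (hreg : forall a : root_type D, GRing.lreg (x_root F a)).
Local Notation T := (root_type D).
Local Notation W := (weyl D).
Local Notation S := (fga F L).
Local Notation Q := (fga_loc F D).
Local Notation s_ := (@weyl_reflection L D).
Local Notation toQ := (@to_loc R F L D).
Local Notation xq := (@xq R F L D).
Local Notation xi := (@xi R F L D).
Local Notation word := (@weyl_word L D).
Local Notation ninv := (ninv Pi).
Local Notation inversions := (inversions Pi).
Local Notation avg := (avg (F := F) Pi).
Local Notation char s w := (toQ (fga_act w s)).
Implicit Types (a b k : T) (u v w y : W) (f g h : W -> Q) (U V K : seq T) (s : S) (c : Q).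

Section Parabolic.
Variable X : {set T}.
Hypothesis hX : X \subset Pi.

Lemma prod_longest w0 : longest Pi X w0 ->
  (\prod_(b in inversions w0) xq b) * \prod_(b in inversions w0^-1%g) xi b = 1.
Proof.
move=> lw0; rewrite (longest_invg hPi hX lw0) -big_split big1 //= => b _; exact: xqK.
Qed.

Lemma dual_on_point w0 : longest Pi X w0 ->
  dual_on X (fun w => if w == w0 then \prod_(b in inversions w0) xq b else 0).
Proof.
move=> lw0; set pt := fun _ => _ => U UX; have [I hI] := reduced_words_exist hPi hX.
have [t tE] := word_normal hPi hreg hX hI UX; rewrite tE; apply: intQ_sum => v vX.
apply: intQM; first exact: intQ_toQ.
have [IX IE Is] := hI v vX; have w0X : w0 \in parabolic X by case: lw0.
have pt0 z : z \in parabolic X -> (ninv z < ninv w0)%N -> pt z = 0.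
  by move=> zX lt; rewrite /pt; case: eqP lt => // ->; rewrite ltnn.
have := ninv_le_longest hPi hX lw0 vX; rewrite leq_eqVlt => /orP[/eqP nv|lt]; last first.
  by rewrite (dmzs_supp hPi hX pt0) // ?ninv1 ?Is //; apply: intQ0.
rewrite (dmzs_lead hPi hX pt0) // ?ninv1 ?Is // IE mul1g.
rewrite (longest_uniq hPi hX lw0 vX nv) /pt eqxx -mulrA.
rewrite [X in _ * (_ * X)](eq_bigr xi) => [|b _]; last by rewrite weyl_root1.
by rewrite prod_longest // mulr1; apply/intQX/intQN/intQ1.
Qed.

(** Division by the x of w u (a) makes the weight of u symmetric under u |-> u s_a, by
    [prod_sub_neg_mulr], so the two halves of B_a g cancel. *)
Lemma avg_dmz a g w : a \in X -> avg X (dmz a g) w = 0.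
Proof.
move=> aX; have NE u := prod_sub_neg_mulr hPi xi (w * u)%g hX aX.
pose N u := \prod_(b in sub_neg_roots Pi X) xi (weyl_root (w * u)%g b).
rewrite /avg; transitivity (\sum_(u in parabolic X) (N u * xi (weyl_root (w * u)%g a)) * g (w * u)%g -
  \sum_(u in parabolic X) (N u * xi (weyl_root (w * u)%g a)) * g (w * u * s_ a)%g).
  by rewrite -sumrB; apply: eq_bigr => u _; rewrite /dmz /N; ring.
rewrite [X in _ - X](reindex_inj (mulIg (s_ a))) /=.
apply/eqP; rewrite subr_eq0; apply/eqP/eq_big => [u|u uX].
  by rewrite groupMr ?mem_refl.
rewrite /N !mulgA mulgKs (weyl_rootM (w * u)%g (s_ a) a) -[weyl_root (s_ a) a]/(root_opp a).
by congr (_ * _); rewrite -(NE u).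
Qed.

Lemma avg_comb f g c w : avg X (fun w => f w + c * g w) w = avg X f w + c * avg X g w.
Proof.
rewrite /avg mulr_sumr -big_split /=; apply: eq_bigr => u _.
by rewrite mulrDl mulrA.
Qed.

Lemma avg_sum (r : seq W) (B : pred W) (t : W -> Q) (G : W -> W -> Q) w :
  avg X (fun w => \sum_(v <- r | B v) t v * G v w) w = \sum_(v <- r | B v) t v * avg X (G v) w.
Proof.
elim: r => [|v r IH].
  by rewrite big_nil /avg big1 // => u _; rewrite big_nil mul0r.
rewrite big_cons -IH; case: ifP => Bv.
  under [in LHS]eq_fun do rewrite big_cons Bv addrC.
  by rewrite avg_comb addrC.
by under [in LHS]eq_fun do rewrite big_cons Bv.
Qed.

Lemma avg_ltrans v f w : avg X (ltrans v f) w = ltrans v (avg X f) w.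
Proof.
rewrite /avg /ltrans loc_act_sum; apply: eq_bigr => u _.
rewrite loc_actM loc_act_prod mulgA; congr (_ * _).
by apply: eq_bigr => b _; rewrite loc_act_xi // -weyl_rootM !mulgA mulVg mul1g.
Qed.

Lemma avg_ext f g w : w \in parabolic X -> {in parabolic X, f =1 g} -> avg X f w = avg X g w.
Proof. by move=> wX fg; apply: eq_bigr => u uX; rewrite fg // groupM. Qed.

(** A_X is an S-combination of the B_(I_v) because it is integral at 1 on a dual basis: A_X B_U (pt)
    vanishes for nonempty U, and A_X (pt) is 1 at the point 1. *)
Lemma avg_normal I : reduced_words Pi X I -> exists t : W -> S, forall f w,
  avg X f w = \sum_(v in parabolic X) char (t v) w * dmzs (I v) f w.
Proof.
move=> hI; have [w0 lw0] := longest_exists hPi hX.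
have hI' w : w \in min_reps_in Pi X set0 -> [/\ all (mem X) (I w), word (I w) = w & size (I w) = ninv w].
  by rewrite (min_reps_in0 hPi); apply: hI.
pose p0 := \prod_(b in inversions w0) xq b.
pose pt w : Q := if w == w0 then p0 else 0.
have p01 := prod_longest lw0.
have up : unitQ (p0 * \prod_(b in inversions w0^-1%g) xi b) by rewrite p01; apply: unitQ1.
pose C f := dual_on X f /\ intQ (avg X f 1%g).
have dpt : dual_on X pt := dual_on_point lw0.
have w0X : w0 \in parabolic X by case: lw0.
have [||||b] := @dual_basis R F L D Pi hPi X hX set0 (sub0set _) I hI' w0 p0 lw0 up pt (fun w _ => erefl) C.
- move=> U UX; rewrite avg_set0 //; split; first exact: dual_on_dmzs.
  case: U UX => [_|a U /andP[aX _]]; last by rewrite /= avg_dmz //; apply: intQ0.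
  rewrite /avg (bigD1 w0) //= [X in _ + X]big1 => [|u /andP[_ uw]]; last first.
    by rewrite mul1g /pt (negPf uw) mul0r.
  rewrite addr0 (prod_inv_longest hPi xi 1%g hX lw0) mul1g /pt eqxx.
  rewrite [X in _ * X](eq_bigr xi) => [|b' _]; last by rewrite weyl_root1.
  by rewrite p01; apply: intQ1.
- split; first exact/dual_on_cst/intQ0.
  by rewrite /avg big1 => [|u _]; [apply: intQ0 | rewrite mul0r].
- move=> f g c ic [df af] [dg ag]; split; first by apply: dual_onD => //; apply: dual_onZ.
  by rewrite avg_comb; apply: intQD => //; apply: intQM.
- by move=> f [].
rewrite (min_reps_in0 hPi) => bP.
have inv0 f : right_inv X set0 f.
  by move=> w u _; rewrite /parabolic /= imset0 gen0 inE => /eqP ->; rewrite mulg1.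
have tP v : exists s, v \in parabolic X -> avg X (b v) 1%g = toQ s.
  have [vX|_] := boolP (v \in parabolic X); last by exists 0.
  by have [[_ [s sE]] _] := bP v vX; exists s.
pose t v := projT1 (cid (tP v)).
have tE v : v \in parabolic X -> avg X (b v) 1%g = toQ (t v) by apply: (projT2 (cid (tP v))).
have expand f : avg X f 1%g = \sum_(v in parabolic X) toQ (t v) * dmzs (I v) f 1%g.
  have fE : {in parabolic X, f =1 fun y => \sum_(v in parabolic X) dmzs (I v) f 1%g * b v y}.
    move=> y yX; have := dual_expansion hPi hX (sub0set _) hI' _ (inv0 f) yX (b := b).
    rewrite (min_reps_in0 hPi); apply => v vX; split; first exact: inv0.
    by have [_ be] := bP v vX; move=> w wX; apply: be.
  rewrite (avg_ext (group1 _) fE) avg_sum.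
  by apply: eq_bigr => v vX; rewrite tE // mulrC.
exists t => f w; rewrite -(ltrans1 w (avg X f)) -avg_ltrans expand loc_act_sum.
by apply: eq_bigr => v vX; rewrite loc_actM loc_act_toQ -dmzs_at.
Qed.

Lemma dual_on_avg (Y : {set T}) f : X \subset Y -> dual_on Y f -> dual_on Y (avg X f).
Proof.
move=> XY df; have [I hI] := reduced_words_exist hPi hX.
have [t tE] := avg_normal hI.
have -> : avg X f = fun w => \sum_(v in parabolic X) 1 * (char (t v) w * dmzs (I v) f w).
  by apply/funext => w; rewrite tE; apply: eq_bigr => v _; rewrite mul1r.
apply: (@dual_on_sum _ _ _ _ _ _ _ _ (fun=> 1) (fun v w => char (t v) w * dmzs (I v) f w))
  => [v _|v vX]; first exact: intQ1.
apply: dual_onM; first exact: dual_on_char.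
have [IX _ _] := hI v vX; apply: dual_on_dmzs df.
by apply: sub_all IX => c; apply: (subsetP XY).
Qed.

End Parabolic.
End Averages.

(** * Functions on cosets and their trace to a point *)

Section Cosets.
Variables (R : comNzRingType) (F : formal_group_law R).
Variables (L : zmodType) (D : root_datum L) (Pi : {set root_type D}).
Hypothesis hPi : simple_system Pi.
Local Notation T := (root_type D).
Local Notation W := (weyl D).
Local Notation S := (fga F L).
Local Notation Q := (fga_loc F D).
Local Notation s_ := (@weyl_reflection L D).
Local Notation xq := (@xq R F L D).
Local Notation xi := (@xi R F L D).
Local Notation ninv := (ninv Pi).
Local Notation inversions := (inversions Pi).
Local Notation avg := (avg (F := F) Pi).
Implicit Types (a b k : T) (u v w y : W) (f g h : W -> Q) (U V K : seq T) (s : S) (c : Q).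

Section CosetSpace.
Variable X : {set T}.

Lemma coset_classM w u : u \in parabolic X -> coset_class X (w * u)%g = coset_class X w.
Proof. by move=> uX; apply: val_inj; rewrite /= !lcosetE; apply/lcoset_eqP; rewrite mem_lcoset mulKg. Qed.

Lemma coset_rep_class w : exists2 u, u \in parabolic X & coset_rep (coset_class X w) = (w * u)%g.
Proof.
have : coset_rep (coset_class X w) \in (w *: parabolic X)%g.
  by rewrite /coset_rep /= lcosetE; apply: (mem_repr w); apply: lcoset_refl.
by case/lcosetP => u uX E; exists u.
Qed.

Lemma coset_repK (C : coset_space X) : coset_class X (coset_rep C) = C.
Proof.
have [w _ CE] := lcosetsP (valP C).
have -> : C = coset_class X w by apply: val_inj; rewrite /= lcosetE.
by have [u uX ->] := coset_rep_class w; rewrite coset_classM.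
Qed.

Lemma sum_cosets (G : W -> Q) :
  \sum_w G w = \sum_(C : coset_space X) \sum_(u in parabolic X) G (coset_rep C * u)%g.
Proof.
rewrite (partition_big (coset_class X) xpredT) //=; apply: eq_bigr => C _.
rewrite (reindex_inj (mulgI (coset_rep C))) /=; apply: eq_bigl => u.
apply/eqP/idP => [E|uX]; last by rewrite coset_classM // coset_repK.
have := congr1 val (etrans E (esym (coset_repK C))) ; rewrite /= !lcosetE => /lcoset_eqP.
by rewrite mem_lcoset mulKg.
Qed.

Definition pull (f : {ffun coset_space X -> Q^o}) : W -> Q := fun w => f (coset_class X w).

Lemma pull_inj (f g : {ffun coset_space X -> Q^o}) : pull f = pull g -> f = g.
Proof.
move=> fg; apply/ffunP => C; rewrite -(coset_repK C).
exact: (congr1 (fun h => h (coset_rep C)) fg).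
Qed.

Lemma pull_inv (Y : {set T}) (f : {ffun coset_space X -> Q^o}) : right_inv Y X (pull f).
Proof. by move=> w u _ uX; rewrite /pull coset_classM. Qed.

End CosetSpace.

Section Trace.
Variable X : {set T}.
Hypothesis hX : X \subset Pi.
Local Notation rel := (sub_neg_roots Pi Pi :\: sub_neg_roots Pi X).

Lemma prod_rel_invariant w u : u \in parabolic X ->
  \prod_(b in rel) xi (weyl_root (w * u)%g b) = \prod_(b in rel) xi (weyl_root w b).
Proof.
case/parabolic_word=> U UX <-; elim/last_ind: U UX w => [|U a IH].
  by move=> _ w; rewrite word_nil mulg1.
rewrite all_rcons word_rcons => /andP[aX UX] w; rewrite mulgA -[RHS](IH UX).
have aPi := subsetP hX _ aX; rewrite [RHS](reindex_inj (@weyl_root_inj _ _ (s_ a))) /=.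
apply: eq_big => b; last by rewrite weyl_rootM.
have relE (c : T) : (c \in rel) =
    (c \in sub_neg_roots Pi Pi :\ root_opp a) && (c \notin sub_neg_roots Pi X :\ root_opp a).
  rewrite in_setD !in_setD1 negb_and negbK; case: eqP => [->|_] /=; last by rewrite andbC.
  by rewrite (mem_sub_neg_opp hPi hX aX).
by rewrite !relE !sub_neg_roots_mul.
Qed.

(** The single coefficient of A_(Pi / X) h, for h constant on the cosets of W_X; see [pairingE]. *)
Definition trace (h : W -> Q) : Q :=
  \sum_(C : coset_space X) h (coset_rep C) * \prod_(b in rel) xi (weyl_root (coset_rep C) b).

(** Transitivity of push-forwards, A_(Pi / X) A_X = A_Pi. *)
Lemma trace_avg g : trace (avg X g) = avg Pi g 1%g.
Proof.
rewrite {2}/avg (eq_bigl xpredT) => [|u]; last by rewrite parabolicT.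
under eq_bigr do rewrite mul1g.
rewrite (sum_cosets X (fun u => g u * \prod_(b in sub_neg_roots Pi Pi) xi (weyl_root u b))).
apply: eq_bigr => C _; rewrite /avg mulr_suml; apply: eq_bigr => u uX.
rewrite -mulrA; congr (_ * _).
rewrite [RHS](big_setID (sub_neg_roots Pi X)) /= (setIidPr (sub_neg_rootsS hPi hX)).
by rewrite -(prod_rel_invariant (coset_rep C) uX).
Qed.

Lemma avgM g h w : right_inv Pi X h -> avg X (fun w => g w * h w) w = avg X g w * h w.
Proof.
move=> hi; rewrite /avg mulr_suml; apply: eq_bigr => u uX.
rewrite (hi w u (parabolicT hPi w) uX); ring.
Qed.

(** The projection formula for A_X followed by transitivity. *)
Lemma trace_avgM g h : right_inv Pi X h ->
  trace (fun w => avg X g w * h w) = avg Pi (fun w => g w * h w) 1%g.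
Proof. by move=> hi; rewrite -trace_avg; apply: eq_bigr => C _; rewrite avgM. Qed.

Lemma trace_sum (r : seq W) (B : pred W) (t : W -> Q) (G : W -> W -> Q) :
  trace (fun w => \sum_(v <- r | B v) t v * G v w) = \sum_(v <- r | B v) t v * trace (G v).
Proof.
rewrite /trace; under eq_bigr do rewrite mulr_suml.
rewrite exchange_big /=; apply: eq_bigr => v _; rewrite mulr_sumr.
by apply: eq_bigr => C _; rewrite mulrA.
Qed.

End Trace.

(** With h' (w) = h (w s_k) one has (B_k f) h - f (B_k h) = B_k (f h'), and A_Pi vanishes on the
    image of B_k. *)
Lemma avg_adjoint k f h : k \in Pi ->
  avg Pi (fun w => dmz k f w * h w) 1%g = avg Pi (fun w => f w * dmz k h w) 1%g.
Proof.
move=> kPi; apply/eqP; rewrite -subr_eq0; apply/eqP.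
rewrite -(avg_dmz hPi (subxx _) (fun w => f w * h (w * s_ k)%g) 1%g kPi).
have -> : dmz k (fun w => f w * h (w * s_ k)%g) = fun w => dmz k f w * h w + (-1) * (f w * dmz k h w).
  by apply/funext => w; rewrite /dmz mulgKs; ring.
by rewrite avg_comb mulN1r.
Qed.

Lemma avg_adjoint_word U f h : all (mem Pi) U ->
  avg Pi (fun w => dmzs (rev U) f w * h w) 1%g = avg Pi (fun w => f w * dmzs U h w) 1%g.
Proof.
elim: U f => [//|k U IH] f /= /andP[kPi UPi].
rewrite rev_cons; under eq_fun do rewrite dmzs_rcons.
by rewrite IH // avg_adjoint.
Qed.

End Cosets.

(** * The pairing *)

Section Bridge.
Variables (R : comNzRingType) (F : formal_group_law R).
Variables (L : zmodType) (D : root_datum L) (Pi : {set root_type D}).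
Local Notation T := (root_type D).
Local Notation W := (weyl D).
Local Notation S := (fga F L).
Local Notation Q := (fga_loc F D).
Local Notation s_ := (@weyl_reflection L D).
Local Notation toQ := (@to_loc R F L D).
Local Notation xq := (@xq R F L D).
Local Notation xi := (@xi R F L D).
Local Notation avg := (avg (F := F) Pi).
Local Notation char s w := (toQ (fga_act w s)).
Local Notation QW := {ffun W -> Q^o}.
Implicit Types (a b k : T) (u v w y : W) (g h : W -> Q) (U V K : seq T) (s : S) (c : Q) (z : QW).

(** The action of Q_W on plain functions. It is multiplicative in z ([qw_opM]), which reduces
    statements on D_F to its generators. *)
Definition qw_op z g : W -> Q := fun w => \sum_u loc_act w (z u : Q) * g (w * u)%g.

Lemma qw_opD z z' g w : qw_op (z + z') g w = qw_op z g w + qw_op z' g w.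
Proof.
rewrite /qw_op -big_split; apply: eq_bigr => u _.
by rewrite ffunE loc_actD mulrDl.
Qed.

Lemma qw_op_sum (J : Type) (r : seq J) (B : pred J) (z : J -> QW) g w :
  qw_op (\sum_(j <- r | B j) z j) g w = \sum_(j <- r | B j) qw_op (z j) g w.
Proof.
elim/big_rec2: _ => [|j x y _ <-]; last by rewrite qw_opD.
by rewrite /qw_op big1 // => u _; rewrite ffunE loc_act0 mul0r.
Qed.

Lemma qw_op_basis c v g w : qw_op (c *: fbasis F D v) g w = loc_act w c * g (w * v)%g.
Proof.
rewrite /qw_op (bigD1 v) //= big1 => [|u uv]; last first.
  by rewrite !ffunE (negPf uv) scaler0 loc_act0 mul0r.
by rewrite !ffunE eqxx addr0; congr (loc_act _ _ * _); apply: mulr1.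
Qed.

Lemma fbasisE v : fbasis F D v = (1 : Q) *: (fbasis F D v : QW).
Proof. by rewrite scale1r. Qed.

Lemma qw_opM z z' g w : qw_op (qw_mul z z') g w = qw_op z (qw_op z' g) w.
Proof.
rewrite /qw_mul qw_op_sum; apply: eq_bigr => v _; rewrite qw_op_sum mulr_sumr.
apply: eq_bigr => u _; rewrite qw_op_basis loc_actM -loc_act_comp mulgA mulrA.
by [].
Qed.

Lemma qw_op1 g w : qw_op (fbasis F D 1%g) g w = g w.
Proof. by rewrite fbasisE qw_op_basis loc_act1 mul1r mulg1. Qed.

Lemma qw_op_X a g w : qw_op (demazure_X F a) g w = dmz a g w.
Proof.
have -> : demazure_X F a = xi a *: (fbasis F D 1%g - fbasis F D (s_ a)) by [].
rewrite scalerBr -scaleNr qw_opD.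
apply: etrans (congr2 +%R (qw_op_basis _ _ _ _) (qw_op_basis _ _ _ _)) _.
by rewrite mulg1 [loc_act w (- _)]loc_actN loc_act_xi /dmz mulNr mulrBr.
Qed.

Lemma qw_op_word U g : qw_op (demazure_word F U) g = dmzs U g.
Proof.
elim: U => [|a U IH]; apply/funext => w; first exact: qw_op1.
by rewrite /= qw_opM qw_op_X IH.
Qed.

Lemma qw_actE z (f : QW) w : qw_act z f w = qw_op z f w.
Proof.
rewrite ffunE /dual_eval -[RHS]mul1r -[1 * _]/(1 * qw_op z f w).
transitivity (qw_op (qw_mul (fbasis F D w) z) f 1%g).
  by apply: eq_bigr => u _; rewrite loc_act_id mul1g.
by rewrite qw_opM fbasisE qw_op_basis loc_act1 mul1g.
Qed.

Lemma demazure_B_wordE U (f : QW) w : demazure_B_word U f w = dmzs U f w.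
Proof.
elim: U w => [//|a U IH] w; rewrite /= /demazure_B qw_actE qw_op_X /dmz.
by rewrite !IH.
Qed.

Lemma dual_eval_proj (X : {set T}) (f : {ffun coset_space X -> Q^o}) z :
  dual_eval f (coset_proj X z) = qw_op z (pull f) 1%g.
Proof.
rewrite /dual_eval /coset_proj; under eq_bigr => C _ do rewrite sum_ffunE mulr_suml.
rewrite exchange_big; apply: eq_bigr => u _; rewrite loc_act_id mul1g.
rewrite (bigD1 (coset_class X u)) //= big1 => [|C Cu].
  by rewrite !ffunE eqxx addr0; congr (_ * _); apply: mulr1.
by rewrite !ffunE (negPf Cu) scaler0 mul0r.
Qed.

Lemma dual_on_qw_op z g : demazure_algebra Pi z -> dual_on Pi g -> dual_on Pi (qw_op z g).
Proof.
move=> dz; elim: dz g => {z} [s|a aPi|z z' _ IH _ IH'|z z' _ IH _ IH'] g dg.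
- have -> : qw_op (toQ s *: fbasis F D 1%g) g = fun w => char s w * g w.
    by apply/funext => w; rewrite qw_op_basis loc_act_toQ mulg1.
  by apply: dual_onM => //; apply: dual_on_char.
- have -> : qw_op (demazure_X F a) g = dmz a g by apply/funext => w; apply: qw_op_X.
  exact: dual_on_dmz.
- have -> : qw_op (z + z') g = fun w => qw_op z g w + qw_op z' g w.
    by apply/funext => w; apply: qw_opD.
  by apply: dual_onD; [apply: IH | apply: IH'].
have -> : qw_op (qw_mul z z') g = qw_op z (qw_op z' g) by apply/funext => w; apply: qw_opM.
by apply: IH; apply: IH'.
Qed.

Lemma demazure_word_algebra U : all (mem Pi) U -> demazure_algebra Pi (demazure_word F U).
Proof.
elim: U => [_|a U IH /andP[aPi /IH aU]] /=.
  by rewrite fbasisE -toQ1; apply: DemazureScalar.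
by apply: DemazureMul => //; apply: DemazureX.
Qed.

(** Dual functions are stable under the generators of D_F, so integrality on the words in the X_a
    implies integrality on all of D_F. *)
Lemma demazure_dualP (X : {set T}) (f : {ffun coset_space X -> Q^o}) :
  demazure_dual Pi f <-> dual_on Pi (pull f).
Proof.
split=> [df U UPi|df _ [z dz ->]]; last first.
  by rewrite dual_eval_proj; apply: dual_on1 (dual_on_qw_op dz df).
rewrite -qw_op_word -dual_eval_proj; apply: df; eexists; last by [].
exact: demazure_word_algebra.
Qed.

Lemma ring_inv_rel w (A : {set T}) :
  ring_inv (loc_act w (toQ (\prod_(a in A) x_root F a))) = \prod_(a in A) xi (weyl_root w a).
Proof.
apply: ring_invP; rewrite loc_act_toQ rmorph_prod toQ_prod -big_split big1 //= => a _.
by rewrite fga_act_root xqK.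
Qed.

End Bridge.

(** * Schubert classes and their dual basis *)

Section Pairing.
Variables (R : comNzRingType) (F : formal_group_law R).
Variables (L : zmodType) (D : root_datum L) (Pi : {set root_type D}).
Hypotheses (hPi : simple_system Pi) (hreg : forall a : root_type D, GRing.lreg (x_root F a)).
Local Notation T := (root_type D).
Local Notation W := (weyl D).
Local Notation S := (fga F L).
Local Notation Q := (fga_loc F D).
Local Notation toQ := (@to_loc R F L D).
Local Notation xq := (@xq R F L D).
Local Notation xi := (@xi R F L D).
Local Notation avg := (avg (F := F) Pi).
Local Notation QW := {ffun W -> Q^o}.
Variable X : {set T}.
Hypothesis hX : X \subset Pi.
Local Notation QX := {ffun coset_space X -> Q^o}.
Local Notation trace := (trace (F := F) Pi X).
Local Notation V := (min_reps Pi X).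
Implicit Types (u v w : W) (s : S).

Lemma pull_push0 (f : QW) : pull (push0 Pi X f) = avg X f.
Proof.
apply/funext => w; rewrite /pull /push0 /push sum_ffunE.
pose G u : Q := f u * \prod_(b in sub_neg_roots Pi X) xi (weyl_root u b) *
  (coset_class X w == coset_class X u)%:R.
transitivity (\sum_u G u).
  rewrite (sum_cosets set0 G); apply: eq_bigr => C _.
  rewrite (big_pred1 1%g) => [|u]; last by rewrite /parabolic /= imset0 gen0 inE.
  by rewrite mulg1 /G !ffunE /x_rel sub_neg_roots0 // setD0 ring_inv_rel.
rewrite (reindex_inj (mulgI w)) /= [RHS]big_mkcond /=; apply: eq_bigr => u _.
rewrite /G; case: ifP => [uX|uX]; first by rewrite coset_classM // eqxx mulr1.
case: eqP => [E|_]; last by rewrite mulr0.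
have := congr1 val E; rewrite /= !lcosetE => /lcoset_eqP.
by rewrite mem_lcoset invMg mulgKV groupV uX.
Qed.

Lemma pairingE (f g : QX) :
  demazure_pairing Pi f g = trace (fun w => pull f w * pull g w) *: fbasis F D (coset_class Pi 1%g).
Proof.
rewrite /demazure_pairing /push /trace scaler_suml; apply: eq_bigr => C _.
rewrite ring_inv_rel /pull coset_repK ffunE; congr (_ *: fbasis F D _).
by rewrite -[coset_rep C]mul1g coset_classM ?parabolicT.
Qed.

Lemma pairing_scalar (f g : QX) s : trace (fun w => pull f w * pull g w) = toQ s ->
  demazure_pairing Pi f g = dual_scalar Pi s.
Proof. by move=> E; rewrite pairingE E. Qed.

Lemma pairing_trace (f g : QX) s : demazure_pairing Pi f g = dual_scalar Pi s ->
  trace (fun w => pull f w * pull g w) = toQ s.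
Proof.
rewrite pairingE /dual_scalar => /ffunP/(_ (coset_class Pi 1%g)).
by rewrite !ffunE eqxx => E; rewrite -[LHS]mulr1 -[RHS]mulr1.
Qed.

Variable I : W -> seq T.
Hypothesis hI : forall w, w \in V -> reduced_word Pi w (I w).

Lemma min_reps_in_Pi : min_reps_in Pi Pi X = V.
Proof. by apply/setP => w; rewrite inE parabolicT. Qed.

Lemma reduced_min_reps w : w \in min_reps_in Pi Pi X ->
  [/\ all (mem Pi) (I w), weyl_word (I w) = w & size (I w) = ninv Pi w].
Proof. by rewrite min_reps_in_Pi => /hI/(reduced_wordP hPi). Qed.

(** Right translation moves the point function from w0 to 1. Its value, a product over the positive
    roots, becomes x_Pi after multiplication by the integral elements x_(-b) / x_b. *)
Lemma dual_on_x_Pi : dual_on Pi (fun w => if w == 1%g then toQ (x_Pi F Pi) else 0).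
Proof.
have [w0 lw0] := longest_exists hPi (subxx Pi).
have := dual_on_shift (parabolicT hPi w0) (dual_on_point hPi hreg (subxx Pi) lw0).
set c := \prod_(b in inversions Pi w0) (xq (root_opp b) * xi b).
have ic : intQ c by apply: intQ_prod => b _; have [] := unitQ_opp hreg b.
move/(dual_onZ ic); congr (dual_on Pi _); apply/funext => w.
rewrite -{2}[w0]mul1g (inj_eq (mulIg w0)); case: eqP => _; last by rewrite mulr0.
rewrite /c -big_split /= /x_Pi toQ_prod [RHS](reindex_inj (inv_inj (@root_oppK L D))) /=.
apply: eq_big => b; last by rewrite -mulrA xiK mulr1.
rewrite neg_rootsE // posbN // negbK (inv_longest hPi (subxx _) lw0) inE.
by rewrite parabolicT // andbT.
Qed.

Definition schubert_class w : QX := push0 Pi X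
  (demazure_B_word (rev (I w)) (toQ (x_Pi F Pi) *: fbasis F D (1%g : W))).

Lemma pull_schubert_class w : pull (schubert_class w) =
  avg X (dmzs (rev (I w)) (fun w => if w == 1%g then toQ (x_Pi F Pi) else 0)).
Proof.
rewrite pull_push0; congr (avg X _); apply/funext => y; rewrite demazure_B_wordE.
congr (dmzs _ _ _); apply/funext => u; rewrite !ffunE.
by case: eqP => _; [apply: mulr1 | apply: mulr0].
Qed.

(** The projection formula and adjointness turn the trace into A_Pi (x_Pi f_e . B_(I_w) h), where
    only the point 1 contributes and x_Pi cancels the denominator. *)
Lemma trace_schubert_class w h : w \in V -> right_inv Pi X h ->
  trace (fun u => pull (schubert_class w) u * h u) = eps I w h.
Proof.
move=> wV hi; rewrite pull_schubert_class trace_avgM //.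
have [IPi _ _] := hI wV; rewrite avg_adjoint_word //.
rewrite /avg (bigD1 1%g) ?group1 //= [X in _ + X]big1 => [|u /andP[_ u1]]; last first.
  by rewrite mul1g (negPf u1) !mul0r.
rewrite addr0 mulg1 eqxx mulrAC sub_neg_rootsT // /x_Pi toQ_prod -big_split /=.
rewrite big1 ?mul1r // => b _; rewrite weyl_root1; exact: xqK.
Qed.

Lemma schubert_class_dual w : w \in V -> demazure_dual Pi (schubert_class w).
Proof.
move=> wV; apply/demazure_dualP; rewrite // pull_schubert_class.
apply: dual_on_avg => //; apply: dual_on_dmzs dual_on_x_Pi.
by rewrite all_rev; have [] := hI wV.
Qed.

(** The integral traces are the reason why the pairing has values in S: on A_X B_U (pt) the trace is
    A_Pi B_U (pt) at 1, which is integral because A_Pi preserves dual functions. *)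
Lemma dual_functions : exists b : W -> W -> Q, forall v, v \in V ->
  [/\ dual_on Pi (b v), right_inv Pi X (b v), intQ (trace (b v)) &
      forall w, w \in V -> eps I w (b v) = (w == v)%:R].
Proof.
have [w0 lw0] := longest_exists hPi (subxx Pi).
have p01 := prod_longest F hPi (subxx Pi) lw0; set p0 := \prod_(b in inversions Pi w0) _ in p01.
have up : unitQ (p0 * \prod_(b in inversions Pi w0^-1%g) xi b) by rewrite p01; apply: unitQ1.
pose pt w : Q := if w == w0 then p0 else 0.
have dpt : dual_on Pi pt := dual_on_point hPi hreg (subxx Pi) lw0.
pose C h := [/\ dual_on Pi h, right_inv Pi X h & intQ (trace h)].
have [||||b bP] := @dual_basis R F L D Pi hPi Pi (subxx _) X hX I reduced_min_reps w0 p0 lw0 up pt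
  (fun w _ => erefl) C.
- move=> U UPi; have dU : dual_on Pi (dmzs U pt) by apply: dual_on_dmzs.
  split; first by apply: dual_on_avg.
    by move=> w u _ uX; apply: avg_invariant.
  by rewrite trace_avg //; apply: (dual_on1 (X := Pi)); apply: dual_on_avg.
- split=> //; first exact/dual_on_cst/intQ0.
  by rewrite /trace big1 => [|K _]; [apply: intQ0 | rewrite mul0r].
- move=> f g c ic [df fi tf] [dg gi tg]; split.
  + by apply: dual_onD => //; apply: dual_onZ.
  + by move=> w u wY uX; rewrite fi // gi.
  have -> : trace (fun w => f w + c * g w) = trace f + c * trace g.
    by rewrite /trace mulr_sumr -big_split /=; apply: eq_bigr => K _; rewrite mulrDl mulrA.
  by apply: intQD => //; apply: intQM.
- by move=> f [].
rewrite min_reps_in_Pi in bP.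
by exists b => v vV; have [[db bi tb] be] := bP v vV.
Qed.

Definition eps_dual v (f : QX) : Prop := demazure_dual Pi f /\
  forall w, w \in V -> eps I w (pull f) = (w == v)%:R.

Lemma is_dual_eltP v (f : QX) : is_dual_elt Pi I v f <-> eps_dual v f.
Proof.
split=> -[df e]; split=> // w wV; move: (e w wV); rewrite dual_eval_proj qw_op_word; exact.
Qed.

(** The function of [dual_functions] descends to the cosets, so a dual element exists and the
    default 0 of [demazure_dual_elt] is not taken. *)
Lemma dual_elt_spec v : v \in V -> eps_dual v (demazure_dual_elt F Pi X I v).
Proof.
move=> vV; have [b bP] := dual_functions; have [db bi _ be] := bP v vV.
rewrite /demazure_dual_elt; case: pselect => [h|]; first by apply/is_dual_eltP; apply: (projT2 (cid h)).
case; exists [ffun C => b v (coset_rep C)]; apply/is_dual_eltP.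
have E : pull [ffun C : coset_space X => b v (coset_rep C) : Q^o] = b v.
  apply/funext => w; rewrite /pull ffunE; have [u uX ->] := coset_rep_class X w.
  exact: (bi w u (parabolicT hPi w) uX).
by split; [apply/demazure_dualP; rewrite // E | rewrite E].
Qed.

Local Notation b := (demazure_dual_elt F Pi X I).

Lemma dual_elt_expansion (f : QX) y : pull f y = \sum_(v in V) eps I v (pull f) * pull (b v) y.
Proof.
have := @dual_expansion _ _ _ _ Pi hPi Pi (subxx _) X hX I reduced_min_reps
  (fun v => pull (b v)) (pull f) _ (@pull_inv R F L D X Pi f) y (parabolicT hPi y).
rewrite min_reps_in_Pi; apply => v vV; split; first exact: pull_inv.
by have [_] := dual_elt_spec vV.
Qed.

Lemma trace_int (h : W -> Q) : dual_on Pi h -> right_inv Pi X h -> intQ (trace h).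
Proof.
move=> dh hi; have [c cP] := dual_functions.
have hE : trace h = trace (fun y => \sum_(v in V) eps I v h * c v y).
  apply: eq_bigr => C _; congr (_ * _).
  have := @dual_expansion _ _ _ _ Pi hPi Pi (subxx _) X hX I reduced_min_reps
    c h _ hi (coset_rep C) (parabolicT hPi _).
  by rewrite min_reps_in_Pi; apply => v vV; have [_ ci _ ce] := cP v vV.
rewrite hE trace_sum; apply: intQ_sum => v vV; have [_ _ tv _] := cP v vV.
by apply: intQM => //; apply: dh; have [] := hI vV.
Qed.

Lemma pairing_int (f g : QX) : demazure_dual Pi f -> demazure_dual Pi g ->
  exists s, demazure_pairing Pi f g = dual_scalar Pi s.
Proof.
move=> /demazure_dualP df /demazure_dualP dg.
have [||s sE] := @trace_int (fun w => pull f w * pull g w).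
- exact: dual_onM.
- by move=> w u wP uX; rewrite !(@pull_inv R F L D X Pi _ w u wP uX).
by exists s; apply: pairing_scalar.
Qed.

Lemma dual_scalar_dual s : demazure_dual Pi (dual_scalar Pi s : {ffun coset_space Pi -> Q^o}).
Proof.
apply/demazure_dualP.
have -> : pull (dual_scalar Pi s : {ffun coset_space Pi -> Q^o}) = fun=> toQ s.
  apply/funext => w; rewrite /pull /dual_scalar !ffunE -{1}[w]mul1g coset_classM ?parabolicT //.
  by rewrite eqxx; apply: mulr1.
exact/dual_on_cst/intQ_toQ.
Qed.

Lemma pairingC (f g : QX) : demazure_pairing Pi f g = demazure_pairing Pi g f.
Proof. by rewrite !pairingE; congr (trace _ *: _); apply/funext => w; rewrite mulrC. Qed.

Lemma eps_inj_pull (f : QX) : (forall w, w \in V -> eps I w (pull f) = 0) -> f = 0.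
Proof.
move=> f0; apply: pull_inj; apply/funext => y; rewrite dual_elt_expansion big1 => [|v vV].
  by rewrite /pull ffunE.
by rewrite f0 // mul0r.
Qed.

Lemma dual_scalar_inj s t : dual_scalar Pi s = dual_scalar Pi t :> {ffun coset_space Pi -> Q^o} -> s = t.
Proof.
move=> /ffunP/(_ (coset_class Pi 1%g)); rewrite !ffunE eqxx => E.
by apply: (toQ_inj hreg); rewrite -[LHS]mulr1 -[RHS]mulr1.
Qed.

Lemma pairing_sum (g : QX) (A : {set W}) (c : W -> S) (f : W -> QX) :
  demazure_pairing Pi (\sum_(w in A) toQ (c w) *: f w) g =
  \sum_(w in A) toQ (c w) *: demazure_pairing Pi (f w) g.
Proof.
have -> : demazure_pairing Pi (\sum_(w in A) toQ (c w) *: f w) g =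
    trace (fun u => \sum_(w in A) toQ (c w) * (pull (f w) u * pull g u)) *: fbasis F D (coset_class Pi 1%g).
  rewrite pairingE; congr (trace _ *: _); apply/funext => u; rewrite /pull sum_ffunE mulr_suml.
  by apply: eq_bigr => w _; rewrite ffunE mulrA.
rewrite trace_sum scaler_suml; apply: eq_bigr => w _.
by rewrite pairingE scalerA.
Qed.

Lemma sum_dual_scalar (c : W -> S) (G : W -> {ffun coset_space Pi -> Q^o}) v :
  v \in V -> (forall u, u \in V -> G u = dual_scalar Pi (u == v)%:R) ->
  \sum_(u in V) toQ (c u) *: G u = dual_scalar Pi (c v).
Proof.
move=> vV GE; transitivity (\sum_(u in V) if u == v then dual_scalar Pi (c v)
    else 0 : {ffun coset_space Pi -> Q^o}).
  apply: eq_bigr => u uV; rewrite (GE u uV) /dual_scalar; case: eqP => [->|_].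
    by rewrite scalerA toQ1 mulr1.
  by rewrite scalerA toQ0 mulr0 scale0r.
rewrite -big_mkcondr (big_pred1 v) // => u /=.
by rewrite andbC; case: eqP => // ->.
Qed.

Lemma pairing_schubert_class w (f : QX) s : w \in V -> eps I w (pull f) = toQ s ->
  demazure_pairing Pi (schubert_class w) f = dual_scalar Pi s.
Proof.
move=> wV E; apply: pairing_scalar; rewrite trace_schubert_class ?E //.
exact: pull_inv.
Qed.

Lemma pairing_dual_bases w v : w \in V -> v \in V ->
  demazure_pairing Pi (schubert_class w) (b v) = dual_scalar Pi (w == v)%:R.
Proof.
move=> wV vV; apply: pairing_schubert_class => //; have [_ ->] := dual_elt_spec vV => //.
by case: eqP; rewrite ?toQ0 ?toQ1.
Qed.

Lemma pairing0 w (f : QX) : w \in V ->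
  demazure_pairing Pi (schubert_class w) f = 0 -> eps I w (pull f) = 0.
Proof.
move=> wV; have -> : 0 = dual_scalar Pi (0 : S) :> {ffun coset_space Pi -> Q^o}.
  by rewrite /dual_scalar toQ0 scale0r.
by move/pairing_trace; rewrite trace_schubert_class ?toQ0 //; apply: pull_inv.
Qed.

(** Pairing with the Schubert classes gives all the functionals [eps I w], and these separate
    functions on the cosets. *)
Lemma pairing_nondegenerate :
  nondegenerate_on (@demazure_dual R F L D Pi X) (@demazure_pairing R F L D Pi X).
Proof.
split=> f _ f0; apply: eps_inj_pull => w wV; apply: pairing0 => //.
  by rewrite pairingC; apply: f0; apply: schubert_class_dual.
by apply: f0; apply: schubert_class_dual.
Qed.

Lemma dual_elt_basis : S_basis (@demazure_dual R F L D Pi X) V b.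
Proof.
split=> [v vV|f df|c c0 v vV]; first by have [] := dual_elt_spec vV.
  have /demazure_dualP dp := df.
  have H v : exists s, v \in V -> eps I v (pull f) = toQ s.
    have [vV|_] := boolP (v \in V); last by exists 0.
    by have [s sE] := dp (I v) (let: And3 h _ _ := hI vV in h); exists s.
  have [c cE] : exists c : W -> S, forall v, v \in V -> eps I v (pull f) = toQ (c v).
    by exists (fun v => projT1 (cid (H v))) => v; apply: (projT2 (cid (H v))).
  exists c; apply: pull_inj; apply/funext => y.
  rewrite dual_elt_expansion /pull sum_ffunE; apply: eq_bigr => v vV.
  by rewrite ffunE (cE v vV).
apply: dual_scalar_inj.
have : demazure_pairing Pi (\sum_(u in V) toQ (c u) *: b u) (schubert_class v) = dual_scalar Pi (c v).
  rewrite pairing_sum; apply: sum_dual_scalar => // u uV.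
  by rewrite pairingC pairing_dual_bases // eq_sym.
rewrite c0 => <-; rewrite pairingE /dual_scalar toQ0 scale0r.
by rewrite /trace big1 ?scale0r // => C _; rewrite /pull ffunE !mul0r.
Qed.

(** The Schubert classes generate: f minus its candidate expansion pairs to zero with the dual
    elements, hence with the Schubert classes, which are combinations of these, and so it
    vanishes. *)
Lemma schubert_class_basis : S_basis (@demazure_dual R F L D Pi X) V schubert_class.
Proof.
have pair_comb (c : W -> S) v : v \in V ->
    demazure_pairing Pi (\sum_(u in V) toQ (c u) *: schubert_class u) (b v) = dual_scalar Pi (c v).
  move=> vV; rewrite pairing_sum; apply: sum_dual_scalar => // u uV.
  exact: pairing_dual_bases.
split=> [v vV|f df|c c0 v vV]; first exact: schubert_class_dual.
  have H v : exists s, v \in V -> demazure_pairing Pi f (b v) = dual_scalar Pi s.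
    have [vV|_] := boolP (v \in V); last by exists 0.
    have [db _] := dual_elt_spec vV.
    by have [s sE] := pairing_int df db; exists s.
  pose c v := projT1 (cid (H v)); exists c.
  have cE v : v \in V -> demazure_pairing Pi f (b v) = dual_scalar Pi (c v) by exact: projT2 (cid (H v)).
  apply/eqP; rewrite -subr_eq0; apply/eqP/eps_inj_pull => w wV; apply: pairing0 => //.
  rewrite pairingC; set g := f - _.
  have gb v : v \in V -> trace (fun u => pull g u * pull (b v) u) = 0.
    move=> vV; have := pairing_trace (cE v vV); have := pairing_trace (pair_comb c v vV).
    set a := \sum_(u in V) _ => ca cf.
    have -> : (fun u => pull g u * pull (b v) u) =
        fun u => \sum_(h <- [:: (1, f); (-1, a)]) h.1 * (pull h.2 u * pull (b v) u).
      apply/funext => u; rewrite !big_cons big_nil /= /pull !ffunE addr0 mul1r mulN1r.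
      by rewrite -mulrBl.
    rewrite /trace; under eq_bigr do rewrite mulr_suml.
    rewrite exchange_big /= !big_cons big_nil /= addr0.
    rewrite -[RHS](subrr (toQ (c v))) -{1}cf -ca /trace -sumrB -big_split /=.
    by apply: eq_bigr => C _; rewrite mul1r mulN1r mulNr.
  rewrite pairingE.
  have -> : (fun u => pull g u * pull (schubert_class w) u) =
      fun u => \sum_(v in V) eps I v (pull (schubert_class w)) * (pull g u * pull (b v) u).
    apply/funext => u; rewrite [pull (schubert_class w) u]dual_elt_expansion mulr_sumr.
    by apply: eq_bigr => v _; rewrite mulrCA.
  rewrite trace_sum big1 ?scale0r // => v vV.
  by rewrite gb // mulr0.
apply: dual_scalar_inj; rewrite -(pair_comb c v vV) c0 pairingE /dual_scalar toQ0 scale0r.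
by rewrite /trace big1 ?scale0r // => C _; rewrite /pull ffunE !mul0r.
Qed.

End Pairing.

Theorem theorem15p6 (R : comNzRingType) (F : formal_group_law R)
    (L : zmodType) (D : root_datum L) (Pi : {set root_type D})
    (hPi : simple_system Pi)
    (hreg : forall a : root_type D, GRing.lreg (x_root F a))
    (Xi : {set root_type D}) (hXi : Xi \subset Pi)
    (I : weyl D -> seq (root_type D))
    (hI : forall w, w \in min_reps Pi Xi -> reduced_word Pi w (I w)) :
  let dualXi := @demazure_dual R F L D Pi Xi in
  let pairing := @demazure_pairing R F L D Pi Xi in
  let a (w : weyl D) := push0 Pi Xi
    (demazure_B_word (rev (I w)) (to_loc D (x_Pi F Pi) *: fbasis F D (1%g : weyl D))) in
  let b (v : weyl D) := demazure_dual_elt F Pi Xi I v in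
  [/\ forall f g, dualXi f -> dualXi g ->
        demazure_dual Pi (pairing f g) /\
        exists s : fga F L, pairing f g = dual_scalar Pi s,
      nondegenerate_on dualXi pairing,
      S_basis dualXi (min_reps Pi Xi) a /\ S_basis dualXi (min_reps Pi Xi) b &
      forall w v, w \in min_reps Pi Xi -> v \in min_reps Pi Xi ->
        pairing (a w) (b v) = dual_scalar Pi (w == v)%:R].
Proof.
move=> dualXi pairing a b; split.
- move=> f g df dg; have [s sE] := pairing_int hPi hreg hXi hI df dg.
  by split; [rewrite /pairing sE; apply: dual_scalar_dual | exists s].
- exact: (pairing_nondegenerate hPi hreg hXi hI).
- by split; [exact: (schubert_class_basis hPi hreg hXi hI) | exact: (dual_elt_basis hPi hreg hXi hI)].
- by move=> w v wV vV; exact: (pairing_dual_bases hPi hreg hXi hI wV vV).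
Qed.
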